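(* Let $(L,e)$ be a Nijenhuis operator with a unity on a manifold $\mathsf M^n$. Assume that at a point $\mathsf p\in\mathsf M^n$ the characteristic polynomial $\chi_{L(\mathsf p)}(\lambda)=\det(\lambda\,\mathrm{Id}-L(\mathsf p))$ factorises as $\chi_{L(\mathsf p)}(\lambda)=\chi_1(\lambda)\chi_2(\lambda)$, where $\chi_1$ and $\chi_2$ are coprime monic (real) polynomials, and put $m_1=\deg\chi_1$, $m_2=\deg\chi_2$. Then in a neighbourhood of $\mathsf p$ there exists a coordinate system $(u_1,u_2)$, $u_1=(u_1^1,\dots,u_1^{m_1})$, $u_2=(u_2^1,\dots,u_2^{m_2})$, such that: 1. $L$ has the block form $$L(u_1,u_2)=\begin{pmatrix}L_1(u_1)&0\\0&L_2(u_2)\end{pmatrix},$$ where $L_i$ depends only on the variables $u_i$ and is a Nijenhuis operator, $i=1,2$; moreover, at the point $\mathsf p$, $\chi_{L_1}(\lambda)=\chi_1(\lambda)$ and $\chi_{L_2}(\lambda)=\chi_2(\lambda)$. 2. The unity vector field decomposes as $e=e_1+e_2$, where $e_i=\sum_{\alpha=1}^{m_i}e_i^\alpha\,\frac{\partial}{\partial u_i^\alpha}$ and each $e_i^\alpha$ depends only on the variables $u_i$. 3. Each $e_i$ is a unity vector field for $L_i$, i.e. $\mathcal L_{e_i}L_i=\mathrm{Id}$, $i=1,2$.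
   Context: Everything is in the smooth or the real-analytic category (the result holds in both). For a field of endomorphisms (operator field) $L$ of $T\mathsf M^n$ the Nijenhuis torsion is $\mathcal N_L(\xi,\eta)=[L\xi,L\eta]+L^2[\xi,\eta]-L[L\xi,\eta]-L[\xi,L\eta]$ for vector fields $\xi,\eta$; $L$ is a Nijenhuis operator if $\mathcal N_L=0$. A pair $(L,e)$ of an operator field $L$ and a vector field $e$ is a Nijenhuis operator with a unity if $L$ is a Nijenhuis operator and $\mathcal L_eL=\mathrm{Id}$ ($\mathcal L_e$ is the Lie derivative along $e$); then $e$ is called a unity vector field for $L$. *)

(* Defs.v *)
From HB Require Import structures.
From mathcomp Require Import all_boot all_order all_algebra.
From mathcomp Require Import all_classical all_reals all_analysis.

Set Implicit Arguments.
Unset Strict Implicit.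
Unset Printing Implicit Defensive.
Import Order.TTheory GRing.Theory Num.Theory.
Import numFieldNormedType.Exports.

Local Open Scope classical_set_scope.
Local Open Scope ring_scope.

Variant category := Smooth | Analytic.

Section Regularity.
Context {R : realType} {n : nat}.
Implicit Types (U : set 'cV[R]_n) (f : 'cV[R]_n -> R).

Fixpoint Ck (k : nat) U f : Prop :=
  match k with
  | 0 => forall x, U x -> {for x, continuous f}
  | k'.+1 => (forall x, U x -> differentiable f x) /\
             (forall v, Ck k' U ('D_v f))
  end.

(* Partial sums over the boxes [0, N]^n of multi-indices, together with
   absolute convergence, encode summation of the multi-indexed family in the
   power series  sum_a c_a h^a. *)
Definition power_term (c : {ffun 'I_n -> nat} -> R) (h : 'cV[R]_n)
    (a : {ffun 'I_n -> nat}) : R :=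
  c a * \prod_i h i ord0 ^+ a i.

Definition box_sum (F : {ffun 'I_n -> nat} -> R) (N : nat) : R :=
  \sum_(a : {ffun 'I_n -> 'I_N.+1}) F [ffun i => val (a i)].

Definition analytic_at f (x : 'cV[R]_n) : Prop :=
  exists (c : {ffun 'I_n -> nat} -> R) (r : R), 0 < r /\
    forall h : 'cV[R]_n, `|h| < r ->
      cvgn (box_sum (fun a => `|power_term c h a|)) /\
      box_sum (power_term c h) @ \oo --> f (x + h).

Definition regular (C : category) U f : Prop :=
  match C with
  | Smooth => forall k, Ck k U f
  | Analytic => forall x, U x -> analytic_at f x
  end.

Definition regular_mx (C : category) U p q (F : 'cV[R]_n -> 'M[R]_(p, q)) :
    Prop :=
  forall i j, regular C U (fun x => F x i j).

End Regularity.

(* Tensor calculus on an open set U of R^n. Vectors are columns, so an operator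
   field L acts on a vector field xi by L xi = (x |-> L x *m xi x). *)
Section LocalFields.
Context {R : realType} {n : nat}.
Implicit Types (U : set 'cV[R]_n) (xi eta e : 'cV[R]_n -> 'cV[R]_n)
  (L : 'cV[R]_n -> 'M[R]_n).

Definition app L xi : 'cV[R]_n -> 'cV[R]_n := fun x => L x *m xi x.

Definition bracket xi eta : 'cV[R]_n -> 'cV[R]_n :=
  fun x => 'd eta x (xi x) - 'd xi x (eta x).

Definition torsion L xi eta : 'cV[R]_n -> 'cV[R]_n := fun x =>
  bracket (app L xi) (app L eta) x + app L (app L (bracket xi eta)) x
  - app L (bracket (app L xi) eta) x - app L (bracket xi (app L eta)) x.

(* (Lie_e L) xi = Lie_e (L xi) - L (Lie_e xi) *)
Definition lie_op e L xi : 'cV[R]_n -> 'cV[R]_n := fun x =>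
  bracket e (app L xi) x - app L (bracket e xi) x.

Definition nijenhuis_on (C : category) U L : Prop :=
  regular_mx C U L /\
  forall xi eta, regular_mx C U xi -> regular_mx C U eta ->
    forall x, U x -> torsion L xi eta x = 0.

Definition unity_on (C : category) U L e : Prop :=
  regular_mx C U e /\
  forall xi, regular_mx C U xi -> forall x, U x -> lie_op e L xi x = xi x.

End LocalFields.

Section Charts.
Context {R : realType}.

(* chart_map and chart_inv are total functions; their values outside
   chart_dom and chart_cod are irrelevant. *)
Record chart (T : topologicalType) (n : nat) := Chart {
  chart_dom : set T;
  chart_cod : set 'cV[R]_n;
  chart_map :> T -> 'cV[R]_n;
  chart_inv : 'cV[R]_n -> T;
  chart_open_dom : open chart_dom;
  chart_open_cod : open chart_cod;
  chart_map_cod : forall q, chart_dom q -> chart_cod (chart_map q);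
  chart_inv_dom : forall x, chart_cod x -> chart_dom (chart_inv x);
  chart_mapK : forall q, chart_dom q -> chart_inv (chart_map q) = q;
  chart_invK : forall x, chart_cod x -> chart_map (chart_inv x) = x;
  chart_map_cont : {within chart_dom, continuous chart_map};
  chart_inv_cont : {within chart_cod, continuous chart_inv} }.

Context {T : topologicalType} {n : nat}.
Implicit Types phi psi : chart T n.

Definition transition phi psi : 'cV[R]_n -> 'cV[R]_n :=
  fun x => psi (chart_inv phi x).

Definition transition_dom phi psi : set 'cV[R]_n :=
  [set x | chart_cod phi x /\ chart_dom psi (chart_inv phi x)].

Definition compatible (C : category) phi psi : Prop :=
  regular_mx C (transition_dom phi psi) (transition phi psi) /\
  regular_mx C (transition_dom psi phi) (transition psi phi).

End Charts.

Arguments chart R T n : clear implicits.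

Record manifold (R : realType) (C : category) (n : nat) := Manifold {
  carrier :> topologicalType;
  carrier_hausdorff : hausdorff_space carrier;
  carrier_second_countable : @second_countable carrier;
  atlas : set (chart R carrier n);
  atlas_cover : forall q : carrier,
    exists phi, atlas phi /\ chart_dom phi q;
  atlas_compatible : forall phi psi,
    atlas phi -> atlas psi -> compatible C phi psi }.

Section Fields.
Context {R : realType} {C : category} {n : nat}.
Variable M : manifold R C n.

(* The charts of the maximal atlas, i.e. the local coordinate systems of M. *)
Definition coordinate_system (phi : chart R M n) : Prop :=
  forall psi, atlas psi -> compatible C phi psi.

Definition coordinates_at (q : M) (phi : chart R M n) : Prop :=
  coordinate_system phi /\ chart_dom phi q.

(* Tensor fields are given by their components in every coordinate system,
   subject to the tensorial transformation law; the components attached to a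
   chart that is not in the maximal atlas are irrelevant. *)
Record vector_field := VectorField {
  vf_comp :> chart R M n -> 'cV[R]_n -> 'cV[R]_n;
  vf_regular : forall phi, coordinate_system phi ->
    regular_mx C (chart_cod phi) (vf_comp phi);
  vf_transform : forall phi psi,
    coordinate_system phi -> coordinate_system psi ->
    forall x, transition_dom phi psi x ->
      'd (transition phi psi) x (vf_comp phi x)
      = vf_comp psi (transition phi psi x) }.

Record operator_field := OperatorField {
  op_comp :> chart R M n -> 'cV[R]_n -> 'M[R]_n;
  op_regular : forall phi, coordinate_system phi ->
    regular_mx C (chart_cod phi) (op_comp phi);
  op_transform : forall phi psi,
    coordinate_system phi -> coordinate_system psi ->
    forall x, transition_dom phi psi x -> forall v : 'cV[R]_n,
      'd (transition phi psi) x (op_comp phi x *m v)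
      = op_comp psi (transition phi psi x) *m 'd (transition phi psi) x v }.

(* The torsion and the Lie derivative are local, hence they are tested against
   vector fields defined on coordinate domains rather than on the whole of M:
   in the analytic category there are no bump functions to extend them. *)
Definition nijenhuis (L : operator_field) : Prop :=
  forall phi, coordinate_system phi -> nijenhuis_on C (chart_cod phi) (L phi).

Definition unity (L : operator_field) (e : vector_field) : Prop :=
  forall phi, coordinate_system phi ->
    unity_on C (chart_cod phi) (L phi) (e phi).

Definition nijenhuis_with_unity (L : operator_field) (e : vector_field) :
    Prop :=
  nijenhuis L /\ unity L e.

(* chi is the characteristic polynomial of the endomorphism L(q) of T_q M,
   which does not depend on the coordinate system used to compute it. *)
Definition char_poly_at (L : operator_field) (q : M) (chi : {poly R}) : Prop :=
  exists phi, coordinates_at q phi /\ char_poly (L phi (phi q)) = chi.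

End Fields.

(* Main.v *)
Require Import Defs.
From HB Require Import structures.
From mathcomp Require Import all_boot all_order all_algebra.
From mathcomp Require Import all_classical all_reals all_analysis.
From mathcomp Require Import ring lra zify.
Set Implicit Arguments.
Unset Strict Implicit.
Unset Printing Implicit Defensive.
Import Order.TTheory GRing.Theory Num.Theory.
Import numFieldNormedType.Exports.

Local Open Scope classical_set_scope.
Local Open Scope ring_scope.

(** Write N(a, b) for the value of the torsion of L on constant fields a and b.
    The torsion is a tensor, so L is a Nijenhuis operator when N vanishes, and
    likewise the unity equation is the pointwise identity
    D_e L - (De) L + L (De) = 1 ([torsionE], [lie_opE]).

    At the point p, coprimality of chi1 and chi2 provides a basis in which L is
    block diagonal with characteristic polynomials chi1 and chi2
    ([block_diagonalization]).  Two blocks without common eigenvalues make the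
    Sylvester operator Z |-> A1 Z - Z A2 invertible ([sylvester_unit]); this is an
    open condition, and it is the algebraic fact behind every step.

    Near p the second invariant subspace is continued as the graph of a matrix
    A(x) solving a Riccati equation whose linearisation is the Sylvester operator
    ([invariant_graph]).  The obstruction to the integrability of this
    distribution is a bilinear form w, and N = 0 becomes an identity for w from
    which two Sylvester operators can be cancelled; hence w = 0
    ([integrability_algebra]).  The Frobenius theorem then holds in an explicit
    form: rays in the base are lifted to the distribution by a flow, the flow at a
    fixed time parametrises the leaves, and its inverse gives first integrals
    whose differentials span an L-invariant codistribution ([leaf_variation],
    [straighten], [first_integrals]).  Exchanging the two factors gives a
    complementary family.  The two families together are coordinates
    ([splitting_map], [inverse_function]) in which L is block diagonal.

    In such coordinates N = 0, evaluated on one vector of each factor, says that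
    the derivative of a block in the variables of the other factor is annihilated
    by a Sylvester operator, and the off-diagonal part of the unity equation says
    the same of the off-diagonal derivatives of e ([block_torsion],
    [block_unity]).  On a ball of the sup norm, a product of balls, each block
    and each component of e therefore depends on its own variables only, and the
    equations restrict to each factor ([slice_fields], [split_fields]).

    The analytic tools are developed for the two categories side by side: closure
    of regular functions under the algebraic operations, composition and
    differentiation, and existence of regular flows.  Analytic functions are
    treated in the Banach algebras of power series with summable coefficients
    ([series_le]), where the Picard iteration converges ([analytic_flow]); smooth
    flows come from the Picard theorem and the Gronwall inequality, with
    differentiability in the initial value by induction through the variational
    equation ([flow_Ck]).  The inverse function theorem follows from the existence
    of flows, by lifting straight lines ([right_inverse]). *)

(** * Derivatives of functions on column spaces *)

Section Columns.
Context {R : realType} {n : nat}.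
Implicit Types (x v : 'cV[R]_n).

Lemma col_normP x (r : R) : 0 <= r ->
  (`|x| <= r) <-> (forall i, `|x i ord0| <= r).
Proof.
move=> r0; rewrite [`|x|]/Num.Def.normr/= mx_normrE; split=> [h i|h].
  by apply: le_trans h; exact: (le_bigmax _ (fun i => `|x i.1 i.2|) (i, ord0)).
by apply: bigmax_le => // -[i j] _; rewrite (ord1 j); exact: h.
Qed.

Lemma col_norm_ltP x (r : R) : 0 < r ->
  (`|x| < r) <-> (forall i, `|x i ord0| < r).
Proof.
move=> r0; rewrite [`|x|]/Num.Def.normr/= mx_normrE; split=> [h i|h].
  by apply: le_lt_trans h; exact: (le_bigmax _ (fun i => `|x i.1 i.2|) (i, ord0)).
by apply: bigmax_lt => // -[i j] _; rewrite (ord1 j); exact: h.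
Qed.

Lemma coord_le_norm x i : `|x i ord0| <= `|x|.
Proof. exact: (col_normP x (normr_ge0 x)).1 (lexx _) i. Qed.

Definition ecol (i : 'I_n) : 'cV[R]_n := delta_mx i ord0.

Lemma col_sumE x : x = \sum_i x i ord0 *: ecol i.
Proof.
apply/colP=> i; rewrite summxE (bigD1 i)//= big1 ?addr0; last first.
  by move=> j /negPf ji; rewrite !mxE eq_sym ji mulr0.
by rewrite !mxE !eqxx mulr1.
Qed.

Lemma derive_coords (f : 'cV[R]_n -> R) x v : differentiable f x ->
  'D_v f x = \sum_i v i ord0 * 'D_(ecol i) f x.
Proof.
move=> df; rewrite deriveE // [in LHS](col_sumE v) linear_sum.
by apply: eq_bigr => i _; rewrite linearZ /= deriveE.
Qed.

End Columns.

Section DirectionLinear.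
Context {R : realType} {V W : normedModType R}.
Implicit Types (f : V -> W).

Lemma deriveDv f x u v :
  differentiable f x -> 'D_(u + v) f x = 'D_u f x + 'D_v f x.
Proof. by move=> df; rewrite !deriveE // linearD. Qed.

Lemma deriveZv f x (k : R) v :
  differentiable f x -> 'D_(k *: v) f x = k *: 'D_v f x.
Proof. by move=> df; rewrite !deriveE // linearZ. Qed.

End DirectionLinear.

Section MatrixValued.
Context {R : realType} {V : normedModType R}.

Lemma differentiable_mxP p q (F : V -> 'M[R]_(p, q)) x :
  differentiable F x <-> forall i j, differentiable (fun y => F y i j) x.
Proof.
split=> [dF i j|dF].
  apply: (@differentiable_comp _ _ _ _ F (fun N : 'M[R]_(p, q) => N i j)) => //.
  exact: differentiable_coord.
have -> : F = \sum_i \sum_j (fun y => F y i j *: delta_mx i j).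
  apply/funext => y; rewrite [LHS]matrix_sum_delta fct_sumE.
  by apply: eq_bigr => i _; rewrite fct_sumE.
apply: differentiable_sum => i; apply: differentiable_sum => j.
exact: differentiableZl.
Qed.

Lemma derive_mxE p q (F : V -> 'M[R]_(p, q)) x v i j : differentiable F x ->
  ('D_v F x) i j = 'D_v (fun y => F y i j) x.
Proof.
by move=> dF; rewrite derive_mx ?mxE//; apply: diff_derivable.
Qed.

End MatrixValued.

Section LineMVT.
Context {R : realType} {V : normedModType R}.

Lemma derive_line (f : V -> R) x h t : derivable f (x + t *: h) h ->
  is_derive t (1 : R) (fun s : R => f (x + s *: h)) ('D_h f (x + t *: h)).
Proof.
move=> df.
have E : (fun e : R => e^-1 *: ((f (x + (e *: (1:R) + t) *: h)) - f (x + t *: h)))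
       = (fun e : R => e^-1 *: (f (e *: h + (x + t *: h)) - f (x + t *: h))).
  apply/funext => e /=; congr (_ *: (f _ - _)).
  by rewrite [e *: 1]mulr1 scalerDl addrCA.
apply: DeriveDef; first by rewrite /derivable /= E.
by rewrite /derive /= E.
Qed.

Lemma mvt_line (f : V -> R) x h :
  (forall t, 0 <= t <= 1 -> derivable f (x + t *: h) h) ->
  exists2 t, 0 < t < 1 & f (x + h) - f x = 'D_h f (x + t *: h).
Proof.
move=> df.
have [||t] := @MVT R (fun s : R => f (x + s *: h)) (fun t => 'D_h f (x + t *: h)) 0 1 ltr01.
- move=> t; rewrite in_itv/= => /andP[t0 t1]; apply: derive_line; apply: df.
  by rewrite !ltW.
- apply: derivable_within_continuous => t; rewrite in_itv/= => t01.
  by have [] := derive_line (df t t01).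
rewrite in_itv/= => t01; rewrite scale1r scale0r addr0 subr0 mulr1 => E.
by exists t.
Qed.

Lemma mvt_le (f : V -> R) x h (M : R) :
  (forall t, 0 <= t <= 1 -> derivable f (x + t *: h) h) ->
  (forall t, 0 <= t <= 1 -> `|'D_h f (x + t *: h)| <= M) ->
  `|f (x + h) - f x| <= M.
Proof.
move=> df hM; have [t /andP[t0 t1] ->] := mvt_line df.
by apply: hM; rewrite !ltW.
Qed.

End LineMVT.

Section UniformLimit.
Context {R : realType} {V : normedModType R}.

Lemma ball_line (x0 x h : V) (r : R) t : ball x0 r x -> ball x0 r (x + h) ->
  0 <= t <= 1 -> ball x0 r (x + t *: h).
Proof.
rewrite -ball_normE /= => bx bh /andP[t0 t1].
have -> : x0 - (x + t *: h) = (1 - t) *: (x0 - x) + t *: (x0 - (x + h)).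
  rewrite !opprD !addrA; move: (x0 - x) => a.
  by rewrite scalerBl scale1r scalerBr addrA subrK.
have [->|tN0] := eqVneq t 0; first by rewrite subr0 scale0r addr0 scale1r.
have tp : 0 < t by rewrite lt_neqAle eq_sym tN0.
rewrite (le_lt_trans (ler_normD _ _))// !normrZ ger0_norm ?subr_ge0// (ger0_norm t0).
have -> : r = (1 - t) * r + t * r by ring.
by apply: ler_ltD; [apply: ler_wpM2l; rewrite ?subr_ge0// ltW|rewrite ltr_pM2l].
Qed.

Lemma differentiable_from_bound (f : V -> R) x (w : {linear V -> R}) :
  continuous w ->
  (forall e, 0 < e -> \forall h \near (0 : V),
     `|f (x + h) - f x - w h| <= e * `|h|) ->
  differentiable f x /\ (forall v, 'D_v f x = w v).
Proof.
move=> cw H.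
have E : f \o shift x = cst (f x) + w +o_ (0 : V) id.
  apply/eqaddoP => e e0; near=> h => /=.
  have -> : (f \o shift x - (cst (f x) + w)) h = f (x + h) - f x - w h.
    by rewrite !fctE /= [h + x]addrC opprD addrA.
  by near: h; exact: H.
have dfE := diff_unique cw E.
have df : differentiable f x.
  by apply/diff_locallyP; rewrite dfE; split.
by split=> // v; rewrite deriveE // dfE.
Unshelve. all: by end_near. Qed.

Lemma cauchy_real (u : nat -> R) :
  (forall e, 0 < e -> exists N, forall m l, (N <= m)%N -> (m <= l)%N ->
     `|u l - u m| <= e) -> cvgn u.
Proof.
move=> H; apply/cauchy_cvgP/cauchy_exP => e e0.
have [N HN] := H (e / 2) (divr_gt0 e0 (ltr0Sn _ _)).
exists (u N); exists N => // l /= Nl.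
rewrite -ball_normE /= distrC (le_lt_trans (HN _ _ (leqnn N) Nl))//.
by rewrite ltr_pdivrMr// ltr_pMr// ltr1n.
Qed.

Lemma cvg_norm_le (u : nat -> R) (l M : R) (N : nat) :
  u @ \oo --> l -> (forall m, (N <= m)%N -> `|u m| <= M) -> `|l| <= M.
Proof.
move=> ul uM; apply: (cvgr_to_le (cvg_norm ul)).
by exists N => // m /=; exact: uM.
Qed.

(** The derivatives converge uniformly, so the mean value inequality turns
    pointwise convergence of f_m into a first-order expansion of the limit. *)
Lemma uniform_limit_diff (x0 : V) (r : R) (f_ : nat -> V -> R) (f : V -> R)
    (e_ : nat -> R) :
  (forall m x, ball x0 r x -> differentiable (f_ m) x) ->
  (forall x, ball x0 r x -> f_ ^~ x @ \oo --> f x) ->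
  e_ @ \oo --> (0 : R) ->
  (forall m l x v, (m <= l)%N -> ball x0 r x ->
     `|'D_v (f_ l) x - 'D_v (f_ m) x| <= e_ m * `|v|) ->
  forall x, ball x0 r x ->
    differentiable f x /\ (forall v, (fun m => 'D_v (f_ m) x) @ \oo --> 'D_v f x).
Proof.
move=> df ff e0 ee x bx.
have cD v : cvgn (fun m => 'D_v (f_ m) x).
  apply: cauchy_real => e ep.
  have [N _ HN] : \forall m \near \oo, `|e_ m| < e / (`|v| + 1).
    by move/cvgr0_norm_lt : e0; apply; rewrite divr_gt0// ltr_pwDr.
  exists N => m l Nm ml; apply: le_trans (ee _ _ _ _ ml bx) _.
  have := HN m Nm; rewrite ltr_pdivlMr ?ltr_pwDr// => /ltW; apply: le_trans.
  apply: le_trans (ler_norm _) _; rewrite normrM ler_wpM2l//.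
  by rewrite normr_id lerDl.
pose w v := limn (fun m => 'D_v (f_ m) x).
have wlin : linear w.
  move=> k u v; rewrite /w -limZr// -limD//; last exact: is_cvgZr.
  have -> : (fun m => 'D_(k *: u + v) (f_ m) x) =
      k *: (fun m => 'D_u (f_ m) x) + (fun m => 'D_v (f_ m) x); last by [].
  apply/funext => m; rewrite deriveDv ?deriveZv//; exact: df.
pose wM := GRing.isLinear.Build _ _ _ _ w wlin.
pose W : {linear V -> R} := HB.pack w wM.
have wE m v : `|w v - 'D_v (f_ m) x| <= e_ m * `|v|.
  have : (fun l => 'D_v (f_ l) x - 'D_v (f_ m) x) @ \oo --> w v - 'D_v (f_ m) x.
    by apply: cvgB; [exact: cD|exact: cvg_cst].
  by move/(@cvg_norm_le _ _ _ m); apply => l ml; exact: ee.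
have cw : continuous W.
  have [C C0 HC] := linear_lipschitz (@diff_continuous _ _ _ _ _ (df 0%N x bx)).
  apply/linear_bounded_continuous/linear_boundedP; exists (`|e_ 0%N| + C); split.
    exact: num_real.
  move=> M HM v; rewrite -[W v](subrK ('D_v (f_ 0%N) x)).
  rewrite (le_trans (ler_normD _ _))//.
  apply: (@le_trans _ _ (`|e_ 0%N| * `|v| + C * `|v|)).
    apply: lerD; last by rewrite deriveE ?HC//; exact: df.
    by apply: le_trans (wE 0%N v) _; rewrite ler_wpM2r// ler_norm.
  by rewrite -mulrDl ler_wpM2r// ltW.
have [|dfx DfE] := @differentiable_from_bound f x W cw.
  move=> e ep.
  have [N _ HN] : \forall m \near \oo, `|e_ m| < e / 4.
    by move/cvgr0_norm_lt : e0; apply; rewrite divr_gt0.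
  have H1 : \forall h \near (0 : V), `|f_ N (h + x) - f_ N x - 'd (f_ N) x h| <= e / 4 * `|h|.
    have /eqaddoP H := diff_locally (df N x bx).
    have e4 : 0 < e / 4 by rewrite divr_gt0.
    apply: filterS (H _ e4) => h; rewrite !fctE /=.
    by rewrite opprD addrA.
  have H2 : \forall h \near (0 : V), ball x0 r (x + h).
    have : \forall y \near x, ball x0 r y by exact: open_nbhs_nbhs (conj (ball_open _ _) bx).
    move=> /nbhs0P; exact.
  near=> h.
  have bh : ball x0 r (x + h) by near: h.
  have D l : (N <= l)%N -> `|(f_ l (x + h) - f_ N (x + h)) - (f_ l x - f_ N x)| <= e / 4 * `|h|.
    move=> Nl; apply: (@mvt_le _ _ (fun y => f_ l y - f_ N y)).
      move=> t t01; apply: derivableB; apply: diff_derivable; apply: df; exact: ball_line.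
    move=> t t01; have bt := ball_line bx bh t01.
    rewrite deriveB; [|by apply/diff_derivable/df..].
    apply: le_trans (ee _ _ _ _ Nl bt) _; rewrite ler_wpM2r//.
    by apply: le_trans (ler_norm _) _; apply/ltW/(HN N) => /=.
  have D' : `|(f (x + h) - f_ N (x + h)) - (f x - f_ N x)| <= e / 4 * `|h|.
    apply: (@cvg_norm_le (fun l => (f_ l (x + h) - f_ N (x + h)) - (f_ l x - f_ N x)) _ _ N) => //.
    by apply: cvgB; (apply: cvgB; [exact: ff|exact: cvg_cst]).
  have E1 : `|f_ N (h + x) - f_ N x - 'd (f_ N) x h| <= e / 4 * `|h| by near: h.
  have E2 : `|W h - 'D_h (f_ N) x| <= e / 4 * `|h|.
    apply: le_trans (wE N h) _; rewrite ler_wpM2r//.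
    by apply: le_trans (ler_norm _) _; apply/ltW/(HN N) => /=.
  rewrite deriveE in E2; last exact: df.
  have -> : f (x + h) - f x - W h = ((f (x + h) - f_ N (x + h)) - (f x - f_ N x))
     + (f_ N (h + x) - f_ N x - 'd (f_ N) x h) - (W h - 'd (f_ N) x h).
    by rewrite [h + x]addrC; ring.
  apply: le_trans (ler_normB _ _) _; apply: le_trans (lerD (ler_normD _ _) (lexx _)) _.
  have h0 : 0 <= `|h| by [].
  nra.
by split => // v; rewrite DfE; exact: cD.
Unshelve. all: by end_near. Qed.

End UniformLimit.

(** * Functions of class C^k *)

Section Local.
Context {R : realType} {V : normedModType R}.
Implicit Types (f g : V -> R) (U : set V).

Lemma open_near U x : open U -> U x -> \forall y \near x, U y.
Proof. by move=> oU Ux; exact: open_nbhs_nbhs. Qed.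

Lemma differentiable_near f g x : (\forall y \near x, f y = g y) ->
  differentiable f x -> differentiable g x.
Proof.
move=> fg df.
have cd : continuous ('d f x) by apply: diff_continuous.
have [|//] := @differentiable_from_bound R V g x ('d f x) cd.
move=> e e0; have /eqaddoP H := diff_locally df.
have := H _ e0; have := fg; rewrite nbhs0P.
have fgx := nbhs_singleton fg.
apply: filterS2 => h E; rewrite !fctE /= opprD addrA -E -fgx.
by rewrite [h + x]addrC.
Qed.

Lemma differentiable_ext U f g x : open U -> U x ->
  (forall y, U y -> f y = g y) -> differentiable f x -> differentiable g x.
Proof.
move=> oU Ux fg; apply: differentiable_near.
by apply: filterS (open_near oU Ux).
Qed.

Lemma derive_ext U f g x v : open U -> U x ->
  (forall y, U y -> f y = g y) -> 'D_v f x = 'D_v g x.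
Proof.
move=> oU Ux fg; have [->|v0] := eqVneq v 0; first by rewrite !derive0.
by apply: near_eq_derive => //; apply: filterS (open_near oU Ux).
Qed.

End Local.

Section ContinuityDist.
Context {R : realType} {V W : normedModType R}.

Lemma continuous_dist (f : V -> W) x (e : R) : {for x, continuous f} -> 0 < e ->
  exists2 d, 0 < d & forall y, `|y - x| < d -> `|f x - f y| <= e.
Proof.
move=> cf e0; have /cvgrPdist_le /(_ e e0) := cf.
move=> /nbhs_ballP [d d0 H]; exists d => // y yd; apply: H.
by rewrite -ball_normE /= distrC.
Qed.

Lemma open_dist (U : set V) x : open U -> U x ->
  exists2 d : R, 0 < d & forall y, `|y - x| < d -> U y.
Proof.
move=> oU Ux; have /nbhs_ballP [r r0 H] := open_near oU Ux; exists r => // y yr.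
by apply: H; rewrite -ball_normE /= distrC.
Qed.

End ContinuityDist.

Section MatrixLimit.
Context {R : realType}.

Lemma cvg_mx (T : Type) (F : set_system T) (FF : Filter F) p q
    (g : T -> 'M[R]_(p, q)) (l : 'M[R]_(p, q)) :
  (forall i j, (fun x => g x i j) @ F --> l i j) -> g @ F --> l.
Proof.
move=> H; apply/cvgrPdist_le => /= e e0.
have : \forall x \near F, forall ij : 'I_p * 'I_q, `|l ij.1 ij.2 - g x ij.1 ij.2| <= e.
  by apply: filter_forall => -[i j]; have /cvgrPdist_le := H i j; exact.
apply: filterS => x Hx; rewrite [leLHS]/Num.Def.normr/= mx_normrE.
by apply: bigmax_le => [|ij _]; [exact: ltW|rewrite !mxE].
Qed.

Lemma continuous_mx (T : topologicalType) p q (g : T -> 'M[R]_(p, q)) x :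
  (forall i j, {for x, continuous (fun y => g y i j)}) -> {for x, continuous g}.
Proof. by move=> H; apply: cvg_mx => i j; exact: H. Qed.

Lemma continuous_near (T U : topologicalType) (f g : T -> U) x :
  (\forall y \near x, f y = g y) -> {for x, continuous f} -> {for x, continuous g}.
Proof.
move=> fg; rewrite /prop_for /continuous_at -(nbhs_singleton fg) => cf.
by apply: cvg_trans cf; apply: near_eq_cvg.
Qed.

End MatrixLimit.

Section ChainRule.
Context {R : realType} {V : normedModType R} {m : nat}.

Lemma differentiable_chain (f : 'cV[R]_m -> R) (g : V -> 'cV[R]_m) x :
  differentiable g x -> differentiable f (g x) ->
  differentiable (fun y => f (g y)) x.
Proof. by move=> dg df; exact: (@differentiable_comp _ _ _ _ g f). Qed.

Lemma derive_chain (W : normedModType R) (f : 'cV[R]_m -> W) (g : V -> 'cV[R]_m) x v :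
  differentiable g x -> differentiable f (g x) ->
  'D_v (fun y => f (g y)) x = 'D_('D_v g x) f (g x).
Proof.
move=> dg df; rewrite deriveE; last exact: (@differentiable_comp _ _ _ _ g f).
by rewrite (@diff_comp _ _ _ _ g f) //= -deriveE // -deriveE.
Qed.

Lemma derive_chain_sum (f : 'cV[R]_m -> R) (g : V -> 'cV[R]_m) x v :
  differentiable g x -> differentiable f (g x) ->
  'D_v (fun y => f (g y)) x =
    \sum_i 'D_v (fun y => g y i ord0) x * 'D_(ecol i) f (g x).
Proof.
move=> dg df; rewrite derive_chain // derive_coords //.
by apply: eq_bigr => i _; rewrite derive_mxE.
Qed.

End ChainRule.

Section SmoothClosure.
Context {R : realType} {n : nat}.
Implicit Types (U : set 'cV[R]_n) (f g : 'cV[R]_n -> R).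

Lemma Ck_sub k U U' f : U' `<=` U -> Ck k U f -> Ck k U' f.
Proof.
move=> sU; elim: k f => [|k IH] f /= H.
  by move=> x /sU; exact: H.
by split=> [x /sU|v]; [exact: H.1|exact: IH (H.2 v)].
Qed.

Lemma Ck_ext k U f g : open U -> (forall x, U x -> f x = g x) ->
  Ck k U f -> Ck k U g.
Proof.
move=> oU; elim: k f g => [|k IH] f g fg /=.
  move=> cf x Ux; apply: continuous_near (cf x Ux).
  by apply: filterS (open_near oU Ux) => y /fg.
move=> [df Df]; split=> [x Ux|v]; first exact: (differentiable_ext oU Ux fg (df x Ux)).
by apply: IH (Df v) => x Ux; exact: derive_ext oU Ux fg.
Qed.

Lemma CkS k U f : Ck k.+1 U f -> Ck k U f.
Proof.
elim: k f => [|k IH] f [df Df].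
  by move=> x Ux; apply: differentiable_continuous; exact: df.
by split=> // v; apply: IH; exact: Df.
Qed.

Lemma Ck_cst k U (c : R) : Ck k U (fun _ => c).
Proof.
elim: k c => [|k IH] c /=; first by move=> x _; exact: cst_continuous.
split=> [x _|v]; first exact: differentiable_cst.
have -> : 'D_v (fun _ : 'cV[R]_n => c) = (fun _ => 0); last exact: IH.
by apply/funext => x; exact: derive_cst.
Qed.

Lemma Ck_linear k U f : (forall x, differentiable f x) ->
  (forall x v, 'D_v f x = f v) -> Ck k U f.
Proof.
move=> df Df; case: k => [x _|k]; first exact: differentiable_continuous.
split=> // v; have -> : 'D_v f = (fun _ => f v) by apply/funext => x.
exact: Ck_cst.
Qed.

Lemma Ck_coord k U i : Ck k U (fun x => x i ord0).
Proof.
apply: Ck_linear => [x|x v]; first exact: differentiable_coord.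
by rewrite -(@derive_mxE _ _ _ _ id) ?derive_id.
Qed.

Lemma Ck_add k U f g : open U -> Ck k U f -> Ck k U g -> Ck k U (fun x => f x + g x).
Proof.
move=> oU; elim: k f g => [|k IH] f g /=.
  by move=> cf cg x Ux; apply: continuousD; [exact: cf|exact: cg].
move=> [df Df] [dg Dg]; split=> [x Ux|v].
  by apply: differentiableD; [exact: df|exact: dg].
apply: Ck_ext (IH _ _ (Df v) (Dg v)) => // x Ux.
by rewrite deriveD //; apply: diff_derivable; [exact: df|exact: dg].
Qed.

Lemma Ck_mul k U f g : open U -> Ck k U f -> Ck k U g -> Ck k U (fun x => f x * g x).
Proof.
move=> oU; elim: k f g => [|k IH] f g.
  by move=> cf cg x Ux; apply: continuousM; [exact: cf|exact: cg].
move=> Cf Cg; have [df Df] := Cf; have [dg Dg] := Cg; split=> [x Ux|v].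
  by apply: differentiableM; [exact: df|exact: dg].
apply: Ck_ext (Ck_add oU (IH _ _ (CkS Cf) (Dg v)) (IH _ _ (CkS Cg) (Df v))) => // x Ux.
by rewrite deriveM //; apply: diff_derivable; [exact: df|exact: dg].
Qed.

Lemma Ck_opp k U f : open U -> Ck k U f -> Ck k U (fun x => - f x).
Proof.
move=> oU Cf; apply: Ck_ext (Ck_mul oU (Ck_cst k U (-1)) Cf) => // x _.
by rewrite mulN1r.
Qed.

Lemma Ck_sum k U (I : Type) (r : seq I) (P : pred I) (F : I -> 'cV[R]_n -> R) : open U ->
  (forall i, P i -> Ck k U (F i)) -> Ck k U (fun x => \sum_(i <- r | P i) F i x).
Proof.
move=> oU CF; elim: r => [|i r IH].
  by apply: Ck_ext (Ck_cst k U 0) => // x _; rewrite big_nil.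
case Pi : (P i).
  by apply: Ck_ext (Ck_add oU (CF i Pi) IH) => // x _; rewrite big_cons Pi.
by apply: Ck_ext IH => // x _; rewrite big_cons Pi.
Qed.

Lemma Ck_inv k U f : open U -> (forall x, U x -> f x != 0) ->
  Ck k U f -> Ck k U (fun x => (f x)^-1).
Proof.
move=> oU f0; elim: k => [|k IH].
  by move=> cf x Ux; apply: continuousV; [exact: f0|exact: cf].
move=> Cf; have [df Df] := Cf; split=> [x Ux|v].
  by apply: differentiableV; [exact: df|exact: f0].
have Ci := IH (CkS Cf).
apply: Ck_ext (Ck_opp oU (Ck_mul oU (Ck_mul oU Ci Ci) (Df v))) => // x Ux.
rewrite deriveV ?f0//; last exact/diff_derivable/df.
by rewrite scaleNr -exprVn expr2.
Qed.

End SmoothClosure.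

Section SmoothComp.
Context {R : realType}.

(** Induction on k: by the chain rule a directional derivative of f o g is a sum
    of products to which the induction hypothesis applies. *)
Lemma Ck_comp n m k (U : set 'cV[R]_n) (V : set 'cV[R]_m) (f : 'cV[R]_m -> R)
    (g : 'cV[R]_n -> 'cV[R]_m) :
  open U -> open V -> (forall x, U x -> V (g x)) ->
  Ck k V f -> (forall i, Ck k U (fun x => g x i ord0)) ->
  Ck k U (fun x => f (g x)).
Proof.
move=> oU oV UV; elim: k f => [|k IH] f.
  move=> cf cg x Ux; apply: (@continuous_comp _ _ _ g f); last by apply: cf; exact: UV.
  by apply: continuous_mx => i j; rewrite (ord1 j); exact: cg.
move=> Cf Cg; have [df Df] := Cf.
have dg x : U x -> differentiable g x.
  by move=> Ux; apply/differentiable_mxP => i j; rewrite (ord1 j); exact: (Cg i).1.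
split=> [x Ux|v]; first by apply: differentiable_chain; [exact: dg|exact/df/UV].
apply: (@Ck_ext _ _ _ _ (fun x =>
   \sum_i 'D_v (fun y => g y i ord0) x * 'D_(ecol i) f (g x))) => //.
  move=> x Ux; rewrite derive_chain_sum //; [exact: dg|exact/df/UV].
apply: Ck_sum => // i _; apply: Ck_mul => //; first exact: (Cg i).2.
by apply: IH (Df _) _ => j; exact/CkS/Cg.
Qed.

End SmoothComp.

Lemma close_values (R : realType) (a b c d e : R) : d = c ->
  `|a - c| <= e / 2 -> `|b - d| <= e / 2 -> `|a - b| <= e.
Proof.
move=> -> ac bc; have -> : a - b = (a - c) - (b - c) by ring.
by rewrite (le_trans (ler_normB _ _))// [leRHS]splitr lerD.
Qed.

Section SecondDifference.
Context {R : realType} {V : normedModType R}.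

Lemma is_derive_shift (f : V -> R) y u v : derivable f (y + v) u ->
  is_derive y u (fun y => f (y + v)) ('D_u f (y + v)).
Proof.
move=> dfy.
have E : (fun h : R => h^-1 *: (f (h *: u + y + v) - f (y + v))) =
         (fun h : R => h^-1 *: (f (h *: u + (y + v)) - f (y + v))).
  by apply/funext => h; rewrite addrA.
by apply: DeriveDef; rewrite /derivable /derive /= E.
Qed.

(** The mean value theorem is applied to y |-> f (y + v) - f y in the direction u,
    and then to 'D_u f in the direction v. *)
Lemma second_difference (f : V -> R) x u v r :
  (forall y, `|y - x| < r -> differentiable f y) ->
  (forall y, `|y - x| < r -> differentiable ('D_u f) y) ->
  `|u| + `|v| < r ->
  exists2 y, `|y - x| <= `|u| + `|v| &
    f (x + u + v) - f (x + u) - (f (x + v) - f x) = 'D_v ('D_u f) y.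
Proof.
move=> df Df uvr.
have U1 s t : 0 <= s <= 1 -> 0 <= t <= 1 ->
    `|x + s *: u + t *: v - x| <= `|u| + `|v|.
  move=> /andP[s0 s1] /andP[t0 t1]; rewrite addrAC [x + _]addrC addrK.
  by rewrite (le_trans (ler_normD _ _))// !normrZ !ger0_norm// lerD// ler_piMl.
have U2 s t : 0 <= s <= 1 -> 0 <= t <= 1 -> `|x + s *: u + t *: v - x| < r.
  by move=> s01 t01; exact: le_lt_trans (U1 s t s01 t01) uvr.
have i0 : 0 <= (0 : R) <= 1 by rewrite lexx ler01.
have i1 : 0 <= (1 : R) <= 1 by rewrite lexx ler01.
pose phi y := f (y + v) - f y.
have dphi t : 0 <= t <= 1 -> is_derive (x + t *: u) u phi
    ('D_u f (x + t *: u + v) - 'D_u f (x + t *: u)).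
  move=> t01; have := U2 t 1 t01 i1; rewrite scale1r => Uv.
  have := U2 t 0 t01 i0; rewrite scale0r addr0 => Ut.
  apply: is_deriveB; first by apply: is_derive_shift; exact/diff_derivable/df.
  by apply/derivableP/diff_derivable/df.
have [t /andP[t0 t1]] := @mvt_line _ _ phi x u (fun t t01 => @ex_derive _ _ _ _ _ _ _ (dphi t t01)).
have t01 : 0 <= t <= 1 by rewrite !ltW.
rewrite (@derive_val _ _ _ _ _ _ _ (dphi t t01)) => E.
have [s /andP[s0 s1]] := @mvt_line _ _ ('D_u f) (x + t *: u) v
  (fun s s01 => diff_derivable (Df _ (U2 t s t01 s01))).
have s01 : 0 <= s <= 1 by rewrite !ltW.
move=> E'; exists (x + t *: u + s *: v); first exact: U1.
by rewrite -E' -E /phi.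
Qed.

Lemma second_difference_sym (f : V -> R) x u v :
  f (x + u + v) - f (x + u) - (f (x + v) - f x) =
  f (x + v + u) - f (x + v) - (f (x + u) - f x).
Proof. by rewrite (addrAC x u v); ring. Qed.

Lemma exists_scale (u v : V) (c : R) : 0 < c ->
  exists2 s : R, 0 < s & `|s *: u| + `|s *: v| < c.
Proof.
move=> c0; have D0 : 0 < `|u| + `|v| + 1 by rewrite ltr_pwDr// addr_ge0.
have [s s0 E] : exists2 s, 0 < s & s * (`|u| + `|v| + 1) = c / 2.
  by exists (c / 2 / (`|u| + `|v| + 1)); rewrite ?divr_gt0 // divfK // gt_eqF.
exists s => //; rewrite !normrZ !gtr0_norm // -mulrDr (@lt_trans _ _ (c / 2)) //.
  by rewrite -E ltr_pM2l // ltrDl.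
by rewrite ltr_pdivrMr // ltr_pMr // ltr1n.
Qed.

(** Both iterated derivatives are the limit of the same second difference,
    which two applications of the mean value theorem evaluate in either order. *)
Lemma derive_commute (U : set V) (f : V -> R) x u v : open U -> U x ->
  (forall y, U y -> differentiable f y) ->
  (forall w y, U y -> differentiable ('D_w f) y) ->
  (forall a b, {for x, continuous ('D_a ('D_b f))}) ->
  'D_u ('D_v f) x = 'D_v ('D_u f) x.
Proof.
move=> oU Ux df Df cont.
have [r r0 Hr] := open_dist oU Ux.
have scale s a b y : U y -> 'D_(s *: a) ('D_(s *: b) f) y = s ^+ 2 * 'D_a ('D_b f) y.
  move=> Uy; rewrite (@derive_ext _ _ U _ (s *: 'D_b f)) //; last first.
    by move=> z Uz; rewrite deriveZv //; exact: df.
  rewrite deriveZ; last exact/diff_derivable/Df.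
  rewrite deriveZv; last exact: Df.
  by rewrite /GRing.scale /= mulrA.
apply/eqP; rewrite -subr_eq0 -normr_le0; apply/ler_addgt0Pr => e e0; rewrite add0r.
have e2 : 0 < e / 2 by rewrite divr_gt0.
have [d1 d10 H1] := continuous_dist (cont u v) e2.
have [d2 d20 H2] := continuous_dist (cont v u) e2.
pose d := Num.min d1 d2; have d0 : 0 < d by rewrite lt_min d10.
pose c := Num.min r d; have c0 : 0 < c by rewrite lt_min r0.
have [s s0 sc] := exists_scale u v c0.
have scr : `|s *: u| + `|s *: v| < r by apply: lt_le_trans sc _; rewrite ge_min lexx.
have dfr y : `|y - x| < r -> differentiable f y by move=> /Hr; exact: df.
have Dfr w t y : `|y - x| < r -> differentiable ('D_(t *: w) f) y.
  move=> /Hr Uy; apply: (@differentiable_ext _ _ U (t *: 'D_w f)) => //.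
    by move=> z Uz; rewrite deriveZv //; exact: df.
  by apply: differentiableZ; exact: Df.
have [y1 y1x E1] := @second_difference f x _ _ r dfr (Dfr _ _) scr.
have scr' : `|s *: v| + `|s *: u| < r by rewrite [ltLHS]addrC.
have [y2 y2x E2] := @second_difference f x _ _ r dfr (Dfr _ _) scr'.
have Uy1 : U y1 by apply: Hr; exact: le_lt_trans y1x scr.
have Uy2 : U y2 by apply: Hr; exact: le_lt_trans y2x scr'.
have E : 'D_v ('D_u f) y1 = 'D_u ('D_v f) y2.
  apply: (@mulfI _ (s ^+ 2)); first by rewrite expf_neq0 // gt_eqF.
  by rewrite -(scale s v u y1 Uy1) -(scale s u v y2 Uy2) -E1 -E2; exact: second_difference_sym.
have B y : `|y - x| <= `|s *: u| + `|s *: v| -> `|y - x| < d.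
  move=> yx; apply: le_lt_trans yx _.
  by apply: lt_le_trans sc _; rewrite ge_min lexx orbT.
rewrite [leRHS]addrC in y2x.
have L1 : `|y2 - x| < d1 by apply: lt_le_trans (B _ y2x) _; rewrite ge_min lexx.
have L2 : `|y1 - x| < d2 by apply: lt_le_trans (B _ y1x) _; rewrite ge_min lexx orbT.
by apply: (close_values E); [exact: H1|exact: H2].
Qed.

End SecondDifference.

Lemma schwarz (R : realType) n (U : set 'cV[R]_n) (f : 'cV[R]_n -> R) x u v :
  open U -> U x -> Ck 2 U f -> 'D_u ('D_v f) x = 'D_v ('D_u f) x.
Proof.
move=> oU Ux [df Df]; apply: (derive_commute u v oU Ux df).
- by move=> w; exact: (Df w).1.
- by move=> a b; exact: (Df b).2.
Qed.

(** * Power series in several variables *)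

Section Boxes.
Context {R : realType} {n : nat}.
Local Notation mi := {ffun 'I_n -> nat}.
Implicit Types (a b : mi) (F : mi -> R) (h : 'cV[R]_n).

Definition mdeg a : nat := \sum_i a i.

Definition mono a h : R := \prod_i h i ord0 ^+ a i.

(** The boxes [0, m)^n, the empty one included, so that telescoping sums over
    m start from zero. *)
Definition box (m : nat) : seq mi :=
  if m is N.+1 then codom (fun a : {ffun 'I_n -> 'I_N.+1} => [ffun i => val (a i)] : mi)
  else [::].

Lemma box_sumE F N : box_sum F N = \sum_(a <- box N.+1) F a.
Proof. by rewrite /= /codom big_image. Qed.

Lemma box_uniq m : uniq (box m).
Proof.
case: m => // N; apply/injectiveP => a b /ffunP E; apply/ffunP => i.
by apply: val_inj; have := E i; rewrite !ffunE.
Qed.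

Lemma mem_box m a : (a \in box m.+1) = [forall i, (a i <= m)%N].
Proof.
apply/codomP/forallP => [[b -> i]|H]; first by rewrite ffunE /= -ltnS ltn_ord.
exists [ffun i => inord (a i)]; apply/ffunP => i.
by rewrite !ffunE /= inordK // ltnS.
Qed.

Lemma box_sub m l : (m <= l)%N -> {subset box m <= box l}.
Proof.
case: m => // m; case: l => // l ml a; rewrite !mem_box => /forallP H.
by apply/forallP => i; exact: leq_trans (H i) ml.
Qed.

Lemma box_ex a : exists m, a \in box m.
Proof.
exists (\max_i a i).+1; rewrite mem_box; apply/forallP => i.
exact: (leq_bigmax i).
Qed.

Lemma box_sum_diff F m l : (m <= l)%N ->
  \sum_(a <- box l) F a - \sum_(a <- box m) F a =
  \sum_(a <- box l | a \notin box m) F a.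
Proof.
move=> ml; rewrite (bigID (mem (box m))) /=.
suff -> : \sum_(a <- box l | a \in box m) F a = \sum_(a <- box m) F a.
  by rewrite addrAC subrr add0r.
rewrite -big_filter; apply: perm_big; apply: uniq_perm.
- by rewrite filter_uniq // box_uniq.
- exact: box_uniq.
- move=> a; rewrite mem_filter /=; case E: (a \in box m) => //=.
  exact: box_sub ml _ E.
Qed.

Lemma box_sum_incr F m l : (forall a, 0 <= F a) -> (m <= l)%N ->
  \sum_(a <- box m) F a <= \sum_(a <- box l) F a.
Proof.
by move=> F0 ml; rewrite -subr_ge0 box_sum_diff // sumr_ge0.
Qed.

Lemma monoD a b h : mono [ffun i => (a i + b i)%N] h = mono a h * mono b h.
Proof. by rewrite /mono -big_split; apply: eq_bigr => i _; rewrite ffunE exprD. Qed.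

Lemma mdegD a b : mdeg [ffun i => (a i + b i)%N] = (mdeg a + mdeg b)%N.
Proof. by rewrite /mdeg -big_split; apply: eq_bigr => i _; rewrite ffunE. Qed.

Lemma mono_le a h (r : R) : `|h| <= r -> `|mono a h| <= r ^+ mdeg a.
Proof.
move=> hr; rewrite /mono normr_prod /mdeg -prodrXr.
apply: ler_prod => i _; rewrite normr_ge0 /= normrX; apply: lerXn2r; rewrite ?nnegrE//.
  exact: le_trans hr.
exact: le_trans (coord_le_norm h i) hr.
Qed.

End Boxes.

Section RealSequences.
Context {R : realType}.
Implicit Types (u k : nat -> R).

Lemma cvg_sum_seq (I : Type) (s : seq I) (P : pred I) (u : I -> nat -> R) (l : I -> R) :
  (forall i, P i -> u i @ \oo --> l i) ->
  (fun m => \sum_(i <- s | P i) u i m) @ \oo --> \sum_(i <- s | P i) l i.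
Proof.
move=> ul; elim: s => [|i s IH].
  rewrite big_nil; under eq_fun do rewrite big_nil; exact: cvg_cst.
rewrite big_cons; under eq_fun do rewrite big_cons.
by case Pi : (P i) => //; apply: cvgD => //; exact: ul.
Qed.

(** The tail bound t is the limit of k minus k itself; it turns absolute
    convergence into Cauchy estimates that are uniform in the point. *)
Lemma incr_tail k (K : R) : (forall m, k m <= k m.+1) -> (forall m, k m <= K) ->
  exists t : nat -> R, [/\ t @ \oo --> (0 : R), (forall m, 0 <= t m) &
    (forall m l, (m <= l)%N -> k l - k m <= t m)].
Proof.
move=> kS kK.
have kn : nondecreasing_seq k by apply/nondecreasing_seqP.
have kc : cvgn k.
  by apply: nondecreasing_is_cvgn => //; exists K => _ [m _ <-].
exists (fun m => limn k - k m); split.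
- by rewrite -[X in _ --> X](subrr (limn k)); apply: cvgB => //; exact: cvg_cst.
- by move=> m; rewrite subr_ge0; exact: nondecreasing_cvgn_le.
- by move=> m l ml; rewrite lerD2r; exact: nondecreasing_cvgn_le.
Qed.

Lemma cvg0_eventually (t : nat -> R) e : t @ \oo --> (0 : R) -> 0 < e ->
  exists N, forall m, (N <= m)%N -> `|t m| <= e.
Proof.
move=> t0 e0; have /cvgrPdist_le /(_ e e0) [N _ H] := t0.
by exists N => m Nm; have := H m Nm; rewrite sub0r normrN.
Qed.

Lemma cvg_eventually (u : nat -> R) l e : u @ \oo --> l -> 0 < e ->
  exists N, forall m, (N <= m)%N -> `|u m - l| <= e.
Proof.
move=> ul e0; have /cvgrPdist_le /(_ e e0) [N _ H] := ul.
by exists N => m Nm; have := H m Nm; rewrite distrC.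
Qed.

Lemma cvg_from_eps (u : nat -> R) l :
  (forall e, 0 < e -> exists N, forall m, (N <= m)%N -> `|u m - l| <= e) ->
  u @ \oo --> l.
Proof.
move=> H; apply/cvgrPdist_le => e e0; have [N HN] := H e e0.
by exists N => // m Nm; rewrite distrC; exact: HN.
Qed.

Lemma dist3 (x y z w e : R) : `|x - y| <= e / 3 -> `|y - z| <= e / 3 ->
  `|z - w| <= e / 3 -> `|x - w| <= e.
Proof.
move=> xy yz zw; have -> : x - w = (x - y) + (y - z) + (z - w) by ring.
rewrite (le_trans (ler_normD _ _))// (le_trans (lerD (ler_normD _ _) (lexx _)))//.
lra.
Qed.

Lemma cvg_le (u : nat -> R) (l M : R) (N : nat) :
  u @ \oo --> l -> (forall m, (N <= m)%N -> u m <= M) -> l <= M.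
Proof. by move=> ul uM; apply: (cvgr_to_le ul); exists N. Qed.

End RealSequences.

Section MajorizedSeries.
Context {R : realType} {n : nat}.
Local Notation mi := {ffun 'I_n -> nat}.
Implicit Types (f g : 'cV[R]_n -> R) (r K : R) (c : mi -> R).

(** The ball of radius K in the Banach algebra of power series with finite
    weighted l1-norm sum_a |c_a| r^|a|.  The estimates of the analytic case are
    all norm estimates in this algebra. *)
Definition series_le r K f := exists c : mi -> R,
  (forall m, \sum_(a <- box m) `|c a| * r ^+ mdeg a <= K) /\
  (forall h, `|h| <= r -> (fun m => \sum_(a <- box m) c a * mono a h) @ \oo --> f h).

Lemma series_le_ext r K f g : (forall h, `|h| <= r -> f h = g h) ->
  series_le r K f -> series_le r K g.
Proof.
move=> fg [c [cK cf]]; exists c; split=> // h hr; rewrite -fg //; exact: cf.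
Qed.

Lemma series_leW r K K' f : K <= K' -> series_le r K f -> series_le r K' f.
Proof.
by move=> KK [c [cK cf]]; exists c; split=> // m; exact: le_trans (cK m) KK.
Qed.

Lemma series_le_radius r r' K f : 0 <= r' -> r' <= r -> series_le r K f -> series_le r' K f.
Proof.
move=> r0 rr [c [cK cf]]; exists c; split=> [m|h hr]; last by apply: cf; exact: le_trans rr.
apply: le_trans (cK m); apply: ler_sum => a _; apply: ler_wpM2l => //.
by apply: lerXn2r; rewrite ?nnegrE // (le_trans r0).
Qed.

Lemma series_le_ge0 r K f : series_le r K f -> 0 <= K.
Proof. by case=> c [/(_ 0%N) + _]; rewrite big_nil. Qed.

Lemma series_le_bound r K f h : series_le r K f -> `|h| <= r -> `|f h| <= K.
Proof.
move=> [c [cK cf]] hr; apply: (cvg_norm_le (N := 0%N) (cf h hr)) => m _.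
apply: le_trans (ler_norm_sum _ _ _) _; apply: le_trans (cK m).
by apply: ler_sum => a _; rewrite normrM ler_wpM2l // mono_le.
Qed.

Lemma series_le_monomial r (k : R) (a : mi) : 0 <= r ->
  series_le r (`|k| * r ^+ mdeg a) (fun h => k * mono a h).
Proof.
move=> r0; exists (fun b => if b == a then k else 0).
have E (G : mi -> R) m : (forall b, b != a -> G b = 0) ->
    \sum_(b <- box m) G b = if a \in box m then G a else 0.
  move=> G0; case: ifP => am; last first.
    by rewrite big_seq big1 // => b bm; apply: G0; apply: contraFneq am => <-.
  rewrite (bigD1_seq a) ?box_uniq //= big1 ?addr0 // => b ba; exact: G0.
split=> [m|h hr].
  rewrite E; last by move=> b /negPf ->; rewrite normr0 mul0r.
  by rewrite eqxx; case: ifP => // _; rewrite mulr_ge0 // exprn_ge0.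
have [N aN] := box_ex a; apply: cvg_from_eps => e e0; exists N => m Nm.
rewrite E; last by move=> b /negPf ->; rewrite mul0r.
by rewrite (box_sub Nm aN) eqxx subrr normr0 ltW.
Qed.

Lemma series_le_add r K L f g : 0 <= r -> series_le r K f -> series_le r L g ->
  series_le r (K + L) (fun h => f h + g h).
Proof.
move=> r0 [c [cK cf]] [d [dL dg]]; exists (fun a => c a + d a); split=> [m|h hr].
  apply: le_trans (lerD (cK m) (dL m)); rewrite -big_split /=.
  apply: ler_sum => a _; rewrite -mulrDl; apply: ler_wpM2r; first exact: exprn_ge0.
  exact: ler_normD.
under eq_fun do under eq_bigr do rewrite mulrDl.
under eq_fun do rewrite big_split.
by apply: cvgD; [exact: cf|exact: dg].
Qed.

Lemma series_le0 r : 0 <= r -> series_le r 0 (fun _ => 0).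
Proof.
move=> r0; have := series_le_monomial 0 [ffun => 0%N] r0; rewrite normr0 mul0r.
by apply: series_le_ext => h _; rewrite mul0r.
Qed.

Lemma series_le_sum r (I : Type) (s : seq I) (P : pred I) (K : I -> R)
    (f : I -> 'cV[R]_n -> R) : 0 <= r ->
  (forall i, P i -> series_le r (K i) (f i)) ->
  series_le r (\sum_(i <- s | P i) K i) (fun h => \sum_(i <- s | P i) f i h).
Proof.
move=> r0 Kf; elim: s => [|i s IH].
  by rewrite big_nil; apply: series_le_ext (series_le0 r0) => h _; rewrite big_nil.
rewrite big_cons; case Pi : (P i).
  apply: series_le_ext (series_le_add r0 (Kf i Pi) IH) => h _.
  by rewrite big_cons Pi.
by apply: series_le_ext IH => h _; rewrite big_cons Pi.
Qed.

(** The norm of a telescoping series is at most the sum of the norms of its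
    terms: the coefficients of the limit are the sums of the coefficients. *)
Lemma series_le_telescope r K (u : nat -> 'cV[R]_n -> R) (k : nat -> R) f :
  0 < r -> k 0%N = 0 -> (forall h, u 0%N h = 0) ->
  (forall m, series_le r (k m.+1 - k m) (fun h => u m.+1 h - u m h)) ->
  (forall m, k m <= K) ->
  (forall h, `|h| <= r -> u ^~ h @ \oo --> f h) ->
  series_le r K f.
Proof.
move=> r0 k0 u0 uk kK uf.
have kS m : k m <= k m.+1 by rewrite -subr_ge0; exact: series_le_ge0 (uk m).
have [t [t0 tp kt]] := incr_tail kS kK.
have [c_ /all_and2 [cK cu]] := choice uk.
have rp (a : mi) : 0 < r ^+ mdeg a by exact: exprn_gt0.
pose C m a := \sum_(i < m) c_ i a.
have Cdiff m l a : (m <= l)%N -> C l a - C m a = \sum_(m <= i < l) c_ i a.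
  move=> ml; rewrite /C -!(big_mkord xpredT (fun i => c_ i a)).
  by rewrite (big_cat_nat _ ml) //= addrAC subrr add0r.
have tail m l N : (m <= l)%N ->
    \sum_(a <- box N) `|C l a - C m a| * r ^+ mdeg a <= k l - k m.
  move=> ml; rewrite -(telescope_sumr _ ml).
  apply: (@le_trans _ _ (\sum_(m <= i < l) \sum_(a <- box N) `|c_ i a| * r ^+ mdeg a)).
    rewrite exchange_big /=; apply: ler_sum => a _; rewrite -mulr_suml.
    apply: ler_wpM2r; [exact/ltW/rp|by rewrite Cdiff //; exact: ler_norm_sum].
  by apply: ler_sum => i _; exact: cK.
have Ccvg a : cvgn (C ^~ a).
  apply: cauchy_real => e e0.
  have [N HN] := cvg0_eventually t0 (mulr_gt0 e0 (rp a)); exists N => m l Nm ml.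
  have [N' aN'] := box_ex a.
  have := tail m l N' ml; rewrite (bigD1_seq a) ?box_uniq //= => H.
  have {}H : `|C l a - C m a| * r ^+ mdeg a <= k l - k m.
    by apply: le_trans H; rewrite lerDl sumr_ge0 // => b _; rewrite mulr_ge0 // ltW.
  rewrite -(ler_pM2r (rp a)); apply: le_trans H _; apply: le_trans (kt _ _ ml) _.
  by apply: le_trans (ler_norm _) (HN m Nm).
pose c a := limn (C ^~ a).
have tailc m N : \sum_(a <- box N) `|c a - C m a| * r ^+ mdeg a <= t m.
  apply: (@cvg_le _ (fun l => \sum_(a <- box N) `|C l a - C m a| * r ^+ mdeg a) _ _ m).
    apply: cvg_sum_seq => a _; apply: cvgMl; apply: cvg_norm; apply: cvgB; last exact: cvg_cst.
    exact: Ccvg.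
  by move=> l ml; apply: le_trans (tail _ _ _ ml) (kt _ _ ml).
exists c; split=> [N|h hr].
  apply: (@cvg_le _ (fun l => \sum_(a <- box N) `|C l a| * r ^+ mdeg a) _ _ 0%N).
    by apply: cvg_sum_seq => a _; apply: cvgMl; apply: cvg_norm; exact: Ccvg.
  move=> l _; have := tail 0%N l N (leq0n l).
  rewrite k0 subr0; under eq_bigr do rewrite /C big_ord0 subr0.
  by move/le_trans; apply.
apply: cvg_from_eps => e e0; have e3 : 0 < e / 3 by rewrite divr_gt0.
have [N1 H1] := cvg0_eventually t0 e3.
have [N2 H2] := cvg_eventually (uf h hr) e3.
pose m := maxn N1 N2.
have Cm : (fun N => \sum_(a <- box N) C m a * mono a h) @ \oo --> u m h.
  have -> : u m h = \sum_(i < m) (u i.+1 h - u i h).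
    by rewrite -(big_mkord xpredT (fun i => u i.+1 h - u i h)) telescope_sumr // u0 subr0.
  have -> : (fun N => \sum_(a <- box N) C m a * mono a h) =
      (fun N => \sum_(i < m) \sum_(a <- box N) c_ i a * mono a h).
    apply/funext => N; rewrite exchange_big /=; apply: eq_bigr => a _.
    by rewrite mulr_suml.
  by apply: cvg_sum_seq => i _; exact: cu.
have [N3 H3] := cvg_eventually Cm e3.
exists N3 => N NN.
have B1 : `|\sum_(a <- box N) c a * mono a h - \sum_(a <- box N) C m a * mono a h| <= e / 3.
  rewrite -sumrB; apply: le_trans (ler_norm_sum _ _ _) _.
  apply: le_trans (le_trans (tailc m N) (le_trans (ler_norm _) (H1 m (leq_maxl _ _)))).
  by apply: ler_sum => a _; rewrite -mulrBl normrM ler_wpM2l // mono_le.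
have B2 := H3 N NN; have B3 := H2 m (leq_maxr _ _).
exact: dist3 B1 B2 B3.
Qed.

(** The partial sums converge as soon as their norms do. *)
Lemma series_le_telescope_cvg r K (u : nat -> 'cV[R]_n -> R) (k : nat -> R) :
  (forall m, series_le r (k m.+1 - k m) (fun h => u m.+1 h - u m h)) ->
  (forall m, k m <= K) -> forall h, `|h| <= r -> cvgn (u ^~ h).
Proof.
move=> uk kK h hr.
have kS m : k m <= k m.+1 by rewrite -subr_ge0; exact: series_le_ge0 (uk m).
have [t [t0 tp kt]] := incr_tail kS kK.
apply: cauchy_real => e e0; have [N HN] := cvg0_eventually t0 e0; exists N => m l Nm ml.
rewrite -(telescope_sumr (fun i => u i h) ml); apply: le_trans (ler_norm_sum _ _ _) _.
apply: (@le_trans _ _ (\sum_(m <= i < l) (k i.+1 - k i))).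
  by apply: ler_sum => i _; exact: series_le_bound (uk i) hr.
by rewrite telescope_sumr // (le_trans (kt _ _ ml))// (le_trans (ler_norm _))// HN.
Qed.

(** The product of the partial sums over boxes telescopes, and each increment is
    a finite combination of monomials whose norms add up to the increment of the
    product of the norms. *)
Lemma series_le_mul r K L f g : 0 < r -> series_le r K f -> series_le r L g ->
  series_le r (K * L) (fun h => f h * g h).
Proof.
move=> r0 [c [cK cf]] [d [dL dg]]; have r0' := ltW r0.
pose F m h := \sum_(a <- box m) c a * mono a h.
pose G m h := \sum_(a <- box m) d a * mono a h.
pose S m := \sum_(a <- box m) `|c a| * r ^+ mdeg a.
pose T m := \sum_(a <- box m) `|d a| * r ^+ mdeg a.
have nn (e : mi -> R) a : 0 <= `|e a| * r ^+ mdeg a by rewrite mulr_ge0 // exprn_ge0.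
have pol (s s' : seq mi) (P P' : pred mi) : series_le r
    ((\sum_(a <- s | P a) `|c a| * r ^+ mdeg a) * (\sum_(a <- s' | P' a) `|d a| * r ^+ mdeg a))
    (fun h => (\sum_(a <- s | P a) c a * mono a h) * (\sum_(a <- s' | P' a) d a * mono a h)).
  rewrite mulr_suml; under eq_bigr do rewrite mulr_sumr.
  apply: (@series_le_ext _ _ (fun h => \sum_(a <- s | P a) \sum_(b <- s' | P' b)
      (c a * d b) * mono [ffun i => (a i + b i)%N] h)).
    move=> h _; rewrite mulr_suml; apply: eq_bigr => a _; rewrite mulr_sumr.
    by apply: eq_bigr => b _; rewrite monoD; ring.
  apply: series_le_sum => // a _; apply: series_le_sum => // b _.
  have := series_le_monomial (c a * d b) [ffun i => (a i + b i)%N] r0'.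
  by rewrite mdegD exprD normrM; congr series_le; ring.
apply: (@series_le_telescope _ _ (fun m h => F m h * G m h) (fun m => S m * T m)) => //.
- by rewrite /S big_nil mul0r.
- by move=> h; rewrite /F big_nil mul0r.
- move=> m.
  have -> : S m.+1 * T m.+1 - S m * T m = (S m.+1 - S m) * T m.+1 + S m * (T m.+1 - T m) by ring.
  apply: (@series_le_ext _ _ (fun h => (F m.+1 h - F m h) * G m.+1 h + F m h * (G m.+1 h - G m h))).
    by move=> h _; ring.
  rewrite /S /T /F /G; apply: series_le_add => //.
    rewrite box_sum_diff //; apply: series_le_ext (pol _ _ _ _) => h _.
    by rewrite -box_sum_diff.
  rewrite [X in _ * X]box_sum_diff //; apply: series_le_ext (pol _ _ _ _) => h _.
  by rewrite -box_sum_diff.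
- by move=> m; apply: ler_pM; rewrite ?cK ?dL // /S /T sumr_ge0.
- by move=> h hr; apply: cvgM; [exact: cf|exact: dg].
Qed.

End MajorizedSeries.

(** * Composition of power series *)

Section SeriesComposition.
Context {R : realType} {n : nat}.
Local Notation mi := {ffun 'I_n -> nat}.
Implicit Types (f g : 'cV[R]_n -> R) (r K : R).

Lemma mdeg0 : mdeg [ffun _ : 'I_n => 0%N] = 0%N.
Proof. by rewrite /mdeg big1 // => i _; rewrite ffunE. Qed.

Lemma mono0 (h : 'cV[R]_n) : mono [ffun => 0%N] h = 1.
Proof. by rewrite /mono big1 // => i _; rewrite ffunE expr0. Qed.

Lemma series_le_cst r (k : R) : 0 <= r -> series_le r `|k| (fun _ : 'cV[R]_n => k).
Proof.
move=> r0; have := series_le_monomial k [ffun _ : 'I_n => 0%N] r0.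
rewrite mdeg0 mulr1; apply: series_le_ext => h _; by rewrite mono0 mulr1.
Qed.

Lemma series_le_coord r i : 0 <= r -> series_le r r (fun h : 'cV[R]_n => h i ord0).
Proof.
move=> r0; have := series_le_monomial 1 [ffun j : 'I_n => (j == i) : nat] r0.
have -> : mdeg [ffun j : 'I_n => (j == i) : nat] = 1%N.
  rewrite /mdeg (bigD1 i) //= big1 ?ffunE ?eqxx // => j /negPf ji.
  by rewrite ffunE ji.
rewrite normr1 mul1r expr1; apply: series_le_ext => h _.
rewrite mul1r /mono (bigD1 i) //= big1 ?ffunE ?eqxx ?mulr1 // => j /negPf ji.
by rewrite ffunE ji.
Qed.

Lemma series_le_scale r K k f : 0 < r -> series_le r K f ->
  series_le r (`|k| * K) (fun h => k * f h).
Proof. by move=> r0; apply: series_le_mul => //; exact: series_le_cst (ltW r0). Qed.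

Lemma series_le_exp r K f k : 0 < r -> series_le r K f ->
  series_le r (K ^+ k) (fun h => f h ^+ k).
Proof.
move=> r0 Kf; elim: k => [|k IH].
  have := @series_le_cst r 1 (ltW r0); rewrite normr1 expr0.
  by apply: series_le_ext => h _; rewrite expr0.
rewrite exprS; apply: series_le_ext (series_le_mul r0 Kf IH) => h _.
by rewrite exprS.
Qed.

Lemma series_le_prod r (I : Type) (s : seq I) (K : I -> R) (f : I -> 'cV[R]_n -> R) :
  0 < r -> (forall i, series_le r (K i) (f i)) ->
  series_le r (\prod_(i <- s) K i) (fun h => \prod_(i <- s) f i h).
Proof.
move=> r0 Kf; elim: s => [|i s IH].
  have := @series_le_cst r 1 (ltW r0); rewrite normr1 big_nil.
  by apply: series_le_ext => h _; rewrite big_nil.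
rewrite big_cons; apply: series_le_ext (series_le_mul r0 (Kf i) IH) => h _.
by rewrite big_cons.
Qed.

Section Layers.
Variables (m : nat) (c : {ffun 'I_m -> nat} -> R) (phi : {ffun 'I_m -> nat} -> 'cV[R]_n -> R).
Variables (kappa : {ffun 'I_m -> nat} -> R) (r K : R).
Hypotheses (r0 : 0 < r) (phi_le : forall a, series_le r (kappa a) (phi a)).
Hypothesis cK : forall N, \sum_(a <- box N) `|c a| * kappa a <= K.

Lemma layer_le N : series_le r
  (\sum_(a <- box N.+1) `|c a| * kappa a - \sum_(a <- box N) `|c a| * kappa a)
  (fun h => \sum_(a <- box N.+1) c a * phi a h - \sum_(a <- box N) c a * phi a h).
Proof.
rewrite box_sum_diff //.
apply: (@series_le_ext _ _ _ _ (fun h => \sum_(a <- box N.+1 | a \notin box N) c a * phi a h)).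
  by move=> h _; rewrite box_sum_diff.
apply: series_le_sum; [exact: ltW|move=> a _; exact: series_le_scale].
Qed.

Lemma series_le_layers f :
  (forall h, `|h| <= r -> (fun N => \sum_(a <- box N) c a * phi a h) @ \oo --> f h) ->
  series_le r K f.
Proof.
move=> cf; apply: (series_le_telescope r0 _ _ layer_le cK cf) => [|h];
  by rewrite big_nil.
Qed.

Lemma series_le_layers_cvg h : `|h| <= r ->
  cvgn (fun N => \sum_(a <- box N) c a * phi a h).
Proof. exact: (series_le_telescope_cvg layer_le cK). Qed.

End Layers.

Section Compose.
Context {m : nat}.
Implicit Types (F : 'cV[R]_m -> R) (G : 'cV[R]_n -> 'cV[R]_m).

Lemma series_le_mono r rho G (a : {ffun 'I_m -> nat}) : 0 < r ->
  (forall i, series_le r rho (fun h => G h i ord0)) ->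
  series_le r (rho ^+ mdeg a) (fun h => mono a (G h)).
Proof.
move=> r0 HG; rewrite /mdeg -prodrXr; apply: series_le_prod => // i.
exact: series_le_exp.
Qed.

Lemma series_map_bound r rho G h : 0 <= rho ->
  (forall i, series_le r rho (fun h => G h i ord0)) -> `|h| <= r -> `|G h| <= rho.
Proof. by move=> rho0 HG hr; apply/col_normP => // i; exact: series_le_bound (HG i) hr. Qed.

(** Substituting G for the variables replaces each monomial of F by a product of
    norm at most rho^|a|, so the norm of F o G is at most that of F. *)
Lemma series_le_comp r rho K F G : 0 < r -> 0 < rho -> series_le rho K F ->
  (forall i, series_le r rho (fun h => G h i ord0)) ->
  series_le r K (fun h => F (G h)).
Proof.
move=> r0 rho0 [c [cK cF]] HG.
apply: (series_le_layers r0 (fun a => series_le_mono a r0 HG) cK) => h hr.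
by apply: cF; exact: series_map_bound (ltW rho0) HG hr.
Qed.

Lemma natr_le_exp2 k : k%:R <= 2 ^+ k :> R.
Proof. by rewrite -natrX ler_nat ltnW // ltn_expl. Qed.

(** Each factor of a monomial of degree k contributes delta rho^(k-1) to the
    difference, and k <= 2^k is absorbed by doubling the radius. *)
Lemma series_le_lipschitz r rho delta K F G G' : 0 < r -> 0 < rho ->
  series_le (2 * rho) K F ->
  (forall i, series_le r rho (fun h => G h i ord0)) ->
  (forall i, series_le r rho (fun h => G' h i ord0)) ->
  (forall i, series_le r delta (fun h => G h i ord0 - G' h i ord0)) ->
  0 <= delta -> series_le r (delta / rho * K) (fun h => F (G h) - F (G' h)).
Proof.
move=> r0 rho0 [c [cK cF]] HG HG' HD d0; have rho0' := ltW rho0.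
pose T k (u v : 'cV[R]_n -> R) := [/\ series_le r (rho ^+ k) u, series_le r (rho ^+ k) v &
  series_le r (k%:R * rho ^+ k * (delta / rho)) (fun h => u h - v h)].
have T1 : T 0%N (fun _ => 1) (fun _ => 1).
  have := series_le_cst 1 (ltW r0); rewrite normr1 => H; split=> //.
  by rewrite !mul0r; apply: series_le_ext (series_le0 (ltW r0)) => h _; rewrite subrr.
have TM k l u v u' v' : T k u v -> T l u' v' ->
    T (k + l)%N (fun h => u h * u' h) (fun h => v h * v' h).
  move=> [Tu Tv Tw] [Tu' Tv' Tw']; split; rewrite ?exprD; try exact: series_le_mul.
  have := series_le_add (ltW r0) (series_le_mul r0 Tw Tu') (series_le_mul r0 Tv Tw').
  have -> : k%:R * rho ^+ k * (delta / rho) * rho ^+ l +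
      rho ^+ k * (l%:R * rho ^+ l * (delta / rho)) =
      (k + l)%:R * (rho ^+ k * rho ^+ l) * (delta / rho) by rewrite natrD; ring.
  by apply: series_le_ext => h _; ring.
have TX i k : T k (fun h => G h i ord0 ^+ k) (fun h => G' h i ord0 ^+ k).
  elim: k => [|k IH]; first exact: T1.
  have Ti : T 1%N (fun h => G h i ord0) (fun h => G' h i ord0).
    by split => //; rewrite mul1r expr1 mulrC divfK ?gt_eqF.
  have := TM _ _ _ _ _ _ Ti IH; rewrite add1n; congr T; apply/funext => h; by rewrite exprS.
have Tmono a : T (mdeg a) (fun h => mono a (G h)) (fun h => mono a (G' h)).
  rewrite /T /mono /mdeg; elim: (index_enum _) => [|i s IH].
    by rewrite big_nil; have := T1; congr T; apply/funext => h; rewrite big_nil.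
  rewrite big_cons; have := TM _ _ _ _ _ _ (TX i (a i)) IH.
  by congr T; apply/funext => h; rewrite big_cons.
apply: (@series_le_layers m c (fun a h => mono a (G h) - mono a (G' h))
  (fun a => (mdeg a)%:R * rho ^+ mdeg a * (delta / rho))) => //.
- by move=> a; have [] := Tmono a.
- move=> N; apply: (@le_trans _ _ (delta / rho * \sum_(a <- box N) `|c a| * (2 * rho) ^+ mdeg a)).
    rewrite mulr_sumr; apply: ler_sum => a _.
    rewrite mulrA mulrC ler_wpM2l ?divr_ge0 //.
    by rewrite ler_wpM2l // exprMn ler_wpM2r ?exprn_ge0 // natr_le_exp2.
  by rewrite ler_wpM2l // divr_ge0.
move=> h hr; under eq_fun do under eq_bigr do rewrite mulrBr.
under eq_fun do rewrite sumrB.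
have rho2 : rho <= 2 * rho by rewrite ler_peMl ?ler1n // ltW.
by apply: cvgB; apply: cF; apply: le_trans rho2;
  [apply: series_map_bound HG hr|apply: series_map_bound HG' hr]; exact: ltW.
Qed.

End Compose.

(** Without constant term the norm decreases linearly with the radius. *)
Lemma series_le_small r rho K f : 0 < r -> r <= rho -> series_le rho K f -> f 0 = 0 ->
  series_le r (r / rho * K) f.
Proof.
move=> r0 rr [c [cK cf]] f0; have rho0 : 0 < rho by exact: lt_le_trans r0 rr.
have m0 (a : mi) : a != [ffun => 0%N] -> mono a 0 = 0 :> R /\ (0 < mdeg a)%N.
  move=> aN; have [i ai] : exists i, (0 < a i)%N.
    apply/existsP; apply: contraNT aN => /existsPn H; apply/eqP/ffunP => i.
    by rewrite ffunE; apply/eqP; rewrite -leqn0 leqNgt; exact: H.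
  split; last by rewrite /mdeg (bigD1 i) //= ltn_addr.
  by rewrite /mono (bigD1 i) //= mxE expr0n gtn_eqF // mul0r.
have c0 : c [ffun => 0%N] = 0.
  have : (fun N => \sum_(a <- box N) c a * mono a 0) @ \oo --> c [ffun => 0%N].
    apply: cvg_from_eps => e e0; exists 1%N => N N1.
    have zN : [ffun _ : 'I_n => 0%N] \in box N.
      by apply: (@box_sub n 1%N N N1); rewrite mem_box; apply/forallP => i; rewrite ffunE.
    rewrite (bigD1_seq [ffun => 0%N]) ?box_uniq //= big1 ?addr0.
      by rewrite mono0 mulr1 subrr normr0 ltW.
    by move=> a /m0 [-> _]; rewrite mulr0.
  have := cf 0; rewrite normr0 f0 => /(_ (ltW rho0)) H1 H2.
  by apply/esym; exact: (cvg_unique _ H1 H2).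
exists c; split=> [N|h hr]; last by apply: cf; exact: le_trans rr.
apply: (@le_trans _ _ (r / rho * \sum_(a <- box N) `|c a| * rho ^+ mdeg a)).
  rewrite mulr_sumr; apply: ler_sum => a _.
  have [->|/m0 [_ ad]] := eqVneq a [ffun => 0%N].
    by rewrite c0 normr0 !mul0r mulr0.
  rewrite mulrCA ler_wpM2l // -(prednK ad) !exprS mulrA divfK ?gt_eqF //.
  by rewrite ler_wpM2l ?(ltW r0) // lerXn2r // nnegrE ltW.
by rewrite ler_wpM2l // divr_ge0 // ltW.
Qed.

End SeriesComposition.

(** * Analytic functions *)

Section MonomialDerivative.
Context {R : realType} {n : nat}.
Local Notation mi := {ffun 'I_n -> nat}.

Lemma Ck_exp k (U : set 'cV[R]_n) f e : open U -> Ck k U f -> Ck k U (fun x => f x ^+ e).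
Proof.
move=> oU Cf; elim: e => [|e IH].
  by apply: Ck_ext (Ck_cst k U 1) => // x _; rewrite expr0.
by apply: Ck_ext (Ck_mul oU Cf IH) => // x _; rewrite exprS.
Qed.

Lemma Ck_prod k (U : set 'cV[R]_n) (I : Type) (s : seq I) (P : pred I) (F : I -> 'cV[R]_n -> R) :
  open U -> (forall i, P i -> Ck k U (F i)) -> Ck k U (fun x => \prod_(i <- s | P i) F i x).
Proof.
move=> oU CF; elim: s => [|i s IH].
  by apply: Ck_ext (Ck_cst k U 1) => // x _; rewrite big_nil.
case Pi : (P i).
  by apply: Ck_ext (Ck_mul oU (CF i Pi) IH) => // x _; rewrite big_cons Pi.
by apply: Ck_ext IH => // x _; rewrite big_cons Pi.
Qed.

Lemma differentiable_mono (a : mi) (x : 'cV[R]_n) : differentiable (mono a : 'cV[R]_n -> R) x.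
Proof.
have : Ck 1 [set: 'cV[R]_n] (mono a : 'cV[R]_n -> R).
  by apply: Ck_prod => [|i _]; [exact: openT|apply: Ck_exp; [exact: openT|exact: Ck_coord]].
by move=> [H _]; exact: H.
Qed.

Lemma is_derive_coord (x v : 'cV[R]_n) i :
  is_derive x v (fun h : 'cV[R]_n => h i ord0) (v i ord0).
Proof.
apply: DeriveDef; first by apply: diff_derivable; exact: differentiable_coord.
by rewrite -(@derive_mxE _ _ _ _ id) ?derive_id.
Qed.

Lemma is_derive_exp (V : normedModType R) (f : V -> R) x v df k : is_derive x v f df ->
  is_derive x v (fun h => f h ^+ k) (k%:R * f x ^+ k.-1 * df).
Proof.
move=> fd; elim: k => [|k IH]; first by rewrite !mul0r; exact: is_derive_cst.
have -> : (fun h => f h ^+ k.+1) = f * (fun h => f h ^+ k).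
  by apply/funext => h; rewrite exprS.
apply: is_derive_eq; rewrite /GRing.scale /=; case: k IH => [|k] _ /=.
  by rewrite expr0; ring.
by rewrite exprS [k.+2%:R]mulrS; ring.
Qed.

Lemma is_derive_prod0 (V : normedModType R) (I : Type) (s : seq I) (P : pred I)
    (F : I -> V -> R) x v :
  (forall i, P i -> is_derive x v (F i) 0) ->
  is_derive x v (fun h => \prod_(i <- s | P i) F i h) 0.
Proof.
move=> HF; elim: s => [|i s IH].
  by under eq_fun do rewrite big_nil; exact: is_derive_cst.
case Pi : (P i); under eq_fun do rewrite big_cons Pi; last exact: IH.
have Hi := HF i Pi.
have : is_derive x v (F i * (fun h => \prod_(i <- s | P i) F i h)) 0.
  by apply: is_derive_eq; rewrite !scaler0 addr0.
by [].
Qed.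

Lemma is_derive_sum_seq (V : normedModType R) (I : Type) (s : seq I)
    (F : I -> V -> R) (dF : I -> R) x v :
  (forall i, is_derive x v (F i) (dF i)) ->
  is_derive x v (fun h => \sum_(i <- s) F i h) (\sum_(i <- s) dF i).
Proof.
move=> HF; elim: s => [|i s IH].
  by rewrite big_nil; under eq_fun do rewrite big_nil; exact: is_derive_cst.
rewrite big_cons; under eq_fun do rewrite big_cons.
have Hi := HF i.
have : is_derive x v (F i + (fun h => \sum_(i <- s) F i h)) (dF i + \sum_(i <- s) dF i).
  by apply: is_derive_eq.
by [].
Qed.

Definition mdecr (a : mi) i : mi := [ffun j => (a j - (j == i))%N].

Lemma derive_mono (a : mi) i (x : 'cV[R]_n) :
  'D_(ecol i) (mono a) x = (a i)%:R * mono (mdecr a i) x.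
Proof.
have E : mono a = (fun h : 'cV[R]_n => h i ord0 ^+ a i) *
    (fun h => \prod_(j < n | j != i) h j ord0 ^+ a j).
  by apply/funext => h; rewrite /mono (bigD1 i).
have H1 : is_derive x (ecol i) (fun h : 'cV[R]_n => \prod_(j < n | j != i) h j ord0 ^+ a j) 0.
  apply: is_derive_prod0 => j ji; have Hj := is_derive_coord x (ecol i) j.
  have := is_derive_exp (a j) Hj; have -> : ecol i j ord0 = 0 :> R.
    by rewrite mxE (negPf ji).
  by rewrite mulr0.
have H2 := is_derive_exp (a i) (is_derive_coord x (ecol i) i).
rewrite mxE !eqxx mulr1 in H2.
rewrite E; have := is_deriveM H2 H1; move/@derive_val => ->.
rewrite scaler0 add0r /GRing.scale /= mulrC /mono [in RHS](bigD1 i) //=.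
rewrite [mdecr a i i]ffunE eqxx subn1 mulrA; congr (_ * _).
by apply: eq_bigr => j ji; rewrite ffunE (negPf ji) subn0.
Qed.

Lemma mdeg_mdecr (a : mi) i : (0 < a i)%N -> mdeg a = (mdeg (mdecr a i)).+1.
Proof.
move=> ai; rewrite /mdeg (bigD1 i) //= [in RHS](bigD1 i) //= ffunE eqxx subn1 -addSn prednK //.
by congr (_ + _)%N; apply: eq_bigr => j ji; rewrite ffunE (negPf ji) subn0.
Qed.

(** The factor k produced by differentiating a monomial of degree k is absorbed
    by doubling the radius, since k <= 2^k. *)
Lemma mdeg_weight (r : R) (a : mi) : 0 < r ->
  (mdeg a)%:R * r ^+ (mdeg a).-1 <= (2 * r) ^+ mdeg a / r.
Proof.
move=> r0; rewrite ler_pdivlMr // exprMn; case: (mdeg a) => [|k].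
  by rewrite !mul0r mulr_ge0 // ?exprn_ge0 // ltW.
rewrite /= -mulrA -exprSr ler_wpM2r ?natr_le_exp2 //.
by rewrite exprn_ge0 // ltW.
Qed.

Lemma derive_mono_bound (r : R) (a : mi) (x v : 'cV[R]_n) : 0 < r -> `|x| <= r ->
  `|'D_v (mono a) x| <= (2 * r) ^+ mdeg a / r * `|v|.
Proof.
move=> r0 xr; apply: (@le_trans _ _ ((mdeg a)%:R * r ^+ (mdeg a).-1 * `|v|)); last first.
  by rewrite ler_wpM2r // mdeg_weight.
rewrite derive_coords; last exact: differentiable_mono.
apply: le_trans (ler_norm_sum _ _ _) _.
rewrite {1}/mdeg natr_sum !mulr_suml; apply: ler_sum => i _.
rewrite derive_mono; case: (posnP (a i)) => [->|ai].
  by rewrite !mul0r mulr0 normr0.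
rewrite normrM mulrC normrM normr_nat -!mulrA ler_wpM2l // ler_pM //; last exact: coord_le_norm.
by rewrite (mdeg_mdecr ai) /= mono_le.
Qed.

End MonomialDerivative.

Section SeriesDerivative.
Context {R : realType} {n : nat}.
Local Notation mi := {ffun 'I_n -> nat}.
Implicit Types (f g : 'cV[R]_n -> R) (r K : R).

(** Power series may be differentiated term by term: on a smaller ball the
    differentiated partial sums are again dominated by a convergent series. *)
Lemma series_le_derive r K f : 0 < r -> series_le (2 * r) K f ->
  (forall h, `|h| < r -> differentiable f h) /\
  (forall i, series_le (r / 2) (K / r) ('D_(ecol i) f)).
Proof.
move=> r0 [c [cK cf]]; have r0' := ltW r0.
pose u m (h : 'cV[R]_n) := \sum_(a <- box m) c a * mono a h.
pose k m := \sum_(a <- box m) `|c a| * (2 * r) ^+ mdeg a.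
have r20 : 0 <= 2 * r by rewrite mulr_ge0.
have kS m : k m <= k m.+1.
  by apply: box_sum_incr => // a; rewrite mulr_ge0 // exprn_ge0.
have [t [t0 tp kt]] := incr_tail kS cK.
have iu v m h : is_derive h v (u m) (\sum_(a <- box m) c a * 'D_v (mono a) h).
  apply: is_derive_sum_seq => a.
  have H : is_derive h v (mono a : 'cV[R]_n -> R) ('D_v (mono a) h).
    by apply/derivableP/diff_derivable/differentiable_mono.
  exact: is_deriveZ.
have Du v m h : 'D_v (u m) h = \sum_(a <- box m) c a * 'D_v (mono a) h.
  by rewrite (@derive_val _ _ _ _ _ _ _ (iu v m h)).
have du m h : differentiable (u m) h.
  have : Ck 1 [set: 'cV[R]_n] (u m).
    apply: Ck_sum => [|a _]; first exact: openT.
    apply: Ck_mul; [exact: openT|exact: Ck_cst|].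
    by apply: Ck_prod => [|i _]; [exact: openT|apply: Ck_exp; [exact: openT|exact: Ck_coord]].
  by move=> [H _]; exact: H.
have bE h : ball (0 : 'cV[R]_n) r h <-> `|h| < r by rewrite -ball_normE /= sub0r normrN.
have key := @uniform_limit_diff R _ 0 r u f (fun m => t m / r).
have {}key : forall h, `|h| < r -> differentiable f h /\
    (forall v, (fun m => 'D_v (u m) h) @ \oo --> 'D_v f h).
  move=> h /bE; apply: key => //.
  - move=> x /bE xr; apply: cf; apply: le_trans (ltW xr) _.
    by rewrite ler_peMl // ler1n.
  - by rewrite -(mul0r r^-1); apply: cvgMl.
  - move=> m l x v ml /bE xr; rewrite !Du box_sum_diff //.
    apply: le_trans (ler_norm_sum _ _ _) _.
    apply: (@le_trans _ _ ((k l - k m) / r * `|v|)); last first.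
      by rewrite ler_wpM2r // ler_wpM2r ?invr_ge0 // kt.
    rewrite box_sum_diff // !mulr_suml; apply: ler_sum => a _.
    rewrite normrM -!mulrA ler_wpM2l // mulrA.
    exact: derive_mono_bound (ltW xr).
split=> [h hr|i]; first by have [] := key h hr.
have r2 : 0 < r / 2 by rewrite divr_gt0.
have r2r : r / 2 < r by rewrite ltr_pdivrMr // ltr_pMr // ltr1n.
apply: (@series_le_layers _ _ n c (fun a => 'D_(ecol i) (mono a))
   (fun a => (2 * r) ^+ mdeg a / r)) => //.
- move=> a; apply: series_leW (mdeg_weight a r0) _.
  case: (posnP (a i)) => [ai|ai].
    apply: series_leW (series_le_ext _ (series_le0 (ltW r2))).
      by rewrite mulr_ge0 // exprn_ge0.
    by move=> h _; rewrite derive_mono ai mul0r.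
  have := series_le_monomial (a i)%:R (mdecr a i) r0'.
  rewrite (mdeg_mdecr ai) /= => /(series_le_radius (ltW r2) (ltW r2r)) H.
  apply: series_leW (series_le_ext _ H); last by move=> h _; rewrite derive_mono.
  rewrite normr_nat ler_wpM2r ?exprn_ge0 // ler_nat -(mdeg_mdecr ai).
  by rewrite /mdeg (bigD1 i) //= leq_addr.
- move=> N; under eq_bigr do rewrite mulrA.
  by rewrite -mulr_suml ler_wpM2r // invr_ge0.
- move=> h hr; have := (key h (le_lt_trans hr r2r)).2 (ecol i).
  by under eq_fun do rewrite Du.
Qed.

End SeriesDerivative.

Lemma geometric_sum (R : realType) (v : R) m : (\sum_(i < m) v ^+ i) * (1 - v) = 1 - v ^+ m.
Proof. by rewrite -(opprB (v ^+ m)) subrX1; ring. Qed.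

Lemma cvg_succ (R : realType) (u : nat -> R) (l : R) :
  (fun N => u N.+1) @ \oo --> l <-> u @ \oo --> l.
Proof. by rewrite -(cvg_shiftS u). Qed.

Section AnalyticAt.
Context {R : realType} {n : nat}.
Local Notation mi := {ffun 'I_n -> nat}.
Implicit Types (f g : 'cV[R]_n -> R) (r K : R).

Lemma power_termE (c : mi -> R) (h : 'cV[R]_n) a : power_term c h a = c a * mono a h.
Proof. by []. Qed.

Lemma box_sum_funE (F : mi -> R) : box_sum F = (fun N => \sum_(a <- box N.+1) F a).
Proof. by apply/funext => N; exact: box_sumE. Qed.

Lemma analytic_series f x : analytic_at f x ->
  exists r K, 0 < r /\ series_le r K (fun h => f (x + h)).
Proof.
move=> [c [r [r0 H]]].
have r2 : 0 < r / 2 by rewrite divr_gt0.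
have r2r : r / 2 < r by rewrite ltr_pdivrMr // ltr_pMr // ltr1n.
pose h0 : 'cV[R]_n := const_mx (r / 2).
have h0r : `|h0| < r.
  by apply/col_norm_ltP => // i; rewrite mxE gtr0_norm.
have mh a : `|mono a h0| = (r / 2) ^+ mdeg a.
  rewrite /mono normr_prod /mdeg -prodrXr; apply: eq_bigr => i _.
  by rewrite mxE normrX gtr0_norm.
have [Hc _] := H h0 h0r.
exists (r / 2), (limn (box_sum (fun a => `|power_term c h0 a|))); split=> //.
exists c; split=> [m|h hr]; last first.
  have [_] := H h (le_lt_trans hr r2r); rewrite box_sum_funE.
  by move/(@cvg_succ _ (fun N => \sum_(a <- box N) c a * mono a h)).
have nd : nondecreasing_seq (box_sum (fun a => `|power_term c h0 a|)).
  by apply/nondecreasing_seqP => N; rewrite !box_sumE; exact: box_sum_incr.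
apply: le_trans (nondecreasing_cvgn_le nd Hc m); rewrite box_sumE.
apply: le_trans (box_sum_incr _ (leqnSn m)) _ => [a|].
  by rewrite mulr_ge0 // exprn_ge0 // ltW.
by apply: ler_sum => a _; rewrite power_termE normrM mh.
Qed.

Lemma series_analytic f x r K : 0 < r -> series_le r K (fun h => f (x + h)) ->
  analytic_at f x.
Proof.
move=> r0 [c [cK cf]]; exists c, r; split=> // h hr; split; last first.
  rewrite box_sum_funE.
  exact: ((@cvg_succ _ (fun N => \sum_(a <- box N) c a * mono a h) _).2 (cf h (ltW hr))).
apply: nondecreasing_is_cvgn.
  by apply/nondecreasing_seqP => m; rewrite !box_sumE; exact: box_sum_incr.
exists K => _ [N _ <-]; rewrite box_sumE; apply: le_trans (cK N.+1).
by apply: ler_sum => a _; rewrite power_termE normrM ler_wpM2l // mono_le // ltW.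
Qed.

Lemma series_translate r K f (k : 'cV[R]_n) : 0 < r -> `|k| <= r ->
  series_le (2 * r) K f -> series_le r K (fun h => f (k + h)).
Proof.
move=> r0 kr H; apply: (series_le_comp (G := fun h => k + h) r0 _ H); first by rewrite mulr_gt0.
move=> i; apply: series_le_ext (series_leW _ (series_le_add (ltW r0)
   (series_le_cst (k i ord0) (ltW r0)) (series_le_coord i (ltW r0)))).
  by move=> h _; rewrite mxE.
by rewrite mulrC mulr_natr mulr2n lerD2r (le_trans (coord_le_norm k i)).
Qed.

Lemma series_analytic_ball f x r K : 0 < r -> series_le (2 * r) K (fun h => f (x + h)) ->
  forall y, `|y - x| <= r -> analytic_at f y.
Proof.
move=> r0 H y yx; apply: (series_analytic (K := K) r0).
apply: series_le_ext (series_translate r0 yx H) => h _.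
by congr f; rewrite addrA [x + _]addrC subrK.
Qed.

Lemma differentiable_translate (V : normedModType R) (f : V -> R) x y :
  differentiable (fun h => f (x + h)) y -> differentiable f (x + y).
Proof.
move=> df; have -> : f = (fun h => f (x + h)) \o (fun z => z - x).
  by apply/funext => z /=; rewrite addrC subrK.
apply: differentiable_comp; last by rewrite /= addrC addKr.
by apply: differentiableB.
Qed.

Lemma derive_translate (V : normedModType R) (f : V -> R) x y v :
  'D_v (fun h => f (x + h)) y = 'D_v f (x + y).
Proof.
rewrite /derive; suff -> : (fun h : R => h^-1 *: (f (x + (h *: v + y)) - f (x + y))) =
  (fun h : R => h^-1 *: (f (h *: v + (x + y)) - f (x + y))) by [].
by apply/funext => h; rewrite addrCA.
Qed.

Lemma analytic_differentiable f x : analytic_at f x -> differentiable f x.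
Proof.
move=> /analytic_series [r [K [r0 H]]]; rewrite -[x]addr0.
apply: differentiable_translate; have r2 : 0 < r / 2 by rewrite divr_gt0.
have E : 2 * (r / 2) = r by rewrite mulrC divfK.
by rewrite -E in H; apply: (series_le_derive r2 H).1; rewrite normr0.
Qed.

Lemma analytic_ext f g x : (\forall y \near x, f y = g y) -> analytic_at f x -> analytic_at g x.
Proof.
move=> /nbhs_ballP [d d0 fg] /analytic_series [r [K [r0 H]]].
have m0 : 0 < Num.min r (d / 2) by rewrite lt_min r0 divr_gt0.
apply: (series_analytic (K := K) m0).
have mr : Num.min r (d / 2) <= r by rewrite ge_min lexx.
apply: series_le_ext (series_le_radius (ltW m0) mr H) => h hm; apply: fg.
rewrite -ball_normE /= opprD addrA subrr sub0r normrN.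
apply: le_lt_trans hm _; apply: (@le_lt_trans _ _ (d / 2)); first by rewrite ge_min lexx orbT.
by rewrite ltr_pdivrMr // ltr_pMr // ltr1n.
Qed.

Lemma analytic_derive_ecol f x i : analytic_at f x -> analytic_at ('D_(ecol i) f) x.
Proof.
move=> /analytic_series [r [K [r0 H]]].
have r2 : 0 < r / 2 by rewrite divr_gt0.
have E : 2 * (r / 2) = r by rewrite mulrC divfK.
rewrite -E in H; have H2 := (series_le_derive r2 H).2 i.
have r4 : 0 < r / 2 / 2 by rewrite divr_gt0.
apply: (series_analytic r4); apply: series_le_ext H2 => h _.
exact: derive_translate.
Qed.

Lemma analytic_cst x (k : R) : analytic_at (fun _ : 'cV[R]_n => k) x.
Proof. exact: (series_analytic ltr01 (series_le_cst k ler01)). Qed.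

Lemma analytic_coord x i : analytic_at (fun h : 'cV[R]_n => h i ord0) x.
Proof.
apply: (series_analytic ltr01).
apply: series_le_ext (series_le_add ler01 (series_le_cst (x i ord0) ler01) (series_le_coord i ler01)).
by move=> h _; rewrite mxE.
Qed.

Lemma analytic_series2 f g x : analytic_at f x -> analytic_at g x ->
  exists r K L, [/\ 0 < r, series_le r K (fun h => f (x + h)) & series_le r L (fun h => g (x + h))].
Proof.
move=> /analytic_series [r [K [r0 H]]] /analytic_series [s [L [s0 G]]].
have m0 : 0 < Num.min r s by rewrite lt_min r0.
exists (Num.min r s), K, L; split=> //.
- by apply: series_le_radius H; rewrite ?ge_min ?lexx // ltW.
- by apply: series_le_radius G; rewrite ?ge_min ?lexx ?orbT // ltW.
Qed.

Lemma analytic_add f g x : analytic_at f x -> analytic_at g x ->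
  analytic_at (fun y => f y + g y) x.
Proof.
move=> af ag; have [r [K [L [r0 H G]]]] := analytic_series2 af ag.
exact: (series_analytic r0 (series_le_add (ltW r0) H G)).
Qed.

Lemma analytic_mul f g x : analytic_at f x -> analytic_at g x ->
  analytic_at (fun y => f y * g y) x.
Proof.
move=> af ag; have [r [K [L [r0 H G]]]] := analytic_series2 af ag.
exact: (series_analytic r0 (series_le_mul r0 H G)).
Qed.

(** Without constant term, the norm tends to zero with the radius. *)
Lemma analytic_eventually_small f x e : analytic_at f x -> f x = 0 -> 0 < e ->
  \forall r \near (0 : R)^'+, series_le r e (fun h => f (x + h)).
Proof.
move=> /analytic_series [rho [K [rho0 H]]] fx e0.
have K1 : 0 < K + 1 by rewrite ltr_wpDl // (series_le_ge0 H).
near=> r.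
have r0 : 0 < r by near: r; exact: nbhs_right_gt.
have rr : r <= rho by near: r; exact: nbhs_right_le.
have re : r <= e * rho / (K + 1) by near: r; apply: nbhs_right_le; rewrite divr_gt0 // mulr_gt0.
apply: series_leW (series_le_small r0 rr H _); last by rewrite addr0.
rewrite mulrAC ler_pdivrMr //; move: re; rewrite ler_pdivlMr // mulrDr mulr1 => /(le_trans _); apply.
by rewrite lerDl ltW.
Unshelve. all: by end_near. Qed.

(** A function that does not vanish is c (1 - u) with u small, and the
    geometric series in u converges in norm. *)
Lemma analytic_inv f x : analytic_at f x -> f x != 0 -> analytic_at (fun y => (f y)^-1) x.
Proof.
move=> af fx0; pose u y := 1 - (f x)^-1 * f y.
have au : analytic_at u x.
  apply: analytic_add; first exact: analytic_cst.
  apply: (@analytic_ext (fun y => -1 * ((f x)^-1 * f y))).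
    by near=> y; rewrite mulN1r.
  by apply: analytic_mul; [exact: analytic_cst|apply: analytic_mul => //; exact: analytic_cst].
have ux : u x = 0 by rewrite /u mulVf // subrr.
have h2 : 0 < (1 / 2 : R) by rewrite divr_gt0.
have [r [r0 Hu]] : exists r, 0 < r /\ series_le r (1 / 2) (fun h => u (x + h)).
  near (0 : R)^'+ => r; exists r; split; first by near: r; exact: nbhs_right_gt.
  by near: r; exact: analytic_eventually_small.
have ub h : `|h| <= r -> `|u (x + h)| <= 1 / 2 by exact: series_le_bound Hu.
have Hs : series_le r 2 (fun h => (1 - u (x + h))^-1).
  apply: (@series_le_telescope _ _ _ _ (fun m h => \sum_(i < m) u (x + h) ^+ i)
     (fun m => \sum_(i < m) (1 / 2) ^+ i)) => //.
  - by rewrite big_ord0.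
  - by move=> h; rewrite big_ord0.
  - move=> m; rewrite big_ord_recr /= addrAC subrr add0r.
    apply: series_le_ext (series_le_exp m r0 Hu) => h _.
    by rewrite big_ord_recr /= addrAC subrr add0r.
  - move=> m; have := subrX1 (1 / 2 : R) m.
    move: (\sum_(i < m) _) => S E.
    have : 0 <= (1 / 2 : R) ^+ m by rewrite exprn_ge0 // ltW.
    by lra.
  - move=> h /ub uh; set v := u (x + h) in uh *.
    have v1 : `|v| < 1 by apply: le_lt_trans uh _; rewrite ltr_pdivrMr // mul1r ltr1n.
    have vN : 1 - v != 0.
      by rewrite subr_eq0; apply: contraTneq v1 => <-; rewrite normr1 ltxx.
    have -> : (fun m => \sum_(i < m) v ^+ i) = (fun m => (1 - v ^+ m) / (1 - v)).
      apply/funext => m; apply: (mulIf vN); rewrite divfK //.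
      exact: geometric_sum.
    rewrite -[X in _ --> X]mul1r; apply: cvgMl.
    rewrite -[X in _ --> X]subr0; apply: cvgB; first exact: cvg_cst.
    exact: cvg_expr.
have a1 : analytic_at (fun y => (1 - u y)^-1) x by exact: series_analytic Hs.
apply: (@analytic_ext (fun y => (f x)^-1 * (1 - u y)^-1)).
  by near=> y; rewrite /u opprB addrC subrK invfM invrK mulrA mulVf // mul1r.
by apply: analytic_mul => //; exact: analytic_cst.
Unshelve. all: by end_near. Qed.

End AnalyticAt.

(** On a small ball the norm of g - g x is below the radius of convergence of the
    series of f at g x, which can then be composed with the series of g. *)
Lemma analytic_comp (R : realType) n m (f : 'cV[R]_m -> R) (g : 'cV[R]_n -> 'cV[R]_m) x :
  analytic_at f (g x) -> (forall i, analytic_at (fun y => g y i ord0) x) ->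
  analytic_at (fun y => f (g y)) x.
Proof.
move=> /analytic_series [rho [K [rho0 H]]] ag.
have sm i : \forall r \near (0 : R)^'+, series_le r rho (fun h => g (x + h) i ord0 - g x i ord0).
  apply: (@analytic_eventually_small _ _ (fun y => g y i ord0 - g x i ord0)) => //; last by rewrite subrr.
  apply: analytic_add; first exact: ag.
  exact: analytic_cst.
have {}sm : \forall r \near (0 : R)^'+, forall i, series_le r rho (fun h => g (x + h) i ord0 - g x i ord0).
  exact: filter_forall.
have [r [r0 Hr]] : exists r, 0 < r /\
    forall i, series_le r rho (fun h => g (x + h) i ord0 - g x i ord0).
  near (0 : R)^'+ => r; exists r; split; first by near: r; exact: nbhs_right_gt.
  by near: r.
apply: (series_analytic r0).
have := series_le_comp (G := fun h => g (x + h) - g x) r0 rho0 H.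
have Hr' i : series_le r rho (fun h => (g (x + h) - g x) i ord0).
  by apply: series_le_ext (Hr i) => h _; rewrite !mxE.
move=> /(_ Hr'); apply: series_le_ext => h _.
by rewrite addrC subrK.
Unshelve. all: by end_near. Qed.

(** * Regular functions and Jacobian matrices *)

Section Regular.
Context {R : realType} {C : category} {n : nat}.
Implicit Types (U : set 'cV[R]_n) (f g : 'cV[R]_n -> R).

Lemma regular_ext U f g : open U -> (forall x, U x -> f x = g x) ->
  regular C U f -> regular C U g.
Proof.
move=> oU fg; case: C => /= H.
  by move=> k; exact: Ck_ext oU fg (H k).
move=> x Ux; apply: analytic_ext (H x Ux).
by apply: filterS (open_near oU Ux).
Qed.

Lemma regular_sub U U' f : U' `<=` U -> regular C U f -> regular C U' f.
Proof.
move=> sU; case: C => /= H; first by move=> k; exact: Ck_sub sU (H k).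
by move=> x /sU; exact: H.
Qed.

Lemma regular_cst U (c : R) : regular C U (fun _ => c).
Proof.
by case: C => /= [k|x _]; [exact: Ck_cst|exact: analytic_cst].
Qed.

Lemma regular_coord U i : regular C U (fun x => x i ord0).
Proof.
by case: C => /= [k|x _]; [exact: Ck_coord|exact: analytic_coord].
Qed.

Lemma regular_add U f g : open U -> regular C U f -> regular C U g ->
  regular C U (fun x => f x + g x).
Proof.
move=> oU; case: C => /= Hf Hg; first by move=> k; exact: Ck_add.
by move=> x Ux; apply: analytic_add; [exact: Hf|exact: Hg].
Qed.

Lemma regular_mul U f g : open U -> regular C U f -> regular C U g ->
  regular C U (fun x => f x * g x).
Proof.
move=> oU; case: C => /= Hf Hg; first by move=> k; exact: Ck_mul.
by move=> x Ux; apply: analytic_mul; [exact: Hf|exact: Hg].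
Qed.

Lemma regular_opp U f : open U -> regular C U f -> regular C U (fun x => - f x).
Proof.
move=> oU Hf; apply: regular_ext (regular_mul oU (regular_cst U (-1)) Hf) => // x _.
by rewrite mulN1r.
Qed.

Lemma regular_sum U (I : Type) (r : seq I) (P : pred I) (F : I -> 'cV[R]_n -> R) : open U ->
  (forall i, P i -> regular C U (F i)) -> regular C U (fun x => \sum_(i <- r | P i) F i x).
Proof.
move=> oU CF; elim: r => [|i r IH].
  by apply: regular_ext (regular_cst U 0) => // x _; rewrite big_nil.
case Pi : (P i).
  by apply: regular_ext (regular_add oU (CF i Pi) IH) => // x _; rewrite big_cons Pi.
by apply: regular_ext IH => // x _; rewrite big_cons Pi.
Qed.

Lemma regular_prod U (I : Type) (r : seq I) (P : pred I) (F : I -> 'cV[R]_n -> R) : open U ->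
  (forall i, P i -> regular C U (F i)) -> regular C U (fun x => \prod_(i <- r | P i) F i x).
Proof.
move=> oU CF; elim: r => [|i r IH].
  by apply: regular_ext (regular_cst U 1) => // x _; rewrite big_nil.
case Pi : (P i).
  by apply: regular_ext (regular_mul oU (CF i Pi) IH) => // x _; rewrite big_cons Pi.
by apply: regular_ext IH => // x _; rewrite big_cons Pi.
Qed.

Lemma regular_inv U f : open U -> (forall x, U x -> f x != 0) -> regular C U f ->
  regular C U (fun x => (f x)^-1).
Proof.
move=> oU f0; case: C => /= Hf; first by move=> k; exact: Ck_inv.
by move=> x Ux; apply: analytic_inv; [exact: Hf|exact: f0].
Qed.

Lemma regular_diff U f x : U x -> regular C U f -> differentiable f x.
Proof.
move=> Ux; case: C => /= Hf; first exact: (Hf 1%N).1.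
exact/analytic_differentiable/Hf.
Qed.

Lemma regular_derive U f v : open U -> regular C U f -> regular C U ('D_v f).
Proof.
move=> oU; case: C => /= Hf; first by move=> k; exact: (Hf k.+1).2.
move=> x Ux; apply: (@analytic_ext _ _ (fun y => \sum_i v i ord0 * 'D_(ecol i) f y)).
  apply: filterS (open_near oU Ux) => y Uy.
  by rewrite derive_coords //; exact/analytic_differentiable/Hf.
elim: (index_enum _) => [|i s IH].
  by under eq_fun do rewrite big_nil; exact: analytic_cst.
under eq_fun do rewrite big_cons; apply: analytic_add => //.
by apply: analytic_mul; [exact: analytic_cst|exact/analytic_derive_ecol/Hf].
Qed.

Lemma regular_continuous U f x : U x -> regular C U f -> {for x, continuous f}.
Proof. by move=> Ux Hf; apply: differentiable_continuous; exact: regular_diff Hf. Qed.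

End Regular.

Lemma regular_Ck (R : realType) C n k (U : set 'cV[R]_n) f : open U ->
  regular C U f -> Ck k U f.
Proof.
move=> oU; elim: k f => [|k IH] f Hf; first by move=> x Ux; exact: regular_continuous Hf.
by split=> [x Ux|v]; [exact: regular_diff Hf|exact/IH/regular_derive].
Qed.

Lemma regular_comp (R : realType) C n m (U : set 'cV[R]_n) (V : set 'cV[R]_m)
    (f : 'cV[R]_m -> R) (g : 'cV[R]_n -> 'cV[R]_m) :
  open U -> open V -> (forall x, U x -> V (g x)) ->
  regular C V f -> regular_mx C U g -> regular C U (fun x => f (g x)).
Proof.
move=> oU oV UV; rewrite /regular_mx; case: C => /= Hf Hg.
  by move=> k; apply: (Ck_comp oU oV UV (Hf k)) => i; exact: Hg.
move=> x Ux; apply: analytic_comp; first exact/Hf/UV.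
by move=> i; exact: Hg.
Qed.

Section RegularMatrix.
Context {R : realType} {C : category} {n : nat}.
Implicit Types (U : set 'cV[R]_n).

Lemma regular_mx_sub U U' p q (F : 'cV[R]_n -> 'M[R]_(p, q)) : U' `<=` U ->
  regular_mx C U F -> regular_mx C U' F.
Proof. by move=> sU HF i j; exact: regular_sub sU (HF i j). Qed.

Lemma regular_mx_cst U p q (A : 'M[R]_(p, q)) : regular_mx C U (fun _ => A).
Proof. by move=> i j; exact: regular_cst. Qed.

Lemma regular_mx_id U : regular_mx C U id.
Proof. by move=> i j; rewrite (ord1 j); exact: regular_coord. Qed.

Lemma regular_mx_add U p q (F G : 'cV[R]_n -> 'M[R]_(p, q)) : open U ->
  regular_mx C U F -> regular_mx C U G -> regular_mx C U (fun x => F x + G x).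
Proof.
move=> oU HF HG i j.
by apply: regular_ext (regular_add oU (HF i j) (HG i j)) => // x _; rewrite mxE.
Qed.

Lemma regular_mx_opp U p q (F : 'cV[R]_n -> 'M[R]_(p, q)) : open U ->
  regular_mx C U F -> regular_mx C U (fun x => - F x).
Proof.
move=> oU HF i j.
by apply: regular_ext (regular_opp oU (HF i j)) => // x _; rewrite mxE.
Qed.

Lemma regular_mx_mul U p q s (F : 'cV[R]_n -> 'M[R]_(p, q)) (G : 'cV[R]_n -> 'M[R]_(q, s)) :
  open U -> regular_mx C U F -> regular_mx C U G -> regular_mx C U (fun x => F x *m G x).
Proof.
move=> oU HF HG i j.
apply: (@regular_ext _ _ _ _ (fun x => \sum_k F x i k * G x k j)) => //.
  by move=> x _; rewrite mxE.
by apply: regular_sum => // k _; exact: regular_mul.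
Qed.

Lemma regular_mx_entries U p q p' q' (F : 'cV[R]_n -> 'M[R]_(p, q))
    (G : 'cV[R]_n -> 'M[R]_(p', q')) (r : 'I_p' -> 'I_q' -> 'I_p) (c : 'I_p' -> 'I_q' -> 'I_q) :
  open U -> (forall x i j, G x i j = F x (r i j) (c i j)) ->
  regular_mx C U F -> regular_mx C U G.
Proof.
by move=> oU GF HF i j; apply: regular_ext (HF (r i j) (c i j)) => // x _; rewrite GF.
Qed.

Lemma regular_usubmx U p1 p2 q (F : 'cV[R]_n -> 'M[R]_(p1 + p2, q)) : open U ->
  regular_mx C U F -> regular_mx C U (fun x => usubmx (F x)).
Proof.
by move=> oU; apply: (@regular_mx_entries _ _ _ _ _ _ _ (fun i _ => lshift p2 i) (fun _ j => j)) => // x i j; rewrite mxE.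
Qed.

Lemma regular_dsubmx U p1 p2 q (F : 'cV[R]_n -> 'M[R]_(p1 + p2, q)) : open U ->
  regular_mx C U F -> regular_mx C U (fun x => dsubmx (F x)).
Proof.
by move=> oU; apply: (@regular_mx_entries _ _ _ _ _ _ _ (fun i _ => rshift p1 i) (fun _ j => j)) => // x i j; rewrite mxE.
Qed.

Lemma regular_lsubmx U p q1 q2 (F : 'cV[R]_n -> 'M[R]_(p, q1 + q2)) : open U ->
  regular_mx C U F -> regular_mx C U (fun x => lsubmx (F x)).
Proof.
by move=> oU; apply: (@regular_mx_entries _ _ _ _ _ _ _ (fun i _ => i) (fun _ j => lshift q2 j)) => // x i j; rewrite mxE.
Qed.

Lemma regular_rsubmx U p q1 q2 (F : 'cV[R]_n -> 'M[R]_(p, q1 + q2)) : open U ->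
  regular_mx C U F -> regular_mx C U (fun x => rsubmx (F x)).
Proof.
by move=> oU; apply: (@regular_mx_entries _ _ _ _ _ _ _ (fun i _ => i) (fun _ j => rshift q1 j)) => // x i j; rewrite mxE.
Qed.

Lemma regular_col_mx U p1 p2 q (F : 'cV[R]_n -> 'M[R]_(p1, q)) (G : 'cV[R]_n -> 'M[R]_(p2, q)) :
  open U -> regular_mx C U F -> regular_mx C U G ->
  regular_mx C U (fun x => col_mx (F x) (G x)).
Proof.
move=> oU HF HG i j; case: (split_ordP i) => k ->.
  by apply: regular_ext (HF k j) => // x _; rewrite col_mxEu.
by apply: regular_ext (HG k j) => // x _; rewrite col_mxEd.
Qed.

Lemma regular_det U p (F : 'cV[R]_n -> 'M[R]_p) : open U ->
  regular_mx C U F -> regular C U (fun x => \det (F x)).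
Proof.
move=> oU HF; apply: regular_sum => // s _; apply: regular_mul => //; first exact: regular_cst.
by apply: regular_prod => // i _; exact: HF.
Qed.

Lemma regular_invmx U p (F : 'cV[R]_n -> 'M[R]_p) : open U ->
  (forall x, U x -> F x \in unitmx) ->
  regular_mx C U F -> regular_mx C U (fun x => invmx (F x)).
Proof.
move=> oU uF HF i j.
apply: (@regular_ext _ _ _ _ (fun x => (\det (F x))^-1 * ((-1) ^+ (j + i) * \det (row' j (col' i (F x)))))) => //.
  by move=> x Ux; rewrite /invmx uF // !mxE.
apply: regular_mul => //.
  apply: regular_inv => //; last exact: regular_det.
  by move=> x Ux; have := uF x Ux; rewrite unitmxE unitfE.
apply: regular_mul => //; first exact: regular_cst.
apply: regular_det => // k l.
by apply: regular_ext (HF (lift j k) (lift i l)) => // x _; rewrite !mxE.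
Qed.

Lemma regular_mx_diff U p q (F : 'cV[R]_n -> 'M[R]_(p, q)) x : U x ->
  regular_mx C U F -> differentiable F x.
Proof. by move=> Ux HF; apply/differentiable_mxP => i j; exact: regular_diff (HF i j). Qed.

Lemma regular_mx_continuous U p q (F : 'cV[R]_n -> 'M[R]_(p, q)) x : U x ->
  regular_mx C U F -> {for x, continuous F}.
Proof. by move=> Ux HF; apply: differentiable_continuous; exact: regular_mx_diff HF. Qed.

Lemma regular_mx_derive U p q (F : 'cV[R]_n -> 'M[R]_(p, q)) v : open U ->
  regular_mx C U F -> regular_mx C U ('D_v F).
Proof.
move=> oU HF i j; apply: regular_ext (regular_derive v oU (HF i j)) => // x Ux.
by rewrite derive_mxE //; exact: regular_mx_diff HF.
Qed.

End RegularMatrix.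

Lemma regular_mx_comp (R : realType) C n m p q (U : set 'cV[R]_n) (V : set 'cV[R]_m)
    (F : 'cV[R]_m -> 'M[R]_(p, q)) (g : 'cV[R]_n -> 'cV[R]_m) :
  open U -> open V -> (forall x, U x -> V (g x)) ->
  regular_mx C V F -> regular_mx C U g -> regular_mx C U (fun x => F (g x)).
Proof.
move=> oU oV UV HF Hg i j.
exact: (@regular_comp _ _ _ _ U V (fun y => F y i j) g).
Qed.

Section Jacobian.
Context {R : realType} {n m : nat}.
Implicit Types (F : 'cV[R]_n -> 'cV[R]_m).

Definition jac F x : 'M[R]_(m, n) := \matrix_(i, j) 'D_(ecol j) (fun y => F y i ord0) x.

Lemma jacE F x v : differentiable F x -> 'D_v F x = jac F x *m v.
Proof.
move=> dF; apply/colP => i; rewrite derive_mxE // derive_coords; last first.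
  by have /differentiable_mxP := dF; exact.
by rewrite mxE; apply: eq_bigr => j _; rewrite mxE mulrC.
Qed.

Lemma jac_unique F x (A : 'M[R]_(m, n)) :
  (forall v, 'D_v F x = A *m v) -> differentiable F x -> jac F x = A.
Proof.
move=> H dF; apply/matrixP => i j; have := H (ecol j); rewrite jacE // => /colP /(_ i).
by rewrite -!colE !mxE.
Qed.

Lemma regular_jac C U F : open U -> regular_mx C U F -> regular_mx C U (jac F).
Proof.
move=> oU HF i j; apply: regular_ext (regular_derive (ecol j) oU (HF i ord0)) => // x Ux.
by rewrite mxE.
Qed.

End Jacobian.

Lemma jac_comp (R : realType) n m p (F : 'cV[R]_m -> 'cV[R]_p) (G : 'cV[R]_n -> 'cV[R]_m) x :
  differentiable G x -> differentiable F (G x) ->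
  jac (fun y => F (G y)) x = jac F (G x) *m jac G x.
Proof.
move=> dG dF; have dFG : differentiable (fun y => F (G y)) x by exact: (@differentiable_comp _ _ _ _ G F).
by apply: jac_unique => // v; rewrite derive_chain // !jacE // mulmxA.
Qed.

(** * Flows of analytic fields *)

Section DirectionalLimit.
Context {R : realType} {V : normedModType R}.

Lemma is_derive_line1 (f : V -> R) x v df :
  is_derive (0 : R) (1 : R) (fun t : R => f (t *: v + x)) df -> is_derive x v f df.
Proof.
move=> [H1 H2]; have dv : derivable f x v by apply/derivable1P.
apply: DeriveDef => //; rewrite -H2 /derive.
suff -> : (fun h : R => h^-1 *: (f (h *: v + x) - f x)) =
  (fun h : R => h^-1 *: (f ((h *: (1 : R) + 0) *: v + x) - f (0 *: v + x))) by [].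
by apply/funext => h; rewrite addr0 scale0r add0r [h *: 1]mulr1.
Qed.

Lemma is_derive_line (f : V -> R) x v t df : is_derive (t *: v + x) v f df ->
  is_derive t (1 : R) (fun s : R => f (s *: v + x)) df.
Proof.
move=> [H1 H2]; rewrite addrC in H1 H2.
have := derive_line H1; rewrite H2.
by under eq_fun do rewrite addrC.
Qed.

(** Only the derivative in the direction v is known to converge uniformly here:
    Picard iteration controls the time derivative of the iterates. *)
Lemma uniform_limit_direction (x v : V) (d : R) (f_ : nat -> V -> R) (f : V -> R)
    (G_ : nat -> V -> R) (g : R) (e_ : nat -> R) : 0 < d ->
  (forall m t, `|t| < d -> is_derive (t *: v + x) v (f_ m) (G_ m (t *: v + x))) ->
  (forall t, `|t| < d -> (fun m => f_ m (t *: v + x)) @ \oo --> f (t *: v + x)) ->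
  e_ @ \oo --> (0 : R) ->
  (forall m l t, (m <= l)%N -> `|t| < d ->
     `|G_ l (t *: v + x) - G_ m (t *: v + x)| <= e_ m) ->
  (fun m => G_ m x) @ \oo --> g ->
  is_derive x v f g.
Proof.
move=> d0 df ff e0 ee Gg.
have bE t : ball (0 : R) d t <-> `|t| < d by rewrite -ball_normE /= sub0r normrN.
pose p m (t : R) := f_ m (t *: v + x).
have dp m t : `|t| < d -> is_derive t (1 : R) (p m) (G_ m (t *: v + x)).
  by move=> td; apply: is_derive_line; exact: df.
have diffp m t : `|t| < d -> differentiable (p m) t.
  by move=> td; apply/derivable1_diffP; have [] := dp m t td.
have Dp m t (w : R) : `|t| < d -> 'D_w (p m) t = w * G_ m (t *: v + x).
  move=> td; rewrite -[w in LHS]mulr1 -/(w *: (1 : R)) deriveZv; last exact: diffp.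
  by rewrite (@derive_val _ _ _ _ _ _ _ (dp m t td)).
have [|||||dh Dh] := @uniform_limit_diff R _ 0 d p (fun t : R => f (t *: v + x)) e_ _ _ _ _ 0.
- by move=> m t /bE; exact: diffp.
- by move=> t /bE; exact: ff.
- exact: e0.
- move=> m l t w ml /bE td; rewrite !Dp // -mulrBr normrM mulrC ler_wpM2r //.
  exact: ee.
- by apply/bE; rewrite normr0.
apply: is_derive_line1; apply: DeriveDef; first by apply/derivable1_diffP.
have := Dh 1; have -> : (fun m => 'D_1 (p m) 0) = (fun m => G_ m x).
  by apply/funext => m; rewrite Dp ?normr0 // mul1r scale0r add0r.
by move=> H; apply: cvg_unique H Gg.
Qed.

End DirectionalLimit.

Section Primitive.
Context {R : realType} {n : nat}.
Local Notation mi := {ffun 'I_n -> nat}.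
Variable i : 'I_n.

Definition mincr (a : mi) : mi := [ffun j => (a j + [ffun j => (j == i) : nat] j)%N].

Lemma mincrK a : mdecr (mincr a) i = a.
Proof. by apply/ffunP => j; rewrite !ffunE addnK. Qed.

Lemma mincr_i a : mincr a i = (a i).+1.
Proof. by rewrite !ffunE eqxx addn1. Qed.

Lemma mdeg_mincr a : mdeg (mincr a) = (mdeg a).+1.
Proof. by rewrite (@mdeg_mdecr _ _ i) ?mincrK // mincr_i. Qed.

Lemma mono_mincr0 a (h : 'cV[R]_n) : h i ord0 = 0 -> mono (mincr a) h = 0.
Proof. by move=> hi; rewrite /mono (bigD1 i) //= hi mincr_i expr0n mul0r. Qed.

(** Term by term, the coefficient of a is divided by a i + 1 and moved to the
    monomial with one more factor h i. *)
Lemma series_le_primitive r K f : 0 < r -> series_le r K f ->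
  exists F : 'cV[R]_n -> R, [/\ series_le r (r * K) F,
    (forall h : 'cV[R]_n, h i ord0 = 0 -> F h = 0) &
    (forall h, `|h| < r -> is_derive h (ecol i) F (f h))].
Proof.
move=> r0 [c [cK cf]]; have r0' := ltW r0.
pose phi (a : mi) (h : 'cV[R]_n) : R := (a i).+1%:R^-1 * mono (mincr a) h.
pose kappa (a : mi) : R := r * r ^+ mdeg a.
have phi_le a : series_le r (kappa a) (phi a).
  apply: series_leW (series_le_monomial _ _ r0').
  rewrite mdeg_mincr exprS ler_piMl //; first by rewrite mulr_ge0 // exprn_ge0.
  by rewrite ger0_norm ?invr_ge0 // invf_le1 ?ler1n.
have cK' N : \sum_(a <- box N) `|c a| * kappa a <= r * K.
  rewrite (eq_bigr (fun a => r * (`|c a| * r ^+ mdeg a))); last by move=> a _; rewrite mulrCA.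
  by rewrite -mulr_sumr ler_wpM2l.
pose u N (h : 'cV[R]_n) := \sum_(a <- box N) c a * phi a h.
pose F h := limn (fun N => u N h).
have uF h : `|h| <= r -> (fun N => u N h) @ \oo --> F h.
  by move=> hr; exact: (series_le_layers_cvg r0 phi_le cK' hr).
exists F; split.
- exact: (series_le_layers r0 phi_le cK' uF).
- move=> h hi; rewrite /F (_ : (fun N => u N h) = (fun _ => 0)) ?lim_cst //.
  by apply/funext => N; rewrite /u big1 // => a _; rewrite /phi mono_mincr0 // !mulr0.
move=> h hr.
pose k m := \sum_(a <- box m) `|c a| * r ^+ mdeg a.
have kS m : k m <= k m.+1 by apply: box_sum_incr => // a; rewrite mulr_ge0 // exprn_ge0.
have [t [t0 tp kt]] := incr_tail kS cK.
have d0 : 0 < r - `|h| by rewrite subr_gt0.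
have ne : `|ecol i : 'cV[R]_n| <= 1.
  apply/col_normP => // j; rewrite mxE eqxx andbT; case: (j == i); rewrite ?normr1 ?normr0 //.
have near s : `|s| < r - `|h| -> `|s *: ecol i + h| <= r.
  move=> sr; rewrite (le_trans (ler_normD _ _)) // -lerBrDr normrZ.
  by apply: le_trans (ltW sr); rewrite ler_piMr.
apply: (@uniform_limit_direction _ _ h (ecol i) (r - `|h|) u F
   (fun m y => \sum_(a <- box m) c a * mono a y) (f h) t d0) => //.
- move=> m s sr; apply: is_derive_sum_seq => a; rewrite /phi.
  have H : is_derive (s *: ecol i + h) (ecol i) (mono (mincr a) : 'cV[R]_n -> R)
      ((a i).+1%:R * mono a (s *: ecol i + h)).
    apply: DeriveDef; first by apply: diff_derivable; exact: differentiable_mono.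
    by rewrite derive_mono mincr_i mincrK.
  have := is_deriveZ (c a) (is_deriveZ (a i).+1%:R^-1 H).
  rewrite /GRing.scale /= mulKf //.
- by move=> s /near; exact: uF.
- move=> m l s ml /near sr; rewrite box_sum_diff //; apply: le_trans (ler_norm_sum _ _ _) _.
  apply: le_trans (kt _ _ ml); rewrite /k box_sum_diff //.
  by apply: ler_sum => a _; rewrite normrM ler_wpM2l // mono_le.
- by apply: cf; exact: ltW.
Qed.

End Primitive.

Section AnalyticFlow.
Context {R : realType} {N : nat}.

(** The time direction of R x R^N. *)
Definition dt : 'cV[R]_(1 + N) := ecol (lshift N ord0).

Lemma dependent_sequence (S : Type) (Inv : nat -> S -> Prop) (Rel : S -> S -> Prop) :
  (exists s, Inv 0%N s) ->
  (forall k s, Inv k s -> exists2 s', Inv k.+1 s' & Rel s s') ->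
  exists u : nat -> S, forall k, Inv k (u k) /\ Rel (u k) (u k.+1).
Proof.
move=> [s0 Is0] step.
have step' : forall ks : {ks : nat * S | Inv ks.1 ks.2},
   exists s', Inv (sval ks).1.+1 s' /\ Rel (sval ks).2 s'.
  by move=> [[k s] /= Is]; have [s' I' R'] := step k s Is; exists s'.
have [next Hnext] := choice step'.
pose nxt (ks : {ks : nat * S | Inv ks.1 ks.2}) : {ks : nat * S | Inv ks.1 ks.2} :=
  exist _ ((sval ks).1.+1, next ks) (Hnext ks).1.
pose st k := iter k nxt (exist _ (0%N, s0) Is0 : {ks : nat * S | Inv ks.1 ks.2}).
have st1 k : (sval (st k)).1 = k by elim: k => //= k ->.
exists (fun k => (sval (st k)).2) => k; split; last by have [] := Hnext (st k).
by have := svalP (st k); rewrite st1.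
Qed.

Section PicardSeries.
Context (X : 'cV[R]_N -> 'cV[R]_N) (rho K r : R).
Hypotheses (rho0 : 0 < rho) (r0 : 0 < r) (rr : r <= rho / 4) (rK : r * K <= rho / 4).
Hypothesis HK : forall i, series_le (2 * rho) K (fun y => X y i ord0).
Local Notation map := ('cV[R]_(1 + N) -> 'cV[R]_N).
Local Notation i0 := (lshift N ord0 : 'I_(1 + N)).

Definition map_le k (A : map) := forall i, series_le r k (fun w => A w i ord0).

(** The norm of the k-th difference of iterates.  These add up to rho / 2 and the
    identity has norm r <= rho / 4, so all iterates stay below 3/4 rho. *)
Definition picard_gap k : R := rho / 4 * (1 / 2) ^+ k.

(** Two consecutive Picard iterates, the second being a primitive of X along
    the first. *)
Definition picard_pair k (s : map * map) := [/\
  map_le rho s.1, map_le (3 / 4 * rho - picard_gap k) s.2,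
  (forall i, series_le r (picard_gap k) (fun w => s.2 w i ord0 - s.1 w i ord0)),
  (forall (w : 'cV[R]_(1 + N)) i, `|w| < r ->
     is_derive w dt (fun w => s.2 w i ord0) (X (s.1 w) i ord0)) &
  (forall w : 'cV[R]_(1 + N), w i0 ord0 = 0 -> s.2 w = dsubmx w)].

Lemma picard_gap_ge0 k : 0 <= picard_gap k.
Proof. by rewrite /picard_gap mulr_ge0 ?exprn_ge0 // divr_ge0 // ltW. Qed.

Lemma picard_gapS k : picard_gap k.+1 = picard_gap k / 2.
Proof. by rewrite /picard_gap exprS mulrCA mulrC mul1r. Qed.

Lemma picard_base : exists s, picard_pair 0 s.
Proof.
have r0' := ltW r0; have rr' := rr; have rK' := rK.
pose A (w : 'cV[R]_(1 + N)) : 'cV[R]_N := dsubmx w.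
have HA : map_le r A.
  move=> i; apply: series_le_ext (series_le_coord (rshift 1 i) r0') => w _.
  by rewrite mxE.
have HA' : map_le rho A.
  move=> i; apply: series_leW (HA i); apply: le_trans rr _.
  by rewrite ler_pdivrMr // ler_peMr ?ler1n // ltW.
have /choice [P HP] : forall i, exists F : 'cV[R]_(1 + N) -> R, [/\ series_le r (r * K) F,
    (forall h : 'cV[R]_(1 + N), h i0 ord0 = 0 -> F h = 0) &
    (forall h : 'cV[R]_(1 + N), `|h| < r -> is_derive h (ecol i0) F (X (A h) i ord0))].
  move=> i; apply: series_le_primitive => //.
  apply: (series_le_comp (F := fun y => X y i ord0) r0 rho0 _ HA').
  apply: series_le_radius (HK i); first exact: ltW.
  by rewrite ler_peMl ?ler1n // ltW.
have E w i : (A w + \col_i P i w) i ord0 = w (rshift 1 i) ord0 + P i w by rewrite !mxE.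
exists (A, fun w => A w + \col_i P i w); split => //=.
- move=> i; have [Hi _ _] := HP i; rewrite /picard_gap expr0.
  apply: series_leW (series_le_ext _ (series_le_add r0' (HA i) Hi)); first lra.
  by move=> w _; rewrite E mxE.
- move=> i; have [Hi _ _] := HP i; rewrite /picard_gap expr0 mulr1.
  apply: series_leW rK (series_le_ext _ Hi) => w _.
  by rewrite E mxE addrAC subrr add0r.
- move=> w i wr; under eq_fun do rewrite E; have [_ _ /(_ w wr) H1] := HP i.
  have H2 := is_derive_coord w dt (rshift 1 i).
  have := is_deriveD H2 H1; have -> : dt (rshift 1 i) ord0 = 0 by rewrite mxE eq_rlshift.
  by rewrite add0r.
- move=> w wi; apply/colP => i; rewrite E mxE; have [_ -> //] := HP i.
  by rewrite addr0.
Qed.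

Lemma picard_step k s : picard_pair k s ->
  exists2 s', picard_pair k.+1 s' & s.2 = s'.1.
Proof.
case: s => A B [/= HA HB HAB DB B0]; have r0' := ltW r0.
have rr' := rr; have rK' := rK; have rho0' := rho0.
have HB' : map_le rho B.
  move=> i; apply: series_leW (HB i); have := picard_gap_ge0 k; lra.
have /choice [P HP] : forall i, exists F : 'cV[R]_(1 + N) -> R,
    [/\ series_le r (r * (picard_gap k / rho * K)) F,
    (forall h : 'cV[R]_(1 + N), h i0 ord0 = 0 -> F h = 0) &
    (forall h : 'cV[R]_(1 + N), `|h| < r ->
       is_derive h (ecol i0) F (X (B h) i ord0 - X (A h) i ord0))].
  move=> i; apply: series_le_primitive => //.
  apply: (series_le_lipschitz r0 rho0 (HK i)) => //; exact: picard_gap_ge0.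
have E w i : (B w + \col_i P i w) i ord0 = B w i ord0 + P i w by rewrite !mxE.
have Pk i : series_le r (picard_gap k.+1) (P i).
  have [Hi _ _] := HP i; apply: series_leW Hi; rewrite picard_gapS.
  have g0 := picard_gap_ge0 k.
  have -> : r * (picard_gap k / rho * K) = picard_gap k * (r * K / rho) by ring.
  by rewrite ler_wpM2l // ler_pdivrMr //; lra.
exists (B, fun w => B w + \col_i P i w) => //; split => //=.
- move=> i; apply: series_leW (series_le_ext _ (series_le_add r0' (HB i) (Pk i))).
    by rewrite picard_gapS; lra.
  by move=> w _; rewrite E.
- move=> i; apply: series_le_ext (Pk i) => w _.
  by rewrite E addrAC subrr add0r.
- move=> w i wr; under eq_fun do rewrite E; have [_ _ /(_ w wr) H1] := HP i.
  have H2 := DB w i wr; have := is_deriveD H2 H1.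
  by rewrite subrKC.
- move=> w wi; apply/colP => i; rewrite E (B0 w wi); have [_ -> //] := HP i.
  by rewrite addr0.
Qed.

Lemma picard_limit : exists Th : map, [/\
  (forall i, series_le r (2 * rho) (fun w => Th w i ord0)),
  (forall w, `|w| <= r -> `|Th w| <= 3 / 4 * rho),
  (forall w : 'cV[R]_(1 + N), `|w| <= r -> w i0 ord0 = 0 -> Th w = dsubmx w) &
  (forall (w : 'cV[R]_(1 + N)) i, `|w| < r ->
     is_derive w dt (fun w => Th w i ord0) (X (Th w) i ord0))].
Proof.
have r0' := ltW r0; have rho0' := ltW rho0; have rho00 := rho0.
have [u Hu] := @dependent_sequence _ picard_pair (fun s s' => s.2 = s'.1) picard_base picard_step.
pose A k := (u k).1.
have AS k : A k.+1 = (u k).2 by have [_ ->] := Hu k.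
have HA k : map_le rho (A k) by have [[]] := Hu k.
have HAS k : map_le (3 / 4 * rho) (A k.+1).
  have [[_ H _ _ _] _] := Hu k; rewrite AS => i; apply: series_leW (H i).
  by have := picard_gap_ge0 k; lra.
have HD k i : series_le r (picard_gap k) (fun w => A k.+1 w i ord0 - A k w i ord0).
  by have [[_ _ H _ _] _] := Hu k; rewrite AS; exact: H.
pose G m := \sum_(k < m) picard_gap k.
have GS m : G m.+1 = G m + picard_gap m by rewrite /G big_ord_recr.
have Gle m : G m <= rho / 2.
  suff -> : G m = rho / 2 - 2 * picard_gap m by have := picard_gap_ge0 m; lra.
  elim: m => [|m IH]; first by rewrite /G big_ord0 /picard_gap expr0; field.
  by rewrite GS IH picard_gapS; field.
have Acvg i w : `|w| <= r -> cvgn (fun m => A m w i ord0).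
  move=> wr; apply: (@series_le_telescope_cvg _ _ r (rho / 2) (fun m w => A m w i ord0) G) => // m.
  by rewrite GS addrAC subrr add0r.
pose Th w := \col_i limn (fun m => A m w i ord0).
have ATh w : `|w| <= r -> (fun m => A m w) @ \oo --> Th w.
  by move=> wr; apply: cvg_mx => i j; rewrite (ord1 j) mxE; exact: Acvg.
have AThi w i : `|w| <= r -> (fun m => A m w i ord0) @ \oo --> Th w i ord0.
  by move=> wr; rewrite mxE; exact: Acvg.
have Thb w : `|w| <= r -> `|Th w| <= 3 / 4 * rho.
  move=> wr; apply/col_normP; first by rewrite mulr_ge0 // divr_ge0.
  move=> i; apply: (cvg_norm_le (N := 1%N) (AThi w i wr)) => m.
  by case: m => // m _; exact: series_le_bound (HAS m i) wr.
exists Th; split => //.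
- move=> i; apply: (@series_le_telescope _ _ _ _
    (fun m w => if m is m'.+1 then A m' w i ord0 else 0)
    (fun m => if m is m'.+1 then rho + G m' else 0)) => //.
  + case=> [|m]; last first.
      apply: series_leW (HD m i); rewrite GS; lra.
    apply: series_leW (series_le_ext _ (HA 0%N i)).
      by rewrite /G big_ord0 addr0 subr0.
    by move=> w _; rewrite subr0.
  + by case=> [|m]; [rewrite mulr_ge0|have := Gle m; lra].
  + move=> w wr; apply/cvg_succ; exact: AThi.
- move=> w wr wi; apply/colP => i.
  apply: (cvg_unique _ (AThi w i wr)) => //.
  apply/cvg_succ; rewrite (_ : (fun _ => _) = (fun _ => dsubmx w i ord0)); first exact: cvg_cst.
  by apply/funext => m; rewrite AS; have [[_ _ _ _ ->]] := Hu m.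
move=> w i wr.
pose k m := G m / rho * K.
have K0 : 0 <= K by exact: series_le_ge0 (HK i).
have kS m : k m <= k m.+1.
  by rewrite /k ler_wpM2r // ler_wpM2r ?invr_ge0 // GS lerDl picard_gap_ge0.
have kb m : k m <= rho / 2 / rho * K.
  by rewrite /k ler_wpM2r // ler_wpM2r ?invr_ge0.
have [t [t0 tp kt]] := incr_tail kS kb.
have d0 : 0 < r - `|w| by rewrite subr_gt0.
have ne : `|dt| <= 1.
  apply/col_normP => // j; rewrite mxE eqxx andbT; case: (j == _); rewrite ?normr1 ?normr0 //.
have near s : `|s| < r - `|w| -> `|s *: dt + w| < r.
  move=> sr; rewrite (le_lt_trans (ler_normD _ _)) // -ltrBrDr normrZ.
  by apply: le_lt_trans sr; rewrite ler_piMr.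
have XA y m l : (m <= l)%N -> `|y| <= r -> `|X (A l y) i ord0 - X (A m y) i ord0| <= t m.
  move=> ml yr; rewrite -(telescope_sumr (fun j => X (A j y) i ord0) ml).
  apply: le_trans (ler_norm_sum _ _ _) _; apply: le_trans (kt _ _ ml).
  rewrite -(telescope_sumr k ml); apply: ler_sum => j _.
  have -> : k j.+1 - k j = picard_gap j / rho * K by rewrite /k GS; ring.
  apply: (series_le_bound (f := fun y => X (A j.+1 y) i ord0 - X (A j y) i ord0) _ yr).
  exact: (series_le_lipschitz r0 rho0 (HK i) (HA j.+1) (HA j) (HD j) (picard_gap_ge0 j)).
apply: (@uniform_limit_direction _ _ w dt (r - `|w|) (fun m y => A m.+1 y i ord0)
  (fun y => Th y i ord0) (fun m y => X (A m y) i ord0) _ t d0) => //.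
- by move=> m s /near sr; rewrite AS; have [[_ _ _ H _] _] := Hu m; exact: H.
- move=> s /near /ltW sr; exact: ((@cvg_succ _ (fun m => A m (s *: dt + w) i ord0) _).2 (AThi _ i sr)).
- by move=> m l s ml /near /ltW; exact: XA.
have dX : differentiable (fun y => X y i ord0) (Th w).
  apply: (series_le_derive rho0 (HK i)).1; apply: le_lt_trans (Thb w (ltW wr)) _; lra.
exact: (continuous_cvg _ (differentiable_continuous dX) (ATh w (ltW wr))).
Qed.

End PicardSeries.

(** Picard iteration in the Banach algebra of power series on a small ball. *)
Lemma analytic_flow (U : set 'cV[R]_N) (X : 'cV[R]_N -> 'cV[R]_N) :
  open U -> U 0 -> regular_mx Analytic U X ->
  exists eps (Th : 'cV[R]_(1 + N) -> 'cV[R]_N), [/\ 0 < eps,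
    (forall w, `|w| < eps -> U (Th w)),
    regular_mx Analytic [set w | `|w| < eps] Th,
    (forall w, `|w| < eps -> usubmx w = 0 -> Th w = dsubmx w) &
    (forall w, `|w| < eps -> 'D_dt Th w = X (Th w))].
Proof.
move=> oU U0 HX.
have [rho [K [rho0 K0 HK HU]]] : exists rho K, [/\ 0 < rho, 0 < K,
    (forall i, series_le (2 * rho) K (fun y => X y i ord0)) &
    (forall y : 'cV[R]_N, `|y| < rho -> U y)].
  have [d d0 dU] := open_dist oU U0.
  have /choice [rK H] : forall i, exists rK : R * R,
      0 < rK.1 /\ series_le rK.1 rK.2 (fun y => X y i ord0).
    move=> i; have [r [k [r0 Hr]]] := analytic_series (HX i ord0 0 U0).
    by exists (r, k); split => //; apply: series_le_ext Hr => h _; rewrite add0r.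
  have Kp i : 0 <= (rK i).2 by exact: series_le_ge0 (H i).2.
  have m0 : 0 < \big[Num.min/1]_i (rK i).1.
    by apply: lt_bigmin => // i _; have [] := H i.
  have mm : 0 < Num.min d (\big[Num.min/1]_i (rK i).1) by rewrite lt_min d0.
  exists (Num.min d (\big[Num.min/1]_i (rK i).1) / 2), (1 + \sum_i (rK i).2).
  split.
  - by rewrite divr_gt0.
  - by rewrite ltr_pwDl // sumr_ge0.
  - move=> i; rewrite mulrC divfK //; apply: series_leW (series_le_radius _ _ (H i).2).
    + by rewrite (bigD1 i) //= addrCA lerDl addr_ge0 // sumr_ge0.
    + exact: ltW.
    + by rewrite ge_min; apply/orP; right; exact: bigmin_le_cond.
  - move=> y yr; apply: dU; rewrite subr0; apply: lt_le_trans yr _.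
    rewrite ler_pdivrMr //; apply: (@le_trans _ _ d); first by rewrite ge_min lexx.
    by rewrite ler_peMr ?ler1n // ltW.
pose r := Num.min (rho / 4) (rho / 4 / K).
have r0 : 0 < r by rewrite lt_min !divr_gt0.
have rr : r <= rho / 4 by rewrite ge_min lexx.
have rK : r * K <= rho / 4 by rewrite -ler_pdivlMr // ge_min lexx orbT.
have [Th [HTh Thb Th0 DTh]] := picard_limit rho0 r0 rr rK HK.
have r2 : 0 < r / 2 by rewrite divr_gt0.
have r2r : r / 2 < r by rewrite ltr_pdivrMr // ltr_pMr // ltr1n.
have aTh : regular_mx Analytic [set w | `|w| < r / 2] Th.
  move=> i j; rewrite (ord1 j) => w /= wr.
  apply: (@series_analytic_ball _ _ _ 0 (r / 2) (2 * rho)) => //.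
    by rewrite mulrC divfK //; apply: series_le_ext (HTh i) => h _; rewrite add0r.
  by rewrite subr0 ltW.
exists (r / 2), Th; split => //.
- move=> w wr; apply: HU; apply: le_lt_trans (Thb w _) _; last by lra.
  by rewrite ltW // (lt_trans wr).
- move=> w wr w0; apply: Th0; first by rewrite ltW // (lt_trans wr).
  by have /colP /(_ ord0) := w0; rewrite !mxE.
move=> w wr; apply/colP => i; rewrite derive_mxE; last exact: regular_mx_diff aTh.
have /DTh H := lt_trans wr r2r; exact: (@derive_val _ _ _ _ _ _ _ (H i)).
Qed.

End AnalyticFlow.

(** * The Gronwall inequality *)

Section RealFunctions.
Context {R : realType}.
Implicit Types (f g u : R -> R).

Lemma derive_ge0_le f (df : R -> R) (a b : R) : a <= b ->
  (forall t, a <= t <= b -> is_derive t (1 : R) f (df t)) ->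
  (forall t, a <= t <= b -> 0 <= df t) -> f a <= f b.
Proof.
move=> ab fd df0.
have [||c] := @MVT_segment R f df a b ab.
- by move=> t; rewrite in_itv/= => /andP[ta tb]; apply: fd; rewrite !ltW.
- apply: derivable_within_continuous => t; rewrite in_itv/= => tab.
  by have [] := fd t tab.
rewrite in_itv/= => cab E; rewrite -subr_ge0 E mulr_ge0 ?subr_ge0 //.
exact: df0.
Qed.

(** Differential comparison: a bound on |f'| integrates to a bound on |f|. *)
Lemma derive_compare f g (df dg : R -> R) (b : R) : 0 <= b ->
  (forall t, 0 <= t <= b -> is_derive t (1 : R) f (df t)) ->
  (forall t, 0 <= t <= b -> is_derive t (1 : R) g (dg t)) ->
  (forall t, 0 <= t <= b -> `|df t| <= dg t) -> `|f b - f 0| <= g b - g 0.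
Proof.
move=> b0 fd gd dfg; rewrite ler_norml; apply/andP; split.
  have := @derive_ge0_le (fun t => g t + f t) (fun t => dg t + df t) 0 b b0.
  have H1 t : 0 <= t <= b -> is_derive t (1 : R) (fun t => g t + f t) (dg t + df t).
    by move=> tb; have Hf := fd t tb; have Hg := gd t tb; exact: is_deriveD.
  move=> /(_ H1) H; suff : g 0 + f 0 <= g b + f b by lra.
  apply: H => t tb; have := dfg t tb; rewrite ler_norml; lra.
have := @derive_ge0_le (fun t => g t - f t) (fun t => dg t - df t) 0 b b0.
have H1 t : 0 <= t <= b -> is_derive t (1 : R) (fun t => g t - f t) (dg t - df t).
  by move=> tb; have Hf := fd t tb; have Hg := gd t tb; exact: is_deriveB.
move=> /(_ H1) H; suff : g 0 - f 0 <= g b - f b by lra.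
by apply: H => t tb; have := dfg t tb; rewrite ler_norml; lra.
Qed.

Lemma is_derive_reflect f df t : is_derive (- t) (1 : R) f df ->
  is_derive t (1 : R) (fun s => f (- s)) (- df).
Proof.
move=> fd; have H : is_derive t (1 : R) (-%R : R -> R) (-1).
  by have := is_deriveN (is_derive_id t (1 : R)).
have := @is_derive1_comp R f -%R t _ _ fd H.
by rewrite mulrN1.
Qed.

Lemma is_derive_expM (k t : R) : is_derive t (1 : R) (fun s => expR (k * s)) (k * expR (k * t)).
Proof.
have H : is_derive t (1 : R) (fun s : R => k * s) k.
  by have := is_deriveZ k (is_derive_id t (1 : R)); rewrite /GRing.scale /= mulr1.
have := @is_derive1_comp R expR (fun s : R => k * s) t _ _ (is_derive_expR _) H.
by rewrite mulrC.
Qed.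

Lemma continuous_of_derive f (df : R -> R) t : is_derive t (1 : R) f (df t) -> {for t, continuous f}.
Proof. by move=> [H _]; apply: differentiable_continuous; apply/derivable1_diffP. Qed.

Lemma primitive_local f (T : R) : 0 < T -> continuous f ->
  exists F : R -> R, F 0 = 0 /\ (forall t, `|t| < T -> is_derive t (1 : R) F (f t)).
Proof.
move=> T0 cf.
pose G x := \int[@lebesgue_measure R]_(t in [set` `[- T, x]]) f t.
exists (fun x => G x - G 0); split; first by rewrite subrr.
move=> t; rewrite ltr_norml => /andP[Tt tT].
have int : (@lebesgue_measure R).-integrable `[- T, T] (EFin \o f).
  apply: continuous_compact_integrable; first exact: segment_compact.
  by apply: continuous_subspaceT.
have [D E] := continuous_FTC1_closed tT int Tt (cf t).
have H : is_derive t (1 : R) G (f t).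
  by apply: (DeriveDef D); rewrite -derive1E; exact: E.
by have := is_deriveB H (is_derive_cst (G 0) t (1 : R)); rewrite subr0.
Qed.

Lemma primitive_unique f g (df : R -> R) (T t : R) : `|t| < T ->
  (forall s, `|s| < T -> is_derive s (1 : R) f (df s)) ->
  (forall s, `|s| < T -> is_derive s (1 : R) g (df s)) ->
  f 0 = g 0 -> f t = g t.
Proof.
move=> tT fd gd fg0.
pose h s := f s - g s.
have hd s : `|s| < T -> is_derive s (1 : R) h 0.
  by move=> sT; have := is_deriveB (fd s sT) (gd s sT); rewrite subrr.
have pos (k : R -> R) b : (forall s, `|s| < T -> is_derive s (1 : R) k 0) -> 0 <= b -> b < T -> k b = k 0.
  move=> kd b0 bT; apply/eqP; rewrite -subr_eq0 -normr_le0.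
  have := @derive_compare k (fun _ => 0) (fun _ => 0) (fun _ => 0) b b0.
  rewrite subrr; apply.
  - by move=> s /andP[s0 sb]; apply: kd; rewrite ger0_norm // (le_lt_trans sb).
  - by move=> s _; rewrite normr0.
suff : h t = h 0 by rewrite /h fg0 subrr => /eqP; rewrite subr_eq0 => /eqP.
case: (leP 0 t) => t0; first by apply: pos => //; rewrite -[t]ger0_norm.
have := @pos (fun s => h (- s)) (- t); rewrite opprK oppr0; apply.
- move=> s sT; have : `|- s| < T by rewrite normrN.
  by move/hd/is_derive_reflect; rewrite oppr0.
- by rewrite oppr_ge0 ltW.
- by rewrite -ltr0_norm.
Qed.

Lemma primitive f : continuous f ->
  exists F : R -> R, F 0 = 0 /\ (forall t, is_derive t (1 : R) F (f t)).
Proof.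
move=> cf.
have /choice [P HP] : forall n : nat, exists F : R -> R, F 0 = 0 /\
    (forall t, `|t| < n.+1%:R -> is_derive t (1 : R) F (f t)).
  by move=> n; apply: primitive_local => //; rewrite ltr0n.
pose k (t : R) := Num.truncn (`|t|).
have kt t : `|t| < (k t).+1%:R by exact: truncnS_gt.
have agree m l t : (m <= l)%N -> `|t| < m.+1%:R -> P m t = P l t.
  move=> ml tm; apply: (@primitive_unique _ _ f m.+1%:R) => //.
  - exact: (HP m).2.
  - move=> s sm; apply: (HP l).2; apply: lt_le_trans sm _.
    by rewrite ler_nat ltnS.
  - by rewrite (HP m).1 (HP l).1.
have PE m t : `|t| < m.+1%:R -> P (k t) t = P m t.
  move=> tm; case: (leqP (k t) m) => H; first exact: agree.
  by apply/esym; apply: agree => //; exact: ltnW.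
exists (fun t => P (k t) t); split; first exact: (HP _).1.
move=> t; have tk : `|t| < (k t).+1%:R := kt t.
apply: near_eq_is_derive ((HP (k t)).2 t tk).
have bt : ball (0 : R) (k t).+1%:R t by rewrite -ball_normE /= sub0r normrN.
apply: filterS (open_near (ball_open _ _) bt) => s.
by rewrite -ball_normE /= sub0r normrN => sk; rewrite (PE (k t)).
Qed.

(** Gronwall in the form u' <= K u + d, on both sides of 0. *)
Lemma gronwall_real u (du : R -> R) (K d T t : R) : 0 <= K -> 0 <= d ->
  (forall s, `|s| < T -> is_derive s (1 : R) u (du s)) ->
  (forall s, `|s| < T -> `|du s| <= K * u s + d) ->
  `|t| < T -> u t <= (u 0 + d * `|t|) * expR (K * `|t|).
Proof.
move=> K0 d0.
have pos (v dv : R -> R) b : (forall s, `|s| < T -> is_derive s (1 : R) v (dv s)) ->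
    (forall s, `|s| < T -> `|dv s| <= K * v s + d) -> 0 <= b -> b < T ->
    v b <= (v 0 + d * b) * expR (K * b).
  move=> vd dvb b0 bT.
  have sT s : 0 <= s <= b -> `|s| < T by move=> /andP[s0 sb]; rewrite ger0_norm // (le_lt_trans sb).
  pose g s := d * s - v s * expR (- K * s).
  pose dg s := d - (v s * (- K * expR (- K * s)) + dv s * expR (- K * s)).
  have gd s : 0 <= s <= b -> is_derive s (1 : R) g (dg s).
    move=> /sT sb; have H1 := is_deriveM (vd s sb) (is_derive_expM (- K) s).
    have H2 := is_deriveZ d (is_derive_id s (1 : R)).
    have := is_deriveB H2 H1; rewrite /dg /GRing.scale /= mulr1.
    by rewrite [expR _ * dv s]mulrC.
  have H : g 0 <= g b.
    apply: (derive_ge0_le b0 gd) => s sb; rewrite /dg.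
    have /andP[s0 _] := sb.
    have := dvb s (sT s sb); rewrite ler_norml => /andP[_ H].
    have e1 : expR (- K * s) <= 1 by rewrite -expR0 ler_expR mulNr oppr_le0 mulr_ge0.
    have e0 := expR_gt0 (- K * s).
    move: e0 e1 H; move: (expR _) (v s) (dv s) => e x y e0 e1 H.
    have := ler_wpM2r (ltW e0) H; have := ler_wpM2l d0 e1; lra.
  have E : v b * expR (- K * b) <= v 0 + d * b.
    by move: H; rewrite /g !mulr0 expR0; lra.
  by move: E; rewrite mulNr expRN ler_pdivrMr // expR_gt0.
move=> ud dub tT; case: (leP 0 t) => t0.
  by rewrite ger0_norm in tT *; first exact: (pos u du).
rewrite ltr0_norm // in tT *.
have := @pos (fun s => u (- s)) (fun s => - du (- s)) (- t); rewrite opprK oppr0; apply => //.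
- by move=> s sT; apply: is_derive_reflect; apply: ud; rewrite normrN.
- by move=> s sT; rewrite normrN; apply: dub; rewrite normrN.
- by rewrite oppr_ge0 ltW.
Qed.

End RealFunctions.

Section VectorCurves.
Context {R : realType} {N : nat}.
Implicit Types (th : R -> 'cV[R]_N).

Definition curve_derive th (t : R) (v : 'cV[R]_N) : Prop :=
  forall i, is_derive t (1 : R) (fun s => th s i ord0) (v i ord0).

Lemma sqnorm_bounds (z : 'cV[R]_N) :
  `|z| ^+ 2 <= \sum_i z i ord0 ^+ 2 <= N%:R * `|z| ^+ 2.
Proof.
have s0 : 0 <= \sum_i z i ord0 ^+ 2 by apply: sumr_ge0 => i _; exact: sqr_ge0.
apply/andP; split.
  rewrite -[leRHS]sqr_sqrtr // lerXn2r // ?nnegrE ?sqrtr_ge0 //.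
  apply/col_normP; first exact: sqrtr_ge0.
  move=> i; rewrite -sqrtr_sqr ler_wsqrtr // (bigD1 i) //= lerDl.
  by apply: sumr_ge0 => j _; exact: sqr_ge0.
have -> : N%:R * `|z| ^+ 2 = \sum_(i < N) `|z| ^+ 2.
  by rewrite sumr_const card_ord mulr_natl.
apply: ler_sum => i _; rewrite -real_normK ?num_real //.
by apply: lerXn2r; rewrite ?nnegrE // coord_le_norm.
Qed.

(** Gronwall for |th'| <= L |th| + e: the sum of the squares of the coordinates
    satisfies a scalar inequality of the same kind. *)
Lemma gronwall (L T : R) : 0 <= L -> 0 <= T -> exists2 C, 0 <= C &
  forall th (v : R -> 'cV[R]_N) (e : R), 0 <= e ->
    (forall s, `|s| < T -> curve_derive th s (v s)) ->
    (forall s, `|s| < T -> `|v s| <= L * `|th s| + e) ->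
    forall t, `|t| < T -> `|th t| <= C * (`|th 0| + e).
Proof.
move=> L0 T0; pose K := N%:R * (2 * L + 1).
have K0 : 0 <= K by rewrite mulr_ge0 // addr_ge0 // mulr_ge0.
pose C := Num.sqrt (N%:R * (1 + T) * expR (K * T)).
have CC : 0 <= N%:R * (1 + T) * expR (K * T) by rewrite !mulr_ge0 ?expR_ge0 // addr_ge0.
exists C; first exact: sqrtr_ge0.
move=> th v e e0 thd vb t tT.
pose u s := \sum_i th s i ord0 ^+ 2.
pose du s := \sum_i (2 * th s i ord0 * v s i ord0).
have ud s : `|s| < T -> is_derive s (1 : R) u (du s).
  move=> sT; apply: is_derive_sum_seq => i.
  by have := is_derive_exp 2 (thd s sT i); rewrite expr1.
have dub s : `|s| < T -> `|du s| <= K * u s + N%:R * e ^+ 2.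
  move=> sT; apply: (@le_trans _ _ (N%:R * (2 * `|th s| * (L * `|th s| + e)))).
    rewrite mulr_natl -[X in _ *+ X](card_ord N) -sumr_const.
    apply: le_trans (ler_norm_sum _ _ _) _; apply: ler_sum => i _.
    rewrite !normrM (@ger0_norm _ 2) // ler_pM // ?mulr_ge0 //.
      by rewrite ler_wpM2l // coord_le_norm.
    by apply: le_trans (vb s sT); exact: coord_le_norm.
  rewrite /K -(mulrA N%:R) -(mulrDr N%:R) ler_wpM2l //.
  have /andP[H _] := sqnorm_bounds (th s); rewrite -/(u s) in H.
  move: H; move: (`|th s|) (u s) => x y H.
  have : 0 <= (x - e) ^+ 2 by exact: sqr_ge0.
  have := ler_wpM2l L0 H; nra.
have d0 : 0 <= N%:R * e ^+ 2 by rewrite mulr_ge0 // exprn_ge0.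
have := gronwall_real K0 d0 ud dub tT.
have /andP[H1 _] := sqnorm_bounds (th t); have /andP[_ H2] := sqnorm_bounds (th 0).
rewrite -/(u t) in H1; rewrite -/(u 0) in H2 => H3.
have n0 : 0 <= `|th 0| + e by rewrite addr_ge0.
rewrite -(@ler_pXn2r _ 2) ?nnegrE // ?mulr_ge0 ?sqrtr_ge0 //.
apply: le_trans H1 _; apply: le_trans H3 _.
rewrite exprMn sqr_sqrtr // [leRHS]mulrAC ler_pM ?expR_ge0 //.
- by rewrite addr_ge0 ?mulr_ge0 // sumr_ge0 // => i _; exact: sqr_ge0.
- apply: (@le_trans _ _ (N%:R * (`|th 0| ^+ 2 + e ^+ 2 * T))).
    rewrite mulrDr lerD // -mulrA ler_wpM2l // ler_wpM2l ?sqr_ge0 // ltW //.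
  rewrite -[leRHS]mulrA ler_wpM2l //.
  have : 0 <= `|th 0| by []; move: (`|th 0|) => x x0; have := mulr_ge0 x0 e0.
  have := mulr_ge0 (sqr_ge0 x) T0; have := mulr_ge0 (mulr_ge0 x0 e0) T0; nra.
- by rewrite ler_expR ler_wpM2l // ltW.
Qed.

End VectorCurves.

(** * Global solutions of ordinary differential equations *)

Lemma sum_const_ord (R : realType) N (c : R) : \sum_(j < N) c = N%:R * c.
Proof. by rewrite sumr_const card_ord mulr_natl. Qed.

Lemma lipschitz_continuous_at (R : realType) (V W : normedModType R) (f : V -> W) (L : R) (x : V) :
  0 < L -> (forall z z', `|f z' - f z| <= L * `|z' - z|) -> {for x, continuous f}.
Proof.
move=> L0 fL; apply/cvgrPdist_le => /= e e0; have eL : 0 < e / L by rewrite divr_gt0.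
apply: filterS (open_near (ball_open x (e / L)) (ballxx x eL)) => z.
rewrite -ball_normE /= => zT.
by apply: le_trans (fL _ _) _; rewrite mulrC -ler_pdivlMr // ltW.
Qed.

Section CompactBounds.
Context {R : realType} {N : nat}.
Implicit Types (V : set 'cV[R]_N) (f : 'cV[R]_N -> R).

Lemma continuous_bounded f (rho : R) : 0 <= rho ->
  (forall z : 'cV[R]_N, `|z| <= rho -> {for z, continuous f}) ->
  exists2 M, 0 <= M & forall z : 'cV[R]_N, `|z| <= rho -> `|f z| <= M.
Proof.
move=> rho0 cf.
pose A := [set z : 'rV[R]_N | forall i, z ord0 i \in `[- rho, rho]%R].
have cA : compact A.
  apply: (@rV_compact _ _ (fun=> `[- rho, rho]%classic)) => i; exact: segment_compact.
pose g (z : 'rV[R]_N) : R := `|f z^T|.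
have AE z : A z -> `|z^T| <= rho.
  move=> Az; apply/col_normP => // i; rewrite mxE.
  by have := Az i; rewrite in_itv /= ler_norml.
have ct (z : 'rV[R]_N) : {for z, continuous (fun z : 'rV[R]_N => z^T)}.
  apply: continuous_mx => i j.
  have -> : (fun y : 'rV[R]_N => y^T i j) = (fun y => y j i) by apply/funext => y; rewrite mxE.
  exact: coord_continuous.
have cg : {within A, continuous g}.
  apply: continuous_in_subspaceT => z /set_mem Az.
  apply: (@continuous_comp _ _ _ (fun z : 'rV[R]_N => f z^T) (fun y : R => `|y|)); last exact: norm_continuous.
  apply: (@continuous_comp _ _ _ (fun z : 'rV[R]_N => z^T) f); first exact: ct.
  by apply: cf; exact: AE.
have A0 : A !=set0.
  by exists 0 => i; rewrite mxE in_itv /= oppr_le0 rho0.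
have [c _ Hc] := compact_EVT_max A0 cA cg.
exists (g c); first exact: normr_ge0.
move=> z zr; have := Hc z^T; rewrite /g trmxK; apply; apply/mem_set => i.
by rewrite mxE in_itv /= -ler_norml (le_trans (coord_le_norm z i)).
Qed.

Lemma family_bounded (I : finType) (F : I -> 'cV[R]_N -> R) (rho : R) : 0 <= rho ->
  (forall i (z : 'cV[R]_N), `|z| <= rho -> {for z, continuous (F i)}) ->
  exists2 M, 0 <= M & forall i (z : 'cV[R]_N), `|z| <= rho -> `|F i z| <= M.
Proof.
move=> rho0 cF.
have /choice [M HM] : forall i, exists M, 0 <= M /\ forall z : 'cV[R]_N, `|z| <= rho -> `|F i z| <= M.
  by move=> i; have [M M0 HM] := continuous_bounded rho0 (cF i); exists M.
exists (\sum_i M i); first by apply: sumr_ge0 => i _; have [] := HM i.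
move=> i z zr; apply: le_trans ((HM i).2 z zr) _.
rewrite (bigD1 i) //= lerDl; apply: sumr_ge0 => j _; by have [] := HM j.
Qed.

(** The second derivatives are bounded on the compact ball, so that the constant
    of the quadratic Taylor remainder is uniform. *)
Lemma C2_bounds V (X : 'cV[R]_N -> 'cV[R]_N) (rho : R) : 0 <= rho -> open V ->
  (forall z : 'cV[R]_N, `|z| <= rho -> V z) -> (forall i, Ck 2 V (fun z => X z i ord0)) ->
  exists2 L, 0 <= L & [/\
    (forall z : 'cV[R]_N, `|z| <= rho -> `|X z| <= L),
    (forall (z : 'cV[R]_N) i (v : 'cV[R]_N), `|z| <= rho -> `|'D_v (fun z => X z i ord0) z| <= L * `|v|),
    (forall z z' : 'cV[R]_N, `|z| <= rho -> `|z'| <= rho -> `|X z' - X z| <= L * `|z' - z|) &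
    (forall (z z' : 'cV[R]_N) i, `|z| <= rho -> `|z'| <= rho ->
      `|X z' i ord0 - X z i ord0 - 'D_(z' - z) (fun z => X z i ord0) z| <= L * `|z' - z| ^+ 2)].
Proof.
move=> rho0 oV ballV CX.
have dX i (z : 'cV[R]_N) : `|z| <= rho -> differentiable (fun z => X z i ord0) z.
  by move=> /ballV; exact: (CX i).1.
have dDX i (v z : 'cV[R]_N) : `|z| <= rho -> differentiable ('D_v (fun z => X z i ord0)) z.
  by move=> /ballV; exact: ((CX i).2 v).1.
have [M0 M00 HM0] := @family_bounded _ (fun i z => X z i ord0) rho rho0
  (fun i z zr => differentiable_continuous (dX i z zr)).
have [M1 M10 HM1] := @family_bounded _ (fun ij : 'I_N * 'I_N => 'D_(ecol ij.2) (fun z => X z ij.1 ord0)) rho rho0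
  (fun ij z zr => differentiable_continuous (dDX ij.1 (ecol ij.2) z zr)).
have [M2 M20 HM2] := @family_bounded _ (fun ijk : 'I_N * 'I_N * 'I_N =>
    'D_(ecol ijk.2) ('D_(ecol ijk.1.2) (fun z => X z ijk.1.1 ord0))) rho rho0
  (fun ijk z zr => ((CX ijk.1.1).2 (ecol ijk.1.2)).2 (ecol ijk.2) z (ballV z zr)).
have B1 (z : 'cV[R]_N) i (v : 'cV[R]_N) : `|z| <= rho -> `|'D_v (fun z => X z i ord0) z| <= N%:R * M1 * `|v|.
  move=> zr; rewrite derive_coords; last exact: dX.
  apply: le_trans (ler_norm_sum _ _ _) _.
  have -> : N%:R * M1 * `|v| = \sum_(j < N) M1 * `|v|.
    by rewrite sum_const_ord mulrA.
  apply: ler_sum => j _; rewrite normrM mulrC ler_pM // ?coord_le_norm //.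
  exact: (HM1 (i, j)).
have seg (z z' : 'cV[R]_N) (t : R) : `|z| <= rho -> `|z'| <= rho -> 0 <= t <= 1 -> `|z + t *: (z' - z)| <= rho.
  move=> zr zr' /andP[t0 t1]; have -> : z + t *: (z' - z) = (1 - t) *: z + t *: z'.
    by rewrite scalerBl scale1r scalerBr addrA addrAC.
  rewrite (le_trans (ler_normD _ _)) // !normrZ !ger0_norm ?subr_ge0 //.
  have := ler_wpM2l t0 zr'; have : (1 - t) * `|z| <= (1 - t) * rho by rewrite ler_wpM2l // subr_ge0.
  lra.
have B2 (z z' : 'cV[R]_N) i (v : 'cV[R]_N) : `|z| <= rho -> `|z'| <= rho ->
    `|'D_v (fun z => X z i ord0) z' - 'D_v (fun z => X z i ord0) z| <= N%:R * (N%:R * M2) * `|z' - z| * `|v|.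
  move=> zr zr'; rewrite !derive_coords; [|exact: dX..].
  rewrite -sumrB; apply: le_trans (ler_norm_sum _ _ _) _.
  have -> : N%:R * (N%:R * M2) * `|z' - z| * `|v| = \sum_(j < N) (N%:R * M2 * `|z' - z| * `|v|).
    by rewrite sum_const_ord !mulrA.
  apply: ler_sum => j _; rewrite -mulrBr normrM mulrC ler_pM // ?coord_le_norm //.
  rewrite {1}(_ : z' = z + (z' - z)); last by rewrite addrC subrK.
  apply: (@mvt_le _ _ ('D_(ecol j) (fun z => X z i ord0)) z (z' - z)).
    by move=> t t01; apply: diff_derivable; apply: dDX; exact: seg.
  move=> t t01; rewrite derive_coords; last by apply: dDX; exact: seg.
  apply: le_trans (ler_norm_sum _ _ _) _.
  have -> : N%:R * M2 * `|z' - z| = \sum_(k < N) M2 * `|z' - z|.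
    by rewrite sum_const_ord mulrA.
  apply: ler_sum => k _; rewrite normrM mulrC ler_pM // ?coord_le_norm //.
  exact: (HM2 (i, j, k) _ (seg _ _ _ zr zr' t01)).
pose L := M0 + N%:R * M1 + N%:R * (N%:R * M2).
have L1 : M0 <= L by rewrite /L -addrA lerDl addr_ge0 // !mulr_ge0.
have L2 : N%:R * M1 <= L by rewrite /L addrAC lerDr addr_ge0 // !mulr_ge0.
have L3 : N%:R * (N%:R * M2) <= L by rewrite /L lerDr addr_ge0 // !mulr_ge0.
exists L; first exact: le_trans L1.
split.
- move=> z zr; apply/col_normP; first exact: le_trans L1.
  by move=> i; apply: le_trans (HM0 i z zr) L1.
- by move=> z i v zr; apply: le_trans (B1 z i v zr) _; rewrite ler_wpM2r.
- move=> z z' zr zr'; apply/col_normP; first by rewrite mulr_ge0 // (le_trans M00).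
  move=> i; rewrite !mxE {1}(_ : z' = z + (z' - z)); last by rewrite addrC subrK.
  apply: (@mvt_le _ _ (fun z => X z i ord0) z (z' - z)).
    by move=> t t01; apply: diff_derivable; apply: dX; exact: seg.
  by move=> t t01; apply: le_trans (B1 _ _ _ (seg _ _ _ zr zr' t01)) _; rewrite ler_wpM2r.
- move=> z z' i zr zr'; have := @mvt_line _ _ (fun z => X z i ord0) z (z' - z).
  have H t : 0 <= t <= 1 -> derivable (fun z => X z i ord0) (z + t *: (z' - z)) (z' - z).
    by move=> t01; apply: diff_derivable; apply: dX; exact: seg.
  move=> /(_ H) [t /andP[t0 t1]]; rewrite (_ : z + (z' - z) = z'); last by rewrite addrC subrK.
  move=> ->.
  have t01 : 0 <= t <= 1 by rewrite !ltW.
  apply: le_trans (B2 z _ i _ zr (seg _ _ _ zr zr' t01)) _.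
  have -> : z + t *: (z' - z) - z = t *: (z' - z) by rewrite addrAC subrr add0r.
  rewrite normrZ (ger0_norm (ltW t0)) expr2 (mulrA L); apply: ler_wpM2r; first exact: normr_ge0.
  apply: ler_pM => //; first by rewrite !mulr_ge0.
    by rewrite mulr_ge0 // ltW.
  by rewrite ler_piMl // ltW.
Qed.

End CompactBounds.

Section PicardCurves.
Context {R : realType} {N : nat}.

Lemma cvg_curve_bound (u : nat -> 'cV[R]_N) (z : 'cV[R]_N) : u @ \oo --> z ->
  forall i, (fun m => u m i ord0) @ \oo --> z i ord0.
Proof.
move=> uz i; exact: (continuous_cvg _ (@coord_continuous R N 1 i ord0 z) uz).
Qed.

(** Picard iteration for a globally Lipschitz time-dependent field.  On |t| <= T
    the m-th gap is at most 2^-m M exp (2 L |t|), so no smallness of T is needed. *)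
Lemma picard_lindelof (F : R -> 'cV[R]_N -> 'cV[R]_N) (L T : R) (xi : 'cV[R]_N) :
  0 < L -> 0 < T ->
  (forall t z z', `|F t z' - F t z| <= L * `|z' - z|) ->
  (forall z, continuous (F ^~ z)) ->
  exists th : R -> 'cV[R]_N, th 0 = xi /\
    forall t, `|t| < T -> curve_derive th t (F t (th t)).
Proof.
move=> L0 T0 FL Fc.
have Fcurve (th : R -> 'cV[R]_N) : continuous th -> continuous (fun t => F t (th t)).
  move=> cth t; apply/cvgrPdist_le => /= e e0.
  have e2 : 0 < e / 2 by rewrite divr_gt0.
  have eL : 0 < e / 2 / L by rewrite divr_gt0.
  have [d1 d10 H1] := continuous_dist (Fc (th t) t) e2.
  have [d2 d20 H2] := continuous_dist (cth t) eL.
  have m0 : 0 < Num.min d1 d2 by rewrite lt_min d10.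
  have := open_near (ball_open t (Num.min d1 d2)) (ballxx t m0).
  apply: filterS => s; rewrite -ball_normE /= lt_min => /andP[s1 s2].
  rewrite distrC in s1; rewrite distrC in s2.
  have -> : F t (th t) - F s (th s) = (F t (th t) - F s (th t)) + (F s (th t) - F s (th s)).
    by rewrite addrA subrK.
  rewrite (le_trans (ler_normD _ _)) // [leRHS]splitr lerD //; first exact: H1.
  apply: le_trans (FL _ _ _) _; rewrite mulrC -ler_pdivlMr //; exact: H2.
have /choice [prim Hprim] : forall f : R -> R, exists P : R -> R, continuous f ->
    P 0 = 0 /\ forall t, is_derive t (1 : R) P (f t).
  move=> f; have [cf|ncf] := pselect (continuous f); last by exists f.
  by have [P HP] := primitive cf; exists P.
pose next (th : R -> 'cV[R]_N) (t : R) : 'cV[R]_N :=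
  xi + \col_i prim (fun s => F s (th s) i ord0) t.
have nextP th : continuous th -> next th 0 = xi /\ forall t, curve_derive (next th) t (F t (th t)).
  move=> cth; have cF i : continuous (fun s => F s (th s) i ord0).
    move=> t; apply: (@continuous_comp _ _ _ (fun s => F s (th s)) (fun z : 'cV[R]_N => z i ord0)).
      exact: Fcurve.
    exact: coord_continuous.
  split.
    by apply/colP => i; rewrite !mxE (Hprim _ (cF i)).1 addr0.
  move=> t i; have -> : (fun s => next th s i ord0) =
      (fun s => xi i ord0 + prim (fun s => F s (th s) i ord0) s).
    by apply/funext => s; rewrite !mxE.
  have H1 := (Hprim _ (cF i)).2 t.
  by have := is_deriveD (is_derive_cst (xi i ord0) t (1 : R)) H1; rewrite add0r.
have curve_cont (th v : R -> 'cV[R]_N) : (forall t, curve_derive th t (v t)) -> continuous th.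
  move=> thv t; apply: continuous_mx => i j; rewrite (ord1 j).
  exact: (@continuous_of_derive _ _ (fun t => v t i ord0)) (thv t i).
have [th [thc th0 thS]] : exists th : nat -> R -> 'cV[R]_N, [/\
    (forall m, continuous (th m)), (forall m, th m 0 = xi) &
    (forall m t, curve_derive (th m.+1) t (F t (th m t)))].
  pose th m := iter m next (fun _ => xi).
  have thc m : continuous (th m).
    elim: m => [|m IH]; first exact: cst_continuous.
    exact: curve_cont (nextP _ IH).2.
  exists th; split => //.
    by case=> [//|m]; exact: (nextP _ (thc m)).1.
  by move=> m t; exact: (nextP _ (thc m)).2.
have [M M0 HM] : exists2 M, 0 <= M & forall t, `|t| <= T -> `|th 1%N t - th 0%N t| <= M.
  have cn : {within `[- T, T], continuous (fun t => `|th 1%N t - th 0%N t|)}.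
    apply: continuous_subspaceT => t.
    apply: (@continuous_comp _ _ _ (fun t => th 1%N t - th 0%N t) (fun z => `|z|)); last exact: norm_continuous.
    by apply: continuousB; exact: thc.
  have TT : - T <= T by rewrite (@le_trans _ _ 0) ?oppr_le0 // ltW.
  have [c _ Hc] := EVT_max TT cn.
  exists `|th 1%N c - th 0%N c| => // t tT; apply: Hc.
  by rewrite in_itv /= -ler_norml.
pose gap m := (1 / 2) ^+ m * M.
have gap_step m : (forall t, `|t| <= T -> `|th m.+1 t - th m t| <= gap m * expR (2 * L * `|t|)) ->
    forall t, `|t| <= T -> `|th m.+2 t - th m.+1 t| <= gap m.+1 * expR (2 * L * `|t|).
  move=> IH.
  have g0 : 0 <= gap m by rewrite mulr_ge0 // exprn_ge0 // divr_ge0.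
  have pos (f df : R -> R) b : (forall s, is_derive s (1 : R) f (df s)) -> f 0 = 0 ->
      (forall s, 0 <= s <= b -> `|df s| <= L * (gap m * expR (2 * L * s))) -> 0 <= b ->
      `|f b| <= gap m.+1 * expR (2 * L * b).
    move=> fd f0 dfb b0.
    have gd s : 0 <= s <= b -> is_derive s (1 : R) (fun s => gap m / 2 * expR (2 * L * s))
        (L * (gap m * expR (2 * L * s))).
      move=> _; have := is_deriveZ (gap m / 2) (is_derive_expM (2 * L) s).
      rewrite /GRing.scale /=; have -> // : gap m / 2 * (2 * L * expR (2 * L * s)) =
         L * (gap m * expR (2 * L * s)) by field.
    have := derive_compare b0 (fun s _ => fd s) gd dfb.
    rewrite f0 subr0 mulr0 expR0 mulr1.
    have -> : gap m.+1 = gap m / 2 by rewrite /gap exprS; ring.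
    by move=> H; apply: le_trans H _; rewrite lerBlDr lerDl divr_ge0.
  move=> t tT; apply/col_normP; first by rewrite mulr_ge0 ?expR_ge0 // mulr_ge0 // exprn_ge0 // divr_ge0.
  move=> i; rewrite !mxE.
  pose f s := th m.+2 s i ord0 - th m.+1 s i ord0.
  have fd s : is_derive s (1 : R) f (F s (th m.+1 s) i ord0 - F s (th m s) i ord0).
    have H1 := thS m.+1 s i; have H2 := thS m s i; exact: is_deriveB.
  have fb s : `|s| <= T -> `|F s (th m.+1 s) i ord0 - F s (th m s) i ord0| <= L * (gap m * expR (2 * L * `|s|)).
    move=> sT; have := coord_le_norm (F s (th m.+1 s) - F s (th m s)) i; rewrite !mxE => H.
    apply: le_trans H _; apply: le_trans (FL _ _ _) _; rewrite ler_wpM2l ?(ltW L0) //.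
    exact: IH.
  have f0 : f 0 = 0 by rewrite /f !th0 subrr.
  case: (leP 0 t) => t0.
    rewrite (ger0_norm t0) in tT *; apply: (pos f _ t fd f0) => // s /andP[s0 st].
    by have := fb s; rewrite (ger0_norm s0); apply; rewrite (le_trans st).
  rewrite (ltr0_norm t0) in tT *.
  have tN : t = - - t by rewrite opprK.
  rewrite {1 2}tN.
  apply: (pos (fun s => f (- s)) (fun s => - (F (- s) (th m.+1 (- s)) i ord0 - F (- s) (th m (- s)) i ord0)) (- t)).
  - by move=> s; apply: is_derive_reflect.
  - by rewrite oppr0.
  - move=> s /andP[s0 st]; rewrite normrN.
    by have := fb (- s); rewrite normrN (ger0_norm s0); apply; rewrite (le_trans st).
  - by rewrite oppr_ge0 ltW.
have E0 : 0 < expR (2 * L * T) by exact: expR_gt0.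
have gapT m t : `|t| <= T -> `|th m.+1 t - th m t| <= gap m * expR (2 * L * T).
  have {}H : forall t, `|t| <= T -> `|th m.+1 t - th m t| <= gap m * expR (2 * L * `|t|).
    elim: m => [|m IH]; last exact: gap_step.
    move=> s sT; rewrite /gap expr0 mul1r; apply: le_trans (HM s sT) _.
    rewrite ler_peMr // -expR0 ler_expR !mulr_ge0 // ltW //.
  move=> tT; apply: le_trans (H t tT) _; rewrite ler_wpM2l //.
    by rewrite mulr_ge0 // exprn_ge0 // divr_ge0.
  by rewrite ler_expR ler_wpM2l // mulr_ge0 // ltW.
pose k m := \sum_(j < m) (gap j * expR (2 * L * T)).
have gp m : 0 <= gap m * expR (2 * L * T).
  by rewrite mulr_ge0 ?(ltW E0) // mulr_ge0 // exprn_ge0 // divr_ge0.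
have kSE m : k m.+1 = k m + gap m * expR (2 * L * T) by rewrite /k big_ord_recr.
have kS m : k m <= k m.+1 by rewrite kSE lerDl.
have kb m : k m <= 2 * (M * expR (2 * L * T)).
  have E : k m = 2 * (M * expR (2 * L * T)) - 2 * (gap m * expR (2 * L * T)).
    elim: m => [|m IH]; first by rewrite /k big_ord0 /gap expr0; ring.
    by rewrite kSE IH /gap exprS; field.
  by rewrite E lerBlDr lerDl mulr_ge0.
have [tl [tl0 tlp tlk]] := incr_tail kS kb.
have thml m l t : (m <= l)%N -> `|t| <= T -> `|th l t - th m t| <= tl m.
  move=> ml tT; rewrite -(telescope_sumr (fun j => th j t) ml).
  apply: le_trans (ler_norm_sum _ _ _) _; apply: le_trans (tlk _ _ ml).
  rewrite -(telescope_sumr k ml); apply: ler_sum => j _.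
  by rewrite kSE addrAC subrr add0r; exact: gapT.
have thcvg i t : `|t| <= T -> cvgn (fun m => th m t i ord0).
  move=> tT; apply: cauchy_real => e e0; have [n0 Hn] := cvg0_eventually tl0 e0.
  exists n0 => m l nm ml; have := coord_le_norm (th l t - th m t) i; rewrite !mxE => H.
  apply: le_trans H _; apply: le_trans (thml _ _ _ ml tT) _.
  by apply: le_trans (ler_norm _) (Hn m nm).
pose Th t := \col_i limn (fun m => th m t i ord0).
have thTh t : `|t| <= T -> (fun m => th m t) @ \oo --> Th t.
  by move=> tT; apply: cvg_mx => i j; rewrite (ord1 j) mxE; exact: thcvg.
exists Th; split.
  have := thTh 0; rewrite normr0 => /(_ (ltW T0)).
  have -> : (fun m => th m 0) = (fun _ => xi) by apply/funext => m.
  by move=> H; apply: cvg_unique H (cvg_cst _).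
move=> t tT i.
have d0 : 0 < T - `|t| by rewrite subr_gt0.
have near s : `|s| < T - `|t| -> `|s *: (1 : R) + t| < T.
  by move=> sr; rewrite (le_lt_trans (ler_normD _ _)) // -ltrBrDr [s *: 1]mulr1.
apply: (@uniform_limit_direction _ _ t (1 : R) (T - `|t|) (fun m s => th m.+1 s i ord0)
  (fun s => Th s i ord0) (fun m s => F s (th m s) i ord0) _ (fun m => L * tl m) d0).
- by move=> m s _; exact: thS.
- move=> s /near /ltW sT; apply/(@cvg_succ _ (fun m => th m (s *: 1 + t) i ord0)).
  exact: cvg_curve_bound (thTh _ sT) i.
- by rewrite -[X in _ --> X](mulr0 L); apply: cvgMr.
- move=> m l s ml /near /ltW sT.
  have := coord_le_norm (F (s *: (1 : R) + t) (th l (s *: (1 : R) + t)) - F (s *: (1 : R) + t) (th m (s *: (1 : R) + t))) i.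
  rewrite !mxE => H; apply: le_trans H _; apply: le_trans (FL _ _ _) _.
  by rewrite ler_wpM2l ?(ltW L0) // thml.
- apply: (cvg_curve_bound (u := fun m => F t (th m t))).
  have cF : {for Th t, continuous (F t)}.
    exact: lipschitz_continuous_at L0 (FL t).
  exact: (continuous_cvg _ cF (thTh t (ltW tT))).
Qed.

End PicardCurves.

(** * Dependence of smooth flows on the initial value *)

Lemma differentiable_quadratic (R : realType) (V : normedModType R) (f w : V -> R) (x : V)
    (d K : R) : 0 < d -> 0 <= K ->
  (forall (a : R) u v, w (a *: u + v) = a * w u + w v) ->
  (forall h, `|w h| <= K * `|h|) ->
  (forall h, `|h| < d -> `|f (x + h) - f x - w h| <= K * `|h| ^+ 2) ->
  differentiable f x /\ (forall v, 'D_v f x = w v).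
Proof.
move=> d0 K0 lw wK fK.
pose wl : {linear V -> R} := HB.pack w (GRing.isLinear.Build R V R *:%R w lw).
have K1 : 0 < K + 1 by rewrite ltr_wpDl.
apply: (@differentiable_from_bound _ _ f x wl).
  move=> y; apply: (@lipschitz_continuous_at _ _ _ wl (K + 1) y K1) => z z'.
  rewrite -linearB; apply: le_trans (wK _) _; apply: ler_wpM2r; first exact: normr_ge0.
  by rewrite lerDl.
move=> e e0; have dk : 0 < Num.min d (e / (K + 1)) by rewrite lt_min d0 divr_gt0.
apply: filterS (open_near (ball_open 0 (Num.min d (e / (K + 1)))) (ballxx 0 dk)) => h.
rewrite -ball_normE /= sub0r normrN lt_min => /andP[h1 h2].
apply: le_trans (fK h h1) _; rewrite expr2 mulrA ler_wpM2r ?normr_ge0 //.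
have := ltW h2; rewrite ler_pdivlMr // => H; apply: le_trans H.
by rewrite mulrC ler_wpM2l ?normr_ge0 // lerDl.
Qed.

Lemma mvt_real (R : realType) (f df : R -> R) (t tau c M : R) :
  (forall s, `|s - t| <= `|tau| -> is_derive s (1 : R) f (df s)) ->
  (forall s, `|s - t| <= `|tau| -> `|df s - c| <= M) ->
  `|f (t + tau) - f t - tau * c| <= M * `|tau|.
Proof.
move=> fd dfM; pose g s := f s - s * c.
have H s : 0 <= s <= 1 -> `|t + s *: tau - t| <= `|tau|.
  move=> /andP[s0 s1]; rewrite addrAC subrr add0r normrM (ger0_norm s0).
  by rewrite ler_piMl.
have gd s : `|s - t| <= `|tau| -> is_derive s (1 : R) g (df s - c).
  move=> /fd sd; have := is_deriveB sd (is_deriveM (is_derive_id s (1 : R)) (is_derive_cst c s (1 : R))).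
  by rewrite scaler0 add0r [_ *: 1]mulr1.
have gD s : `|s - t| <= `|tau| -> differentiable g s.
  by move=> /gd sd; apply/derivable1_diffP; case: sd.
have -> : f (t + tau) - f t - tau * c = g (t + tau) - g t by rewrite /g; ring.
apply: (@mvt_le _ _ g t tau) => s s01; first by apply: diff_derivable; apply: gD; exact: H.
have -> : 'D_tau g (t + s *: tau) = tau *: 'D_1 g (t + s *: tau).
  rewrite -deriveZv; last by apply: gD; exact: H.
  by rewrite [tau *: 1]mulr1.
have sd := gd _ (H s s01); rewrite derive_val normrM mulrC ler_wpM2r ?normr_ge0 //.
exact: dfM (H s s01).
Qed.

Section FlowDerivative.
Context {R : realType} {N : nat}.
Implicit Types (V B : set 'cV[R]_N) (X : 'cV[R]_N -> 'cV[R]_N).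

Definition time (w : 'cV[R]_(1 + N)) : R := w (lshift N ord0) ord0.

Definition is_flow X (rho T : R) B (th : R -> 'cV[R]_N -> 'cV[R]_N) : Prop :=
  forall xi, B xi -> th 0 xi = xi /\
    forall t, `|t| < T -> `|th t xi| <= rho /\ curve_derive (th ^~ xi) t (X (th t xi)).

(** Freezing the argument outside [-T, T] turns local data into data defined
    everywhere, and changes nothing inside. *)
Definition clamp (T s : R) : R := Num.max (- T) (Num.min T s).

Lemma clamp_le (T s : R) : 0 <= T -> `|clamp T s| <= T.
Proof.
by move=> T0; rewrite /clamp ler_norml le_max lexx ge_max ge_min lexx /= andbT ge0_cp.
Qed.

Lemma clamp_id (T s : R) : `|s| <= T -> clamp T s = s.
Proof.
by rewrite ler_norml /clamp => /andP[a b]; rewrite (min_idPr b) (max_idPr a).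
Qed.

Lemma clamp_lipschitz (T s s' : R) : `|clamp T s' - clamp T s| <= `|s' - s|.
Proof.
rewrite /clamp; have H := ler_norm (s' - s); have := ler_norm (- (s' - s)); rewrite normrN => H'.
rewrite ler_norml; set D := `|s' - s| in H H' *; clearbody D; rewrite /Order.max /Order.min.
case: (ltP T s') => ?; case: (ltP T s) => ?; do !(case: ifPn; rewrite -?leNgt => ?);
  by apply/andP; split; lra.
Qed.

Lemma clamp_continuous (T : R) : continuous (clamp T).
Proof.
move=> s; apply: (@lipschitz_continuous_at _ _ _ (clamp T) 1 s ltr01) => a b.
by rewrite mul1r; exact: clamp_lipschitz.
Qed.

Lemma curve_derive_continuous (c v : R -> 'cV[R]_N) t : curve_derive c t (v t) -> {for t, continuous c}.
Proof.
move=> thv; apply: continuous_mx => i j; rewrite (ord1 j).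
exact: (@continuous_of_derive _ (fun t => c t i ord0) (fun t => v t i ord0)) (thv i).
Qed.

Lemma jac_bounds V X (rho : R) : 0 <= rho -> open V ->
  (forall z : 'cV[R]_N, `|z| <= rho -> V z) -> regular_mx Smooth V X ->
  exists2 L, 0 <= L & [/\
    (forall z : 'cV[R]_N, `|z| <= rho -> `|X z| <= L),
    (forall z v : 'cV[R]_N, `|z| <= rho -> `|jac X z *m v| <= L * `|v|),
    (forall z z' : 'cV[R]_N, `|z| <= rho -> `|z'| <= rho -> `|X z' - X z| <= L * `|z' - z|) &
    (forall z z' : 'cV[R]_N, `|z| <= rho -> `|z'| <= rho ->
      `|X z' - X z - jac X z *m (z' - z)| <= L * `|z' - z| ^+ 2)].
Proof.
move=> rho0 oV bV rX.
have [L L0 [H1 H2 H3 H4]] := C2_bounds rho0 oV bV (fun i => rX i ord0 2%N).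
have E (z v : 'cV[R]_N) i : `|z| <= rho -> (jac X z *m v) i ord0 = 'D_v (fun z => X z i ord0) z.
  by move=> /bV Vz; have dX := regular_mx_diff Vz rX; rewrite -jacE // derive_mxE.
exists L => //; split=> //.
  by move=> z v zr; apply/col_normP => [|i]; rewrite ?mulr_ge0 ?normr_ge0 // E //; exact: H2.
move=> z z' zr zr'; apply/col_normP => [|i]; first by rewrite mulr_ge0 // exprn_ge0.
by have := H4 z z' i zr zr'; rewrite -E // !mxE.
Qed.

(** The derivative of a flow in the initial value solves the variational
    equation W' = DX(th) W; the remainder of the first-order expansion is
    quadratic by Gronwall. *)
Lemma flow_derivative V X (rho T1 T2 : R) B th : 0 <= rho -> 0 < T1 -> T1 < T2 ->
  open V -> (forall z : 'cV[R]_N, `|z| <= rho -> V z) -> regular_mx Smooth V X ->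
  open B -> is_flow X rho T2 B th ->
  exists C (W : R -> 'cV[R]_N -> 'cV[R]_N -> 'cV[R]_N), [/\ 0 <= C,
    (forall xi eta (a : R) t, B xi -> `|t| < T1 -> W t xi (a *: eta) = a *: W t xi eta),
    (forall xi eta, B xi -> W 0 xi eta = eta /\ forall t, `|t| < T1 ->
      `|W t xi eta| <= C * `|eta| /\
      curve_derive (fun t => W t xi eta) t (jac X (th t xi) *m W t xi eta)) &
    (forall w, `|time w| < T1 -> B (dsubmx w) -> forall i,
      differentiable (fun w => th (time w) (dsubmx w) i ord0) w /\
      forall v, 'D_v (fun w => th (time w) (dsubmx w) i ord0) w =
        time v * X (th (time w) (dsubmx w)) i ord0 + W (time w) (dsubmx w) (dsubmx v) i ord0)].
Proof.
move=> rho0 T10 T12 oV bV rX oB fth.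
have [L L0 [XL JL lipX quadX]] := jac_bounds rho0 oV bV rX.
have L1 : 0 < L + 1 by rewrite ltr_wpDl.
have T1T2 s : `|s| <= T1 -> `|s| < T2 by move=> H; exact: le_lt_trans H T12.
have thr xi t : B xi -> `|t| < T2 -> `|th t xi| <= rho by move=> /fth[_ H] /H[].
have thd xi t : B xi -> `|t| < T2 -> curve_derive (th ^~ xi) t (X (th t xi)) by move=> /fth[_ H] /H[].
have th0 xi : B xi -> th 0 xi = xi by move=> /fth[].
have exW (p : 'cV[R]_N * 'cV[R]_N) : exists W : R -> 'cV[R]_N, B p.1 -> W 0 = p.2 /\
    forall t, `|t| < T1 -> curve_derive W t (jac X (th t p.1) *m W t).
  have [Bx|nB] := pselect (B p.1); last by exists (fun _ => 0).
  pose F s (z : 'cV[R]_N) := jac X (th (clamp T1 s) p.1) *m z.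
  have cT s : `|clamp T1 s| < T2 by apply: T1T2; apply: clamp_le; exact: ltW.
  have [||W [W0 HW]] := @picard_lindelof _ _ F (L + 1) T1 p.2 L1 T10.
  - move=> s z z'; rewrite /F -mulmxBr; apply: le_trans (JL _ _ _) _; first exact: thr.
    by apply: ler_wpM2r; [exact: normr_ge0 | rewrite lerDl].
  - move=> z s; have rF : regular_mx Smooth V (fun y => jac X y *m z).
      by apply: regular_mx_mul => //; [exact: regular_jac | exact: regular_mx_cst].
    apply: (@continuous_comp _ _ _ (fun s => th (clamp T1 s) p.1) (fun y => jac X y *m z)).
      apply: (@continuous_comp _ _ _ (clamp T1) (th ^~ p.1)); first exact: clamp_continuous.
      exact: (curve_derive_continuous (v := fun t => X (th t p.1))) (thd _ _ Bx (cT s)).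
    by apply: regular_mx_continuous rF; apply: bV; exact: thr.
  exists W => _; split => // t tT; have := HW t tT; rewrite /F clamp_id //; exact: ltW.
have /choice [W0 HW0] := exW.
pose W t xi eta := W0 (xi, eta) t.
have W00 xi eta : B xi -> W 0 xi eta = eta by move=> Bx; exact: (HW0 (xi, eta) Bx).1.
have Wd xi eta t : B xi -> `|t| < T1 ->
    curve_derive (fun t => W t xi eta) t (jac X (th t xi) *m W t xi eta).
  by move=> Bx; exact: (HW0 (xi, eta) Bx).2.
have [C C0 gron] := @gronwall R N L T1 L0 (ltW T10).
have WC xi eta t : B xi -> `|t| < T1 -> `|W t xi eta| <= C * `|eta|.
  move=> Bx tT; have := gron (fun t => W t xi eta) (fun t => jac X (th t xi) *m W t xi eta) 0 (lexx _).
  rewrite W00 // addr0; apply=> // s sT; first exact: Wd.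
  by rewrite addr0; apply: JL; apply: thr => //; apply: T1T2; exact: ltW.
have Wlin xi eta eta' (a : R) t : B xi -> `|t| < T1 ->
    W t xi (a *: eta + eta') = a *: W t xi eta + W t xi eta'.
  move=> Bx tT; apply/eqP; rewrite -subr_eq0 -normr_le0.
  pose c t := W t xi (a *: eta + eta') - (a *: W t xi eta + W t xi eta').
  have := gron c (fun t => jac X (th t xi) *m c t) 0 (lexx _).
  have -> : c 0 = 0 by rewrite /c !W00 // subrr.
  rewrite normr0 addr0 mulr0; apply=> // s sT.
    move=> i; rewrite /c mulmxBr mulmxDr -scalemxAr !mxE.
    have H1 := Wd xi (a *: eta + eta') s Bx sT i; have H2 := Wd xi eta s Bx sT i.
    have H3 := Wd xi eta' s Bx sT i.
    have := is_deriveB H1 (is_deriveD (is_deriveZ a H2) H3); rewrite !mxE.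
    by congr (is_derive _ _ _ _); apply/funext => y; rewrite !mxE.
  by rewrite addr0; apply: JL; apply: thr => //; apply: T1T2; exact: ltW.
have thlip xi xi' t : B xi -> B xi' -> `|t| < T1 -> `|th t xi' - th t xi| <= C * `|xi' - xi|.
  move=> Bx Bx' tT; have := gron (fun t => th t xi' - th t xi) (fun t => X (th t xi') - X (th t xi)) 0 (lexx _).
  rewrite !th0 // addr0; apply=> // s sT; have sT2 : `|s| < T2 by apply: T1T2; exact: ltW.
    move=> i; rewrite !mxE; have H1 := thd xi' s Bx' sT2 i; have H2 := thd xi s Bx sT2 i.
    have := is_deriveB H1 H2.
    by congr (is_derive _ _ _ _); apply/funext => y; rewrite !mxE.
  by rewrite addr0; apply: lipX; exact: thr.
have rem xi xi' t : B xi -> B xi' -> `|t| < T1 ->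
    `|th t xi' - th t xi - W t xi (xi' - xi)| <= C * (L * (C * `|xi' - xi|) ^+ 2).
  move=> Bx Bx' tT; pose c t := th t xi' - th t xi - W t xi (xi' - xi).
  have e0 : 0 <= L * (C * `|xi' - xi|) ^+ 2 by rewrite mulr_ge0 // exprn_ge0 // mulr_ge0.
  have := gron c (fun t => X (th t xi') - X (th t xi) - jac X (th t xi) *m W t xi (xi' - xi)) _ e0.
  have -> : c 0 = 0 by rewrite /c !th0 // W00 // subrr.
  rewrite normr0 add0r; apply=> // s sT; have sT2 : `|s| < T2 by apply: T1T2; exact: ltW.
    move=> i; rewrite !mxE; have H1 := thd xi' s Bx' sT2 i; have H2 := thd xi s Bx sT2 i.
    have H3 := Wd xi (xi' - xi) s Bx sT i; rewrite mxE in H3.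
    have := is_deriveB (is_deriveB H1 H2) H3.
    by congr (is_derive _ _ _ _); apply/funext => y; rewrite !mxE.
  have -> : X (th s xi') - X (th s xi) - jac X (th s xi) *m W s xi (xi' - xi) =
      jac X (th s xi) *m c s + (X (th s xi') - X (th s xi) - jac X (th s xi) *m (th s xi' - th s xi)).
    by rewrite /c (mulmxBr _ (th s xi' - th s xi)) [RHS]addrC [RHS]addrA subrK.
  apply: le_trans (ler_normD _ _) _; apply: lerD; first by apply: JL; exact: thr.
  apply: le_trans (quadX _ _ _ _) _; [exact: thr|exact: thr|].
  rewrite ler_wpM2l // lerXn2r ?nnegrE ?normr_ge0 ?mulr_ge0 ?normr_ge0 //; exact: thlip.
exists C, W; split => //.
- move=> xi eta a t Bx tT; have := Wlin xi eta 0 a t Bx tT.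
  have W00' : W t xi 0 = 0.
    by apply/eqP; rewrite -normr_le0; have := WC xi 0 t Bx tT; rewrite normr0 mulr0.
  by rewrite W00' !addr0.
- by move=> xi eta Bx; split => [|t tT]; [exact: W00 | split; [exact: WC | exact: Wd]].
move=> w tw Bw i; set t := time w; set xi := dsubmx w.
have [d1 d10 Hd1] := open_dist oB Bw.
have d20 : 0 < T1 - `|t| by rewrite subr_gt0.
pose K := L + C + C * (L * C ^+ 2) + L * C + L * L.
have timeD (u v : 'cV[R]_(1 + N)) : time (u + v) = time u + time v by rewrite /time mxE.
have time_le (h : 'cV[R]_(1 + N)) : `|time h| <= `|h| by exact: coord_le_norm.
have dsub_le (h : 'cV[R]_(1 + N)) : `|dsubmx h| <= `|h|.
  by apply/col_normP => // j; rewrite mxE; exact: coord_le_norm.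
have thX : `|X (th t xi) i ord0| <= L.
  apply: le_trans (coord_le_norm _ _) _; apply: XL; apply: thr => //; apply: T1T2; exact: ltW.
have p1 : 0 <= L * C by rewrite mulr_ge0.
have p2 : 0 <= L * L by rewrite mulr_ge0.
have p3 : 0 <= C * (L * C ^+ 2) by rewrite !mulr_ge0 // exprn_ge0.
apply: (@differentiable_quadratic _ _ _ (fun v => time v * X (th t xi) i ord0 + W t xi (dsubmx v) i ord0)
  w (Num.min d1 (T1 - `|t|)) K).
- by rewrite lt_min d10.
- by rewrite /K; lra.
- move=> a u v; have -> : dsubmx (a *: u + v) = a *: dsubmx u + dsubmx v by rewrite linearP.
  by rewrite Wlin // !mxE /time !mxE; ring.
- move=> h; apply: le_trans (ler_normD _ _) _; rewrite normrM.
  have H1 : `|W t xi (dsubmx h) i ord0| <= C * `|h|.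
    apply: le_trans (coord_le_norm _ _) _; apply: le_trans (WC _ _ _ _ _) _ => //.
    by rewrite ler_wpM2l.
  have H2 : `|time h| * `|X (th t xi) i ord0| <= `|h| * L by rewrite ler_pM.
  apply: le_trans (lerD H2 H1) _; rewrite mulrC -mulrDl ler_wpM2r //.
  by rewrite /K; lra.
move=> h; rewrite lt_min => /andP[h1 h2].
have hB : B (xi + dsubmx h).
  by apply: Hd1; rewrite addrAC subrr add0r (le_lt_trans _ h1).
have ht : `|time h| < T1 - `|t| by rewrite (le_lt_trans _ h2).
have htT s : `|s - t| <= `|time h| -> `|s| < T1.
  move=> H; rewrite -[s](subrK t); apply: le_lt_trans (ler_normD _ _) _.
  by rewrite -ltrBrDr; exact: le_lt_trans H ht.
have tht : `|t + time h| < T1 by apply: htT; rewrite addrAC subrr add0r.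
rewrite timeD linearD /= -/t -/xi.
set tau := time h in ht htT tht *; set eta := dsubmx h in hB *.
have etah : `|eta| <= `|h| by exact: dsub_le.
have tauh : `|tau| <= `|h| by exact: time_le.
have B1 : `|th (t + tau) (xi + eta) i ord0 - th (t + tau) xi i ord0 - W (t + tau) xi eta i ord0|
    <= C * (L * C ^+ 2) * `|h| ^+ 2.
  have := rem xi (xi + eta) (t + tau) Bw hB tht.
  have -> : xi + eta - xi = eta by rewrite addrAC subrr add0r.
  move=> H; have := coord_le_norm (th (t + tau) (xi + eta) - th (t + tau) xi - W (t + tau) xi eta) i.
  rewrite !mxE => H'; apply: le_trans H' _; apply: le_trans H _.
  have Q : `|eta| ^+ 2 <= `|h| ^+ 2 by rewrite lerXn2r ?nnegrE ?normr_ge0.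
  by have := ler_wpM2l p3 Q; rewrite exprMn !mulrA.
have B2 : `|W (t + tau) xi eta i ord0 - W t xi eta i ord0| <= L * C * `|h| ^+ 2.
  have := @mvt_real _ (fun s => W s xi eta i ord0) (fun s => (jac X (th s xi) *m W s xi eta) i ord0) t tau 0 (L * (C * `|h|)).
  rewrite mulr0 subr0 => H; apply: le_trans (H _ _) _.
  - by move=> s /htT sT; exact: Wd.
  - move=> s /htT sT; rewrite subr0; apply: le_trans (coord_le_norm _ _) _.
    apply: le_trans (JL _ _ _) _; first by apply: thr => //; apply: T1T2; exact: ltW.
    rewrite ler_wpM2l //; apply: le_trans (WC _ _ _ _ _) _ => //; by rewrite ler_wpM2l.
  by rewrite expr2 !mulrA ler_wpM2l // !mulr_ge0.
have B3 : `|th (t + tau) xi i ord0 - th t xi i ord0 - tau * X (th t xi) i ord0| <= L * L * `|h| ^+ 2.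
  have := @mvt_real _ (fun s => th s xi i ord0) (fun s => X (th s xi) i ord0) t tau (X (th t xi) i ord0) (L * (L * `|h|)).
  move=> H; apply: le_trans (H _ _) _.
  - by move=> s /htT sT; apply: thd => //; apply: T1T2; exact: ltW.
  - move=> s st; have sT := htT s st; have sT2 : `|s| < T2 by apply: T1T2; exact: ltW.
    have tT2 : `|t| < T2 by apply: T1T2; exact: ltW.
    have := coord_le_norm (X (th s xi) - X (th t xi)) i; rewrite !mxE => H'.
    apply: le_trans H' _; apply: le_trans (lipX _ _ _ _) _; [exact: thr|exact: thr|].
    rewrite ler_wpM2l //; apply/col_normP => [|j]; first by rewrite mulr_ge0.
    rewrite !mxE; have := @mvt_real _ (fun s => th s xi j ord0) (fun s => X (th s xi) j ord0) t (s - t) 0 L.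
    rewrite mulr0 subr0 (_ : t + (s - t) = s); last by ring.
    move=> H2; apply: le_trans (H2 _ _) _.
    + by move=> r rt; apply: thd => //; apply: T1T2; apply/ltW/htT; exact: le_trans rt st.
    + move=> r rt; rewrite subr0; apply: le_trans (coord_le_norm _ _) _; apply: XL; apply: thr => //.
      by apply: T1T2; apply/ltW/htT; exact: le_trans rt st.
    by rewrite ler_wpM2l // (le_trans st).
  by rewrite expr2 !mulrA ler_wpM2l // !mulr_ge0.
set f1 := th (t + tau) (xi + eta) i ord0 in B1 *; set f2 := th (t + tau) xi i ord0 in B1 B3 *.
set f3 := W (t + tau) xi eta i ord0 in B1 B2 *; set f4 := W t xi eta i ord0 in B2 *.
set f5 := th t xi i ord0 in B3 *; set f6 := X (th t xi) i ord0 in B3 *.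
have -> : f1 - f5 - (tau * f6 + f4) = (f1 - f2 - f3) + (f3 - f4) + (f2 - f5 - tau * f6) by ring.
apply: le_trans (ler_normD _ _) _; apply: le_trans (lerD (ler_normD _ _) (lexx _)) _.
apply: le_trans (lerD (lerD B1 B2) B3) _.
rewrite -!mulrDl ler_wpM2r ?exprn_ge0 //.
by rewrite /K; lra.
Qed.

End FlowDerivative.

Section FlowSmooth.
Context {R : realType}.

(** The derivative of the flow of X in the initial value is a component of the
    flow of the extended field (X z, DX(z) v), so each induction step gains one
    derivative.  The variational equation is linear in v, whence a rescaling of v
    keeps the extended flow inside the domain prescribed for it. *)
Lemma flow_Ck k : forall N (V B : set 'cV[R]_N) (X : 'cV[R]_N -> 'cV[R]_N) (rho T1 T2 : R) th,
  0 < rho -> 0 < T1 -> T1 < T2 ->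
  open V -> (forall z : 'cV[R]_N, `|z| <= rho -> V z) -> regular_mx Smooth V X ->
  open B -> is_flow X rho T2 B th ->
  forall i, Ck k [set w : 'cV[R]_(1 + N) | `|time w| < T1 /\ B (dsubmx w)]
    (fun w => th (time w) (dsubmx w) i ord0).
Proof.
have open_dom N (T1 : R) (B : set 'cV[R]_N) : open B ->
    open [set w : 'cV[R]_(1 + N) | `|time w| < T1 /\ B (dsubmx w)].
  move=> oB; apply: openI.
    apply: (@open_comp _ _ (fun w : 'cV[R]_(1 + N) => `|time w|) [set x | x < T1]); last exact: open_lt.
    move=> w _; apply: (@continuous_comp _ _ _ (@time R N) (fun y : R => `|y|)); last exact: norm_continuous.
    exact: coord_continuous.
  apply: (@open_comp _ _ (fun w : 'cV[R]_(1 + N) => dsubmx w) B) => // w _.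
  apply: continuous_mx => i j.
  have -> : (fun y : 'cV[R]_(1 + N) => dsubmx y i j) = (fun y => y (rshift 1 i) j) by apply/funext => y; rewrite mxE.
  exact: coord_continuous.
elim: k => [|k IH] N V B X rho T1 T2 th rho0 T10 T12 oV bV rX oB fth i.
  have [C [W [_ _ _ H]]] := flow_derivative (ltW rho0) T10 T12 oV bV rX oB fth.
  by move=> w [/H H' /H' /(_ i) [/differentiable_continuous]].
pose T' := (T1 + T2) / 2.
have T1' : T1 < T' by rewrite /T'; lra.
have T2' : T' < T2 by rewrite /T'; lra.
have T'0 : 0 < T' by exact: lt_trans T1'.
have [C [W [C0 WZ HW H]]] := flow_derivative (ltW rho0) T'0 T2' oV bV rX oB fth.
set D := [set w : 'cV[R]_(1 + N) | _].
have oD : open D by exact: open_dom.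
split.
  by move=> w [w1 w2]; have [] := H w (lt_trans w1 T1') w2 i.
move=> v; apply: (@Ck_ext _ _ k D (fun w => time v * X (th (time w) (dsubmx w)) i ord0 +
    W (time w) (dsubmx w) (dsubmx v) i ord0)) => //.
  by move=> w [w1 w2]; have [_ ->] := H w (lt_trans w1 T1') w2 i.
apply: Ck_add => //.
  apply: Ck_mul => //; first exact: Ck_cst.
  apply: (@Ck_comp _ _ _ k D V (fun z => X z i ord0) (fun w => th (time w) (dsubmx w))) => //.
    by move=> w [w1 w2]; apply: bV; apply: ((fth _ w2).2 _ _).1; rewrite (lt_trans w1).
    exact: rX.
  exact: IH rho0 T10 T12 oV bV rX oB fth.
pose V2 : set 'cV[R]_(N + N) := [set y | V (usubmx y)].
pose B2 : set 'cV[R]_(N + N) := [set y | B (usubmx y) /\ C * `|dsubmx y| < rho].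
pose X2 (y : 'cV[R]_(N + N)) := col_mx (X (usubmx y)) (jac X (usubmx y) *m dsubmx y).
pose th2 t (y : 'cV[R]_(N + N)) := col_mx (th t (usubmx y)) (W t (usubmx y) (dsubmx y)).
have cu : continuous (fun y : 'cV[R]_(N + N) => usubmx y).
  move=> y; apply: continuous_mx => a b.
  have -> : (fun y : 'cV[R]_(N + N) => usubmx y a b) = (fun y => y (lshift N a) b) by apply/funext => z; rewrite mxE.
  exact: coord_continuous.
have cd : continuous (fun y : 'cV[R]_(N + N) => dsubmx y).
  move=> y; apply: continuous_mx => a b.
  have -> : (fun y : 'cV[R]_(N + N) => dsubmx y a b) = (fun y => y (rshift N a) b) by apply/funext => z; rewrite mxE.
  exact: coord_continuous.
have oV2 : open V2 by apply: (@open_comp _ _ (fun y : 'cV[R]_(N + N) => usubmx y) V) => // y _; exact: cu.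
have oB2 : open B2.
  apply: openI; first by apply: (@open_comp _ _ (fun y : 'cV[R]_(N + N) => usubmx y) B) => // y _; exact: cu.
  apply: (@open_comp _ _ (fun y : 'cV[R]_(N + N) => C * `|dsubmx y|) [set x | x < rho]); last exact: open_lt.
  move=> y _; apply: (@continuous_comp _ _ _ (fun y : 'cV[R]_(N + N) => dsubmx y) (fun y => C * `|y|)); first exact: cd.
  apply: (@continuous_comp _ _ _ (fun y : 'cV[R]_N => `|y|) (fun y : R => C * y)); first exact: norm_continuous.
  exact: mulrl_continuous.
have uler (y : 'cV[R]_(N + N)) : `|usubmx y| <= `|y|.
  by apply/col_normP => // j; rewrite mxE; exact: coord_le_norm.
have rX2 : regular_mx Smooth V2 X2.
  have ru : regular_mx Smooth V2 (fun y : 'cV[R]_(N + N) => usubmx y).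
    by apply: regular_usubmx => //; exact: regular_mx_id.
  apply: regular_col_mx => //; first exact: (regular_mx_comp (V := V)) ru.
  apply: regular_mx_mul => //; last by apply: regular_dsubmx => //; exact: regular_mx_id.
  apply: (regular_mx_comp (V := V)) ru => //; exact: regular_jac.
have fth2 : is_flow X2 rho T' B2 th2.
  move=> y [yB y1]; have [W0 HW1] := HW (usubmx y) (dsubmx y) yB; have [th0 Hth] := fth _ yB.
  split; first by rewrite /th2 th0 W0 vsubmxK.
  move=> t tT; have [w1 w2] := HW1 t tT; have [h1 h2] := Hth t (lt_trans tT T2').
  split.
    apply/col_normP => [|j]; first exact: ltW.
    rewrite /th2; case: (split_ordP j) => a ->.
      by rewrite col_mxEu (le_trans (coord_le_norm _ _) h1).
    by rewrite col_mxEd (le_trans (coord_le_norm _ _)) // (le_trans w1) // ltW.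
  move=> j; rewrite /X2 /th2 col_mxKu col_mxKd.
  case: (split_ordP j) => a ->.
    rewrite col_mxEu; have := h2 a.
    by congr (is_derive _ _ _ _); apply/funext => s; rewrite col_mxEu.
  rewrite col_mxEd; have := w2 a.
  by congr (is_derive _ _ _ _); apply/funext => s; rewrite col_mxEd.
have bV2 (z : 'cV[R]_(N + N)) : `|z| <= rho -> V2 z.
  by move=> zr; apply: bV; exact: le_trans zr.
have Ck2 := IH _ V2 B2 X2 rho T1 T' th2 rho0 T10 T1' oV2 bV2 rX2 oB2 fth2 (rshift N i).
(* W is linear in its last argument: the increment is divided by c to enter the
   domain of the extended flow, and the result is multiplied by c. *)
have [c c0 cr] : exists2 c : R, 0 < c & C * `|c^-1 *: dsubmx v| < rho.
  have p : 0 < C * `|dsubmx v| + 1 by rewrite ltr_wpDl // mulr_ge0.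
  exists ((C * `|dsubmx v| + 1) / rho); first exact: divr_gt0.
  rewrite normrZ gtr0_norm ?invr_gt0 ?divr_gt0 // invf_div mulrCA mulrAC ltr_pdivrMr //.
  by rewrite ltr_pM2l // ltrDl.
pose g (w : 'cV[R]_(1 + N)) : 'cV[R]_(1 + (N + N)) :=
  col_mx (usubmx w) (col_mx (dsubmx w) (c^-1 *: dsubmx v)).
have tg w : time (g w) = time w by rewrite /time /g col_mxEu mxE.
have rg : regular_mx Smooth D g.
  apply: regular_col_mx => //; first by apply: regular_usubmx => //; exact: regular_mx_id.
  apply: regular_col_mx => //; last exact: regular_mx_cst.
  by apply: regular_dsubmx => //; exact: regular_mx_id.
apply: (@Ck_ext _ _ k D (fun w => c * th2 (time (g w)) (dsubmx (g w)) (rshift N i) ord0)) => //.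
  move=> w [w1 w2]; rewrite tg /g col_mxKd /th2 col_mxKu col_mxKd col_mxEd.
  by rewrite WZ ?(lt_trans w1) // mxE mulVKf // gt_eqF.
apply: Ck_mul => //; first exact: Ck_cst.
apply: (@Ck_comp _ _ _ k D _ (fun y => th2 (time y) (dsubmx y) (rshift N i) ord0) g oD _ _ Ck2).
- exact: open_dom.
- move=> w [w1 w2]; split; first by rewrite tg.
  by rewrite /g /B2 /= col_mxKd col_mxKu col_mxKd.
by move=> j; exact: rg.
Qed.

End FlowSmooth.

(** * Local flows in both categories *)

(** Composed with the coordinatewise clamp, X becomes bounded and globally
    Lipschitz, so that solutions exist on a common time interval; on a shorter
    one they do not reach the region where the clamp acts. *)
Lemma smooth_flow (R : realType) N (U : set 'cV[R]_N) (X : 'cV[R]_N -> 'cV[R]_N) :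
  open U -> U 0 -> regular_mx Smooth U X ->
  exists eps (Th : 'cV[R]_(1 + N) -> 'cV[R]_N), [/\ 0 < eps,
    (forall w, `|w| < eps -> U (Th w)),
    regular_mx Smooth [set w | `|w| < eps] Th,
    (forall w, `|w| < eps -> usubmx w = 0 -> Th w = dsubmx w) &
    (forall w, `|w| < eps -> 'D_dt Th w = X (Th w))].
Proof.
move=> oU U0 rX; have [d d0 dU] := open_dist oU U0.
have [rho rho0 rhod] : exists2 rho : R, 0 < rho & rho < d by exists (d / 2); lra.
have bU (z : 'cV[R]_N) : `|z| <= rho -> U z.
  by move=> zr; apply: dU; rewrite subr0 (le_lt_trans zr).
have [L L0 [XL _ lipX _]] := jac_bounds (ltW rho0) oU bU rX.
have [M M0 LM] : exists2 M, 0 < M & L <= M by exists (L + 1); lra.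
pose cl (z : 'cV[R]_N) : 'cV[R]_N := \col_i clamp rho (z i ord0).
have clr z : `|cl z| <= rho.
  by apply/col_normP => [|i]; rewrite ?mxE ?clamp_le // ltW.
have cl_id (z : 'cV[R]_N) : `|z| <= rho -> cl z = z.
  move=> zr; apply/colP => i; rewrite mxE clamp_id //; exact: le_trans (coord_le_norm _ _) zr.
have cllip (z z' : 'cV[R]_N) : `|cl z' - cl z| <= `|z' - z|.
  apply/col_normP => [|i]; first exact: normr_ge0.
  rewrite !mxE; apply: le_trans (clamp_lipschitz _ _ _) _.
  by have := coord_le_norm (z' - z) i; rewrite !mxE.
(* The speed is at most M, so that in this time a solution moves by rho / 2. *)
pose T2 := rho / (2 * M).
have T20 : 0 < T2 by rewrite divr_gt0 // mulr_gt0.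
have MT2 : M * T2 = rho / 2 by rewrite /T2; field; rewrite gt_eqF.
have /choice [th Hth] : forall xi, exists th : R -> 'cV[R]_N, th 0 = xi /\
    forall t, `|t| < T2 -> curve_derive th t (X (cl (th t))).
  move=> xi; apply: (@picard_lindelof _ _ (fun _ z => X (cl z)) M T2 xi M0 T20).
    move=> t z z'; apply: le_trans (lipX _ _ (clr z) (clr z')) _.
    by rewrite ler_pM.
  by move=> z; exact: cst_continuous.
pose B := [set xi : 'cV[R]_N | `|xi| < rho / 2].
have thr xi t : B xi -> `|t| < T2 -> `|th xi t| <= rho.
  move=> Bx tT; rewrite -[th xi t](subrK xi); apply: le_trans (ler_normD _ _) _.
  have H : `|th xi t - xi| <= M * `|t|.
    apply/col_normP => [|i]; first by rewrite mulr_ge0 // ltW.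
    rewrite !mxE -{2}(Hth xi).1.
    have := @mvt_real _ (fun s => th xi s i ord0) (fun s => X (cl (th xi s)) i ord0) 0 t 0 M.
    rewrite add0r mulr0 subr0; apply=> s; rewrite subr0 => st.
      by apply: (Hth xi).2; exact: le_lt_trans st tT.
    by rewrite subr0; apply: le_trans (coord_le_norm _ _) (le_trans (XL _ (clr _)) LM).
  have H2 : M * `|t| <= M * T2 by rewrite ler_wpM2l // ltW.
  by rewrite MT2 in H2; move: Bx; rewrite /B /= => Bx; lra.
pose T1 := T2 / 2.
have [T10 T12] : 0 < T1 /\ T1 < T2 by rewrite /T1; split; lra.
have oB : open B.
  have -> : B = ball 0 (rho / 2) by apply/seteqP; split=> x; rewrite -ball_normE /B /= sub0r normrN.
  exact: ball_open.
have fth : is_flow X rho T2 B (fun t xi => th xi t).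
  move=> xi Bx; split; first exact: (Hth xi).1.
  move=> t tT; split; first exact: thr.
  by have := (Hth xi).2 t tT; rewrite cl_id //; exact: thr.
pose Th (w : 'cV[R]_(1 + N)) := th (dsubmx w) (time w).
pose eps := Num.min T1 (rho / 2).
have dom (w : 'cV[R]_(1 + N)) : `|w| < eps -> `|time w| < T1 /\ B (dsubmx w).
  rewrite lt_min => /andP[w1 w2]; split; first exact: le_lt_trans (coord_le_norm _ _) w1.
  by apply: le_lt_trans w2; apply/col_normP => // i; rewrite mxE; exact: coord_le_norm.
have [C [W [_ WZ _ HW]]] := flow_derivative (ltW rho0) T10 T12 oU bU rX oB fth.
exists eps, Th; split.
- by rewrite lt_min T10 divr_gt0.
- by move=> w /dom[w1 w2]; apply: bU; apply: thr => //; exact: lt_trans T12.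
- move=> i j k; rewrite (ord1 j).
  have := flow_Ck k rho0 T10 T12 oU bU rX oB fth i; apply: Ck_sub.
  exact: dom.
- move=> w _ w0; rewrite /Th (_ : time w = 0) ?(Hth _).1 //.
  by have := congr1 (fun A : 'cV[R]_1 => A ord0 ord0) w0; rewrite !mxE.
move=> w /dom[w1 w2].
have dTh : differentiable Th w.
  by apply/differentiable_mxP => i j; rewrite (ord1 j); have [] := HW w w1 w2 i.
apply/colP => i; rewrite derive_mxE //; have [_ ->] := HW w w1 w2 i.
have -> : dsubmx dt = 0 *: (0 : 'cV[R]_N).
  by rewrite scaler0; apply/colP => j; rewrite !mxE eq_rlshift.
by rewrite WZ // scale0r mxE /time /dt /ecol mxE !eqxx mul1r addr0.
Qed.

(** The rest of the proof depends on the category only through this lemma and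
    through the closure properties of regular functions. *)
Lemma flow (R : realType) (C : category) N (U : set 'cV[R]_N) (X : 'cV[R]_N -> 'cV[R]_N) :
  open U -> U 0 -> regular_mx C U X ->
  exists eps (Th : 'cV[R]_(1 + N) -> 'cV[R]_N), [/\ 0 < eps,
    (forall w, `|w| < eps -> U (Th w)),
    regular_mx C [set w | `|w| < eps] Th,
    (forall w, `|w| < eps -> usubmx w = 0 -> Th w = dsubmx w) &
    (forall w, `|w| < eps -> 'D_dt Th w = X (Th w))].
Proof. by case: C; [exact: smooth_flow | exact: analytic_flow]. Qed.

(** * Matrix-valued derivatives and the inverse function theorem *)

Section MatrixDerivatives.
Context {R : realType} {V : normedModType R}.
Implicit Types (x v : V).

(** Differentiability is carried along with the value, so that the derivative of
    a composite matrix expression can be assembled rule by rule. *)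
Definition mx_derive p q (F : V -> 'M[R]_(p, q)) x v (D : 'M[R]_(p, q)) : Prop :=
  differentiable F x /\ 'D_v F x = D.

Lemma mx_deriveP p q (F : V -> 'M[R]_(p, q)) x v D :
  mx_derive F x v D <-> differentiable F x /\ forall i j, is_derive x v (fun y => F y i j) (D i j).
Proof.
split=> -[dF HD]; split=> //.
  move=> i j; apply: DeriveDef; last by rewrite -derive_mxE // HD.
  by apply: diff_derivable; exact: (differentiable_mxP F x).1.
by apply/matrixP => i j; rewrite derive_mxE //; have H := HD i j; exact: derive_val.
Qed.

Lemma mx_derive_cst p q (A : 'M[R]_(p, q)) x v : mx_derive (fun _ => A) x v 0.
Proof. by split; [exact: differentiable_cst | exact: derive_cst]. Qed.

Lemma mx_derive_add p q (F G : V -> 'M[R]_(p, q)) x v A B :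
  mx_derive F x v A -> mx_derive G x v B -> mx_derive (fun y => F y + G y) x v (A + B).
Proof.
move=> /mx_deriveP[dF HF] /mx_deriveP[dG HG]; apply/mx_deriveP; split; first exact: differentiableD.
move=> i j; rewrite mxE; have H1 := HF i j; have H2 := HG i j; have := is_deriveD H1 H2.
by congr (is_derive _ _ _ _); apply/funext => y; rewrite !mxE.
Qed.

Lemma mx_derive_opp p q (F : V -> 'M[R]_(p, q)) x v A :
  mx_derive F x v A -> mx_derive (fun y => - F y) x v (- A).
Proof.
move=> /mx_deriveP[dF HF]; apply/mx_deriveP; split; first exact: differentiableN.
move=> i j; rewrite mxE; have H1 := HF i j; have := is_deriveN H1.
by congr (is_derive _ _ _ _); apply/funext => y; rewrite !mxE.
Qed.

Lemma mx_derive_sub p q (F G : V -> 'M[R]_(p, q)) x v A B :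
  mx_derive F x v A -> mx_derive G x v B -> mx_derive (fun y => F y - G y) x v (A - B).
Proof. by move=> HF HG; apply: mx_derive_add => //; exact: mx_derive_opp. Qed.

Lemma mx_derive_mul p q s (F : V -> 'M[R]_(p, q)) (G : V -> 'M[R]_(q, s)) x v A B :
  mx_derive F x v A -> mx_derive G x v B ->
  mx_derive (fun y => F y *m G y) x v (A *m G x + F x *m B).
Proof.
move=> /mx_deriveP[dF HF] /mx_deriveP[dG HG].
have E i j : (fun y => (F y *m G y) i j) = (fun y => \sum_k F y i k * G y k j).
  by apply/funext => y; rewrite mxE.
have H i j : is_derive x v (fun y => (F y *m G y) i j) ((A *m G x + F x *m B) i j).
  rewrite E; have K k : is_derive x v (fun y => F y i k * G y k j) (A i k * G x k j + F x i k * B k j).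
    have H1 := HF i k; have H2 := HG k j; have := is_deriveM H1 H2.
    by rewrite addrC /GRing.scale /= [_ * A i k]mulrC.
  rewrite !mxE -big_split /=; exact: is_derive_sum_seq.
apply/mx_deriveP; split => //; apply/differentiable_mxP => i j; rewrite E.
have -> : (fun y => \sum_k F y i k * G y k j) = \sum_k (fun y => F y i k * G y k j).
  by apply/funext => y; rewrite fct_sumE.
apply: differentiable_sum => k; apply: differentiableM.
  exact: (differentiable_mxP F x).1.
exact: (differentiable_mxP G x).1.
Qed.

Lemma mx_derive_entries p q p' q' (F : V -> 'M[R]_(p, q)) (G : V -> 'M[R]_(p', q'))
    (r : 'I_p' -> 'I_q' -> 'I_p) (c : 'I_p' -> 'I_q' -> 'I_q) x v
    (A : 'M[R]_(p, q)) (B : 'M[R]_(p', q')) :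
  (forall y i j, G y i j = F y (r i j) (c i j)) -> (forall i j, B i j = A (r i j) (c i j)) ->
  mx_derive F x v A -> mx_derive G x v B.
Proof.
move=> GF BA /mx_deriveP[dF HF]; have E i j : (fun y => G y i j) = (fun y => F y (r i j) (c i j)).
  by apply/funext.
apply/mx_deriveP; split => [|i j]; last by rewrite E BA.
by apply/differentiable_mxP => i j; rewrite E; exact: (differentiable_mxP F x).1.
Qed.

Lemma mx_derive_usub p1 p2 q (F : V -> 'M[R]_(p1 + p2, q)) x v A :
  mx_derive F x v A -> mx_derive (fun y => usubmx (F y)) x v (usubmx A).
Proof. by apply: (mx_derive_entries (r := fun i _ => lshift p2 i) (c := fun _ j => j)) => [y|] i j; rewrite mxE. Qed.

Lemma mx_derive_dsub p1 p2 q (F : V -> 'M[R]_(p1 + p2, q)) x v A :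
  mx_derive F x v A -> mx_derive (fun y => dsubmx (F y)) x v (dsubmx A).
Proof. by apply: (mx_derive_entries (r := fun i _ => rshift p1 i) (c := fun _ j => j)) => [y|] i j; rewrite mxE. Qed.

Lemma mx_derive_lsub p q1 q2 (F : V -> 'M[R]_(p, q1 + q2)) x v A :
  mx_derive F x v A -> mx_derive (fun y => lsubmx (F y)) x v (lsubmx A).
Proof. by apply: (mx_derive_entries (r := fun i _ => i) (c := fun _ j => lshift q2 j)) => [y|] i j; rewrite mxE. Qed.

Lemma mx_derive_rsub p q1 q2 (F : V -> 'M[R]_(p, q1 + q2)) x v A :
  mx_derive F x v A -> mx_derive (fun y => rsubmx (F y)) x v (rsubmx A).
Proof. by apply: (mx_derive_entries (r := fun i _ => i) (c := fun _ j => rshift q1 j)) => [y|] i j; rewrite mxE. Qed.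

Lemma mx_derive_col p1 p2 q (F : V -> 'M[R]_(p1, q)) (G : V -> 'M[R]_(p2, q)) x v A B :
  mx_derive F x v A -> mx_derive G x v B ->
  mx_derive (fun y => col_mx (F y) (G y)) x v (col_mx A B).
Proof.
move=> HF HG; have H := mx_derive_add (mx_derive_mul (mx_derive_cst (col_mx 1%:M 0) x v) HF)
  (mx_derive_mul (mx_derive_cst (col_mx 0 1%:M) x v) HG).
have E (A' : 'M[R]_(p1, q)) (B' : 'M[R]_(p2, q)) : col_mx 1%:M 0 *m A' + col_mx 0 1%:M *m B' = col_mx A' B'.
  by rewrite !mul_col_mx !mul1mx !mul0mx add_col_mx addr0 add0r.
move: H; rewrite !mul0mx !add0r E; congr (mx_derive _ _ _ _).
by apply/funext => y; rewrite E.
Qed.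

Lemma mx_derive_val p q (F : V -> 'M[R]_(p, q)) x v A : mx_derive F x v A -> 'D_v F x = A.
Proof. by case. Qed.

Lemma mx_derive_eq p q (F : V -> 'M[R]_(p, q)) x v A B : mx_derive F x v A -> A = B ->
  mx_derive F x v B.
Proof. by move=> H <-. Qed.

Lemma mx_derive_ext (U : set V) p q (F G : V -> 'M[R]_(p, q)) x v A : open U -> U x ->
  (forall y, U y -> F y = G y) -> mx_derive F x v A -> mx_derive G x v A.
Proof.
move=> oU Ux FG /mx_deriveP[dF HF]; apply/mx_deriveP; split => [|i j].
  apply/differentiable_mxP => i j; apply: (differentiable_ext oU Ux (f := fun y => F y i j)).
    by move=> y Uy; rewrite FG.
  exact: (differentiable_mxP F x).1.
have H := HF i j; apply: DeriveDef.
  apply: diff_derivable; apply: (differentiable_ext oU Ux (f := fun y => F y i j)).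
    by move=> y Uy; rewrite FG.
  exact: (differentiable_mxP F x).1.
rewrite -(@derive_ext _ _ U (fun y => F y i j)) //; first exact: derive_val.
by move=> y Uy; rewrite FG.
Qed.

Lemma mx_derive_chain m p q (F : 'cV[R]_m -> 'M[R]_(p, q)) (G : V -> 'cV[R]_m) x v A :
  mx_derive G x v A -> differentiable F (G x) ->
  mx_derive (fun y => F (G y)) x v ('D_A F (G x)).
Proof.
move=> [dG HG] dF; split.
  apply/differentiable_mxP => i j; apply: (differentiable_chain (f := fun z => F z i j)) => //.
  exact: (differentiable_mxP F _).1.
by rewrite (derive_chain _ dG dF) HG.
Qed.

Lemma mx_derive_chain_at m p q (F : 'cV[R]_m -> 'M[R]_(p, q)) (G : V -> 'cV[R]_m) x y v A :
  G x = y -> mx_derive G x v A -> differentiable F y -> mx_derive (fun y => F (G y)) x v ('D_A F y).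
Proof. by move=> <-; exact: mx_derive_chain. Qed.

End MatrixDerivatives.

Lemma mx_derive_id (R : realType) n (x v : 'cV[R]_n) : mx_derive id x v v.
Proof.
split; last exact: derive_id.
by apply/differentiable_mxP => i j; exact: differentiable_coord.
Qed.

Lemma mx_derive_regular (R : realType) C n p q (U : set 'cV[R]_n) (F : 'cV[R]_n -> 'M[R]_(p, q)) x v :
  regular_mx C U F -> U x -> mx_derive F x v ('D_v F x).
Proof. by move=> rF Ux; split => //; exact: regular_mx_diff rF. Qed.

Lemma mx_derive_jac (R : realType) C n p (U : set 'cV[R]_n) (F : 'cV[R]_n -> 'cV[R]_p) x v :
  regular_mx C U F -> U x -> mx_derive F x v (jac F x *m v).
Proof. by move=> rF Ux; rewrite -jacE; [exact: mx_derive_regular rF Ux | exact: regular_mx_diff rF]. Qed.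

Lemma regular_mx_sub_op (R : realType) C n p q (U : set 'cV[R]_n) (F G : 'cV[R]_n -> 'M[R]_(p, q)) :
  open U -> regular_mx C U F -> regular_mx C U G -> regular_mx C U (fun x => F x - G x).
Proof. by move=> oU rF rG; apply: regular_mx_add => //; exact: regular_mx_opp. Qed.

Lemma open_norm (R : realType) (V : normedModType R) (x0 : V) (r : R) : open [set x | `|x - x0| < r].
Proof.
have -> : [set x | `|x - x0| < r] = ball x0 r.
  by apply/seteqP; split=> x; rewrite -ball_normE /= distrC.
exact: ball_open.
Qed.

Lemma open_norm0 (R : realType) (V : normedModType R) (r : R) : open [set x : V | `|x| < r].
Proof.
have -> : [set x : V | `|x| < r] = [set x | `|x - 0| < r] by apply/seteqP; split=> x /=; rewrite subr0.
exact: open_norm.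
Qed.

Lemma open_preimage (R : realType) C n p q (U : set 'cV[R]_n) (F : 'cV[R]_n -> 'M[R]_(p, q))
    (S : set 'M[R]_(p, q)) :
  open U -> regular_mx C U F -> open S -> open [set x | U x /\ S (F x)].
Proof.
move=> oU rF oS; rewrite openE => x [Ux Sx].
have Fx := regular_mx_continuous Ux rF.
have H := Fx S (open_nbhs_nbhs (conj oS Sx)).
by apply: filterS2 (open_near oU Ux) H => y.
Qed.

Lemma open_unitmx (R : realType) C n p (U : set 'cV[R]_n) (F : 'cV[R]_n -> 'M[R]_p) :
  open U -> regular_mx C U F -> open [set x | U x /\ F x \in unitmx].
Proof.
move=> oU rF; rewrite openE => x [Ux Sx].
have dF := regular_continuous Ux (regular_det oU rF).
have D0 : \det (F x) != 0 by rewrite -unitfE -unitmxE.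
have := dF [set y | y != 0] (open_nbhs_nbhs (conj (@open_neq R 0) D0)).
by apply: filterS2 (open_near oU Ux) => y Uy; rewrite /= unitmxE unitfE.
Qed.

Section FlowTools.
Context {R : realType} {N : nat}.

Lemma usubmx_le p1 p2 (z : 'cV[R]_(p1 + p2)) : `|usubmx z| <= `|z|.
Proof. by apply/col_normP => // i; rewrite mxE; exact: coord_le_norm. Qed.

Lemma dsubmx_le p1 p2 (z : 'cV[R]_(p1 + p2)) : `|dsubmx z| <= `|z|.
Proof. by apply/col_normP => // i; rewrite mxE; exact: coord_le_norm. Qed.

Lemma col_mx_lt p1 p2 (a : 'cV[R]_p1) (b : 'cV[R]_p2) (r : R) : 0 < r ->
  `|col_mx a b| < r <-> `|a| < r /\ `|b| < r.
Proof.
move=> r0; split=> [H|[Ha Hb]].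
  have := usubmx_le (col_mx a b); have := dsubmx_le (col_mx a b).
  by rewrite col_mxKu col_mxKd => Hd Hu; split; exact: le_lt_trans H.
apply/col_norm_ltP => // i; case: (split_ordP i) => j ->.
  by rewrite col_mxEu (le_lt_trans (coord_le_norm _ _)).
by rewrite col_mxEd (le_lt_trans (coord_le_norm _ _)).
Qed.

Lemma dt_col : dt = col_mx (1%:M : 'cV[R]_1) 0 :> 'cV[R]_(1 + N).
Proof.
apply/colP => i; rewrite /dt /ecol; case: (split_ordP i) => j ->.
  by rewrite col_mxEu !mxE (ord1 j) !eqxx.
by rewrite col_mxEd !mxE eq_rlshift.
Qed.

Lemma const_along_time (eps : R) p q (f : 'cV[R]_(1 + N) -> 'M[R]_(p, q)) :
  (forall w, `|w| < eps -> mx_derive f w dt 0) ->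
  forall w, `|w| < eps -> f w = f (col_mx 0 (dsubmx w)).
Proof.
move=> H w we; apply/matrixP => i j.
pose h := - time w *: dt : 'cV[R]_(1 + N).
have whE t : w + t *: h = col_mx ((1 - t) *: usubmx w) (dsubmx w).
  rewrite /h dt_col scalerA scale_col_mx scaler0 -{1}[w]vsubmxK add_col_mx addr0; congr col_mx.
  apply/colP => k; rewrite !mxE (ord1 k) /time !eqxx; by rewrite /=; ring.
have wh t : 0 <= t <= 1 -> `|w + t *: h| < eps.
  move=> /andP[t0 t1]; have eps0 : 0 < eps by exact: le_lt_trans we.
  rewrite whE; apply/col_mx_lt => //; split; last exact: le_lt_trans (dsubmx_le w) we.
  apply: le_lt_trans we; apply: le_trans (usubmx_le w).
  rewrite normrZ ger0_norm ?subr_ge0 // ler_piMl // lerBlDr lerDl //.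
have df t : 0 <= t <= 1 -> differentiable (fun y => f y i j) (w + t *: h).
  by move=> t01; have [D _] := H _ (wh t t01); exact: (differentiable_mxP f _).1.
have [|t /andP[t0 t1]] := @mvt_line _ _ (fun y => f y i j) w h.
  by move=> t t01; apply: diff_derivable; exact: df.
have t01 : 0 <= t <= 1 by rewrite (ltW t0) (ltW t1).
rewrite {3}/h deriveZv; last exact: df.
have [D E] := H _ (wh t t01); rewrite -derive_mxE // E mxE scaler0.
have -> : w + h = col_mx 0 (dsubmx w) by have := whE 1; rewrite scale1r subrr scale0r.
by move/eqP; rewrite subr_eq0 => /eqP.
Qed.

End FlowTools.

(** The curve x0 + z with z' = DF(x0 + z)^-1 eta is mapped by F to the straight
    line F x0 + t eta; the flow of this field, with eta as an additional constant
    coordinate, therefore gives a right inverse of F. *)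
Lemma right_inverse (R : realType) C n (U : set 'cV[R]_n) (F : 'cV[R]_n -> 'cV[R]_n) x0 :
  open U -> U x0 -> regular_mx C U F -> jac F x0 \in unitmx ->
  exists r (g : 'cV[R]_n -> 'cV[R]_n), [/\ 0 < r,
    regular_mx C [set y | `|y - F x0| < r] g, g (F x0) = x0 &
    forall y, `|y - F x0| < r -> U (g y) /\ F (g y) = y].
Proof.
move=> oU Ux0 rF uF.
pose U1 := [set z | U z /\ jac F z \in unitmx].
have oU1 : open U1 by apply: open_unitmx => //; exact: regular_jac.
pose U2 : set 'cV[R]_(n + n) := [set w | setT w /\ U1 (x0 + usubmx w)].
have rx (S : set 'cV[R]_(n + n)) : open S -> regular_mx C S (fun w : 'cV[R]_(n + n) => x0 + usubmx w).
  move=> oS; apply: regular_mx_add => //; first exact: regular_mx_cst.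
  by apply: regular_usubmx => //; exact: regular_mx_id.
have oU2 : open U2 by apply: (@open_preimage _ C) => //; [exact: openT | exact: rx openT].
pose X (w : 'cV[R]_(n + n)) : 'cV[R]_(n + n) :=
  col_mx (invmx (jac F (x0 + usubmx w)) *m dsubmx w) 0.
have rX : regular_mx C U2 X.
  apply: regular_col_mx => //; last exact: regular_mx_cst.
  apply: regular_mx_mul => //; last by apply: regular_dsubmx => //; exact: regular_mx_id.
  apply: regular_invmx => //; first by move=> w [_ []].
  apply: (regular_mx_comp (V := U) _ _ _ _ (rx _ oU2)) => //; first by move=> w [_ []].
  exact: regular_jac.
have U20 : U2 0 by split => //; rewrite linear0 addr0.
have [eps [Th [e0 ThU rTh Th0 Thd]]] := flow oU2 U20 rX.
have oE := @open_norm0 R 'cV[R]_(1 + (n + n)) eps.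
have dTh w : `|w| < eps -> mx_derive Th w dt (X (Th w)).
  by move=> we; rewrite -Thd //; exact: mx_derive_regular rTh we.
have Thinit (z : 'cV[R]_(n + n)) : `|z| < eps -> Th (col_mx 0 z) = z.
  move=> ze; rewrite Th0 ?col_mxKu ?col_mxKd //; apply/col_mx_lt => //.
  by rewrite normr0.
have Thd2 w : `|w| < eps -> dsubmx (Th w) = dsubmx (dsubmx w).
  move=> we; rewrite (@const_along_time R (n + n) eps _ _ (fun w => dsubmx (Th w))) //.
    by rewrite Thinit //; exact: le_lt_trans (dsubmx_le w) we.
  move=> w' we'; have := mx_derive_dsub (dTh w' we'); by rewrite /X col_mxKd.
have line w : `|w| < eps -> usubmx (dsubmx w) = 0 ->
    F (x0 + usubmx (Th w)) = F x0 + dsubmx (dsubmx w) *m usubmx w.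
  move=> we w0; have := @const_along_time R (n + n) eps _ _
    (fun w => F (x0 + usubmx (Th w)) - dsubmx (dsubmx w) *m usubmx w).
  have H w' : `|w'| < eps -> mx_derive (fun w => F (x0 + usubmx (Th w)) -
      dsubmx (dsubmx w) *m usubmx w) w' dt 0.
    move=> we'; have [_ [Ux ux]] := ThU w' we'.
    have d1 := mx_derive_add (mx_derive_cst x0 w' dt) (mx_derive_usub (dTh w' we')).
    have d2 := mx_derive_chain d1 (regular_mx_diff Ux rF).
    have d3 := mx_derive_mul (mx_derive_dsub (mx_derive_dsub (mx_derive_id w' dt)))
      (mx_derive_usub (mx_derive_id w' dt)).
    apply: mx_derive_eq (mx_derive_sub d2 d3) _.
    rewrite dt_col col_mxKd col_mxKu linear0 mul0mx !add0r mulmx1 /X col_mxKu.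
    rewrite jacE; last exact: regular_mx_diff Ux rF.
    by rewrite mulmxA mulmxV // mul1mx Thd2 // subrr.
  move=> /(_ H w we) /=.
  rewrite col_mxKu mulmx0 subr0 Thinit; last exact: le_lt_trans (dsubmx_le w) we.
  by rewrite w0 addr0 => /eqP; rewrite subr_eq => /eqP.
have [tau tau0 taue] : exists2 tau : R, 0 < tau & tau < eps by exists (eps / 2); lra.
pose G (y : 'cV[R]_n) : 'cV[R]_(1 + (n + n)) := col_mx (tau%:M) (col_mx 0 (tau^-1 *: (y - F x0))).
have Ge y : `|y - F x0| < tau * eps -> `|G y| < eps.
  move=> ye; apply/col_mx_lt => //; split.
    apply/col_norm_ltP => // i; by rewrite mxE (ord1 i) eqxx gtr0_norm.
  apply/col_mx_lt => //; rewrite normr0; split => //.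
  by rewrite normrZ gtr0_norm ?invr_gt0 // ltr_pdivrMl.
exists (tau * eps), (fun y => x0 + usubmx (Th (G y))); split.
- exact: mulr_gt0.
- have oB := @open_norm R 'cV[R]_n (F x0) (tau * eps).
  apply: regular_mx_add => //; first exact: regular_mx_cst.
  apply: regular_usubmx => //; apply: (regular_mx_comp oB oE Ge rTh).
  apply: regular_col_mx => //; first exact: regular_mx_cst.
  apply: regular_col_mx => //; first exact: regular_mx_cst.
  have -> : (fun y => tau^-1 *: (y - F x0)) = (fun y => tau^-1%:M *m (y - F x0)).
    by apply/funext => y; rewrite mul_scalar_mx.
  apply: regular_mx_mul => //; first exact: regular_mx_cst.
  by apply: regular_mx_sub_op => //; [exact: regular_mx_id | exact: regular_mx_cst].
- have G0 : `|G (F x0)| < eps by apply: Ge; rewrite subrr normr0 mulr_gt0.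
  have Xz w' : `|w'| < eps -> dsubmx (dsubmx w') = 0 -> X (Th w') = 0.
    by move=> we' w0; rewrite /X Thd2 // w0 mulmx0 col_mx0.
  have K (w' : 'cV[R]_(1 + (n + n))) : `|w'| < eps -> `|col_mx (usubmx w') (0 : 'cV[R]_(n + n))| < eps.
    move=> we'; apply/col_mx_lt => //; rewrite normr0; split => //; exact: le_lt_trans (usubmx_le w') we'.
  pose P (w : 'cV[R]_(1 + (n + n))) := col_mx (usubmx w) (0 : 'cV[R]_(n + n)).
  have := @const_along_time R (n + n) eps _ _ (fun w => Th (P w)) _ (G (F x0)) G0.
  have PG : P (G (F x0)) = G (F x0).
    by rewrite /P /G col_mxKu subrr scaler0 col_mx0.
  rewrite PG => ->; last first.
    move=> w' we'.
    have dP : mx_derive P w' dt dt.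
      have := mx_derive_col (mx_derive_usub (mx_derive_id w' dt)) (mx_derive_cst (0 : 'cV[R]_(n + n)) w' dt).
      by have -> : col_mx (usubmx (dt : 'cV[R]_(1 + (n + n)))) 0 = dt :> 'cV[R]_(1 + (n + n)) by rewrite dt_col col_mxKu.
    have := mx_derive_chain dP (regular_mx_diff (K w' we') rTh).
    by rewrite (Thd _ (K w' we')) Xz // ?K // /P col_mxKd linear0.
  rewrite /P col_mxKu (_ : col_mx 0 0 = 0) ?col_mx0 //.
  have -> : Th 0 = 0 by rewrite Th0 ?normr0 // linear0.
  by rewrite linear0 addr0.
move=> y ye; have we := Ge y ye; have [_ [Ux _]] := ThU _ we.
split => //; rewrite line //; last by rewrite /G col_mxKd col_mxKu.
rewrite /G !col_mxKd col_mxKu mul_mx_scalar scalerA mulfV ?gt_eqF // scale1r.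
by rewrite addrCA subrr addr0.
Qed.

(** Applying the previous lemma to a right inverse g of F gives a right inverse
    of g, which has to coincide with F. *)
Lemma inverse_function (R : realType) C n (U : set 'cV[R]_n) (F : 'cV[R]_n -> 'cV[R]_n) x0 :
  open U -> U x0 -> regular_mx C U F -> jac F x0 \in unitmx ->
  exists r (g : 'cV[R]_n -> 'cV[R]_n), [/\ 0 < r,
    regular_mx C [set y | `|y - F x0| < r] g, g (F x0) = x0,
    (forall y, `|y - F x0| < r -> [/\ U (g y), F (g y) = y & jac F (g y) \in unitmx]) &
    exists2 W, open W & W x0 /\ forall x, W x -> [/\ U x, `|F x - F x0| < r & g (F x) = x]].
Proof.
move=> oU Ux0 rF uF.
pose U1 := [set z | U z /\ jac F z \in unitmx].
have oU1 : open U1 by apply: open_unitmx => //; exact: regular_jac.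
have U1x : U1 x0 by split.
have rF1 : regular_mx C U1 F by apply: regular_mx_sub rF => x [].
have [r [g [r0 rg gx0 Hg]]] := right_inverse oU1 U1x rF1 uF.
have oB := @open_norm R 'cV[R]_n (F x0) r.
have B0 : `|F x0 - F x0| < r by rewrite subrr normr0.
(* The chain rule for F (g y) = y exhibits the inverse of the Jacobian of g. *)
have ug : jac g (F x0) \in unitmx.
  have dg := regular_mx_diff (U := [set y | `|y - F x0| < r]) B0 rg.
  have dF : differentiable F (g (F x0)) by rewrite gx0; exact: regular_mx_diff Ux0 rF.
  have J : jac F x0 *m jac g (F x0) = 1%:M.
    rewrite -{1}gx0 -jac_comp //; apply: jac_unique => [v|]; last first.
      have := mx_derive_chain (conj dg erefl : mx_derive g (F x0) 0 _) dF; by case.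
    have := mx_derive_ext oB B0 (fun y By => esym (Hg y By).2) (mx_derive_id (F x0) v).
    by move=> /mx_derive_val ->; rewrite mul1mx.
  by have [] := mulmx1_unit J.
have [r2 [f [r20 rf fx0 Hf]]] := right_inverse oB B0 rg ug.
rewrite gx0 in r20 rf fx0 Hf.
have fF x : `|x - x0| < r2 -> f x = F x.
  move=> /Hf[Bf gf]; have [_ E] := Hg _ Bf; by rewrite -[LHS]E gf.
exists r, g; split => //.
  by move=> y /Hg[[]].
exists [set x | `|x - x0| < r2]; first exact: open_norm.
split; first by rewrite /= subrr normr0.
move=> x xr; have [Bf gf] := Hf x xr; rewrite -(fF x xr); split => //.
by have [[]] := Hg _ Bf; rewrite gf.
Qed.

(** * Coprime block diagonalisation and Sylvester operators *)

Section LinearAlgebra.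
Context {F : fieldType}.

Lemma char_poly_similar n (P A B : 'M[F]_n) : P \in unitmx -> P *m A = B *m P ->
  char_poly A = char_poly B.
Proof.
move=> uP E; pose P' := map_mx polyC P.
have H : P' *m char_poly_mx A = char_poly_mx B *m P'.
  rewrite /char_poly_mx mulmxBr mulmxBl -!map_mxM E; congr (_ - _).
  by rewrite scalar_mxC.
have := congr1 determinant H; rewrite !det_mulmx mulrC det_map_mx.
apply: mulIf; by rewrite polyC_eq0 -unitfE -unitmxE.
Qed.

Lemma char_poly_block p q (A : 'M[F]_p) (B : 'M[F]_q) :
  char_poly (block_mx A 0 0 B) = char_poly A * char_poly B.
Proof. by rewrite /char_poly char_block_diag_mx det_ublock. Qed.

(** p(X) - p(A) is divisible by X - A, so the determinant of X - A divides p(X)^n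
    when p(A) = 0. *)
Lemma char_poly_dvd_exp n (A : 'M[F]_n.+1) (p : {poly F}) : horner_mx A p = 0 ->
  char_poly A %| p ^+ n.+1.
Proof.
move=> pA; have [phi [[psi phiK psiK] phiZ phiC _]] := mx_poly_ring_isom F n.
have /factor_theorem [q Hq] : root (map_poly (@scalar_mx F n.+1) p) A by apply/rootP.
have E : p%:M = psi q *m char_poly_mx A.
  apply: (can_inj phiK); rewrite phiZ Hq rmorphM psiK /=; congr (_ * _).
  by rewrite /char_poly_mx rmorphB phiC phiZ map_polyX.
have := congr1 determinant E; rewrite det_scalar det_mulmx => ->.
exact: dvdp_mull.
Qed.

(** The polynomial p kills the restriction of A to ker p(A), so that the
    characteristic polynomial of the restriction divides a power of p. *)
Lemma invariant_kernel n (A : 'M[F]_n) (p : {poly F}) :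
  exists (P : 'M[F]_(\rank (kermxpoly A p), n)) (B : 'M[F]_(\rank (kermxpoly A p))),
    [/\ row_free P, (P :=: kermxpoly A p)%MS, P *m A = B *m P &
        char_poly B %| p ^+ \rank (kermxpoly A p)].
Proof.
set K := kermxpoly A p; set P := row_base K.
have fP : row_free P by exact: row_base_free.
have PK : (P :=: K)%MS by exact: eq_row_base.
have sP : stablemx P A.
  by rewrite (eqmx_stable _ PK); apply: comm_mx_stable_kermxpoly.
exists P, (conjmx P A); split => //; first by rewrite /conjmx mulmxKpV.
move: P fP PK sP; move Er: (\rank K) => r.
case: r Er => [|r] Er P fP PK sP.
  by rewrite /char_poly det_mx00 dvd1p.
apply: char_poly_dvd_exp.
case: n => [|n] in A K Er P fP PK sP *.
  by have := rank_leq_row K; rewrite Er.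
rewrite horner_mx_conj // /conjmx (_ : P *m horner_mx A p = 0) ?mul0mx //.
by apply/sub_kermxP; rewrite PK.
Qed.

Lemma block_rows m1 m2 r1 r2 (A : 'M[F]_(m1 + m2)) (P1 : 'M[F]_(r1, m1 + m2))
    (P2 : 'M[F]_(r2, m1 + m2)) B1 B2 :
  (P1 + P2 :=: 1%:M)%MS -> P1 *m A = B1 *m P1 -> P2 *m A = B2 *m P2 -> r1 = m1 -> r2 = m2 ->
  exists (P : 'M[F]_(m1 + m2)) (A1 : 'M[F]_m1) (A2 : 'M[F]_m2), [/\ P \in unitmx,
    P *m A = block_mx A1 0 0 A2 *m P, char_poly A1 = char_poly B1 &
    char_poly A2 = char_poly B2].
Proof.
move=> full H1 H2 E1 E2; subst r1 r2; exists (col_mx P1 P2), B1, B2; split => //.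
  by rewrite -row_full_unit -sub1mx -(addsmxE P1 P2) full.
by rewrite mul_col_mx mul_block_col !mul0mx addr0 add0r H1 H2.
Qed.

Lemma char_poly_rows n r1 r2 (A : 'M[F]_n) (P1 : 'M[F]_(r1, n)) (P2 : 'M[F]_(r2, n)) B1 B2 :
  (P1 + P2 :=: 1%:M)%MS -> P1 *m A = B1 *m P1 -> P2 *m A = B2 *m P2 -> (r1 + r2)%N = n ->
  char_poly A = char_poly B1 * char_poly B2.
Proof.
move=> full H1 H2 En; subst n.
have [P [A1 [A2 [uP PA <- <-]]]] := block_rows full H1 H2 erefl erefl.
by rewrite (char_poly_similar uP PA) char_poly_block.
Qed.

Lemma coprime_factors (c1 c2 p1 p2 : {poly F}) : c1 \is monic -> c2 \is monic ->
  p1 \is monic -> p2 \is monic ->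
  c1 * c2 = p1 * p2 -> coprimep c1 p2 -> coprimep c2 p1 -> c1 = p1 /\ c2 = p2.
Proof.
move=> m1 m2 n1 n2 E cop1 cop2.
have d1 : c1 %| p1 by rewrite -(Gauss_dvdpl _ cop1) -E dvdp_mulr.
have d1' : p1 %| c1 by rewrite -(@Gauss_dvdpl _ c1 c2) ?E ?dvdp_mulr // coprimep_sym.
have E1 : c1 = p1 by apply/eqP; rewrite -eqp_monic // /eqp d1.
split => //; move: E; rewrite E1; apply: mulfI; exact: monic_neq0.
Qed.

Theorem block_diagonalization m1 m2 (A : 'M[F]_(m1 + m2)) (chi1 chi2 : {poly F}) :
  char_poly A = chi1 * chi2 -> chi1 \is monic -> chi2 \is monic -> coprimep chi1 chi2 ->
  size chi1 = m1.+1 -> size chi2 = m2.+1 ->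
  exists (Q : 'M[F]_(m1 + m2)) (A1 : 'M[F]_m1) (A2 : 'M[F]_m2), [/\ Q \in unitmx,
    invmx Q *m A *m Q = block_mx A1 0 0 A2, char_poly A1 = chi1 & char_poly A2 = chi2].
Proof.
move=> cA mo1 mo2 cop s1 s2.
have [P1 [B1 [f1 K1 H1 D1]]] := invariant_kernel A chi1.
have [P2 [B2 [f2 K2 H2 D2]]] := invariant_kernel A chi2.
move: P1 B1 f1 K1 H1 D1 P2 B2 f2 K2 H2 D2.
move E1: (\rank (kermxpoly A chi1)) => r1; move E2: (\rank (kermxpoly A chi2)) => r2.
move=> P1 B1 f1 K1 H1 D1 P2 B2 f2 K2 H2 D2.
have full : (kermxpoly A chi1 + kermxpoly A chi2 :=: 1%:M)%MS.
  have CH n (B : 'M[F]_n) : (kermxpoly B (char_poly B) :=: 1%:M)%MS.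
    case: n B => [|n] B; first by rewrite [kermxpoly _ _]thinmx0 [1%:M]thinmx0.
    by rewrite /kermxpoly Cayley_Hamilton; exact: kermx0.
  by apply: eqmx_trans (eqmx_sym (kermxpolyM A cop)) _; rewrite -cA.
have fullP : (P1 + P2 :=: 1%:M)%MS by apply: eqmx_trans full; exact: adds_eqmx.
have r12 : (r1 + r2 = m1 + m2)%N.
  have := mxrank_sum_cap (kermxpoly A chi1) (kermxpoly A chi2).
  by rewrite mxdirect_kermxpoly // mxrank0 addn0 full mxrank1 E1 E2.
have E := char_poly_rows fullP H1 H2 r12.
have [c1 c2] : char_poly B1 = chi1 /\ char_poly B2 = chi2.
  apply: coprime_factors => //; rewrite ?char_poly_monic //; first by rewrite -E.
    by apply: (coprimep_dvdr D1); exact: coprimep_expl.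
  by apply: (coprimep_dvdr D2); apply: coprimep_expl; rewrite coprimep_sym.
have r1E : r1 = m1 by apply: succn_inj; rewrite -s1 -c1 size_char_poly.
have r2E : r2 = m2 by apply: succn_inj; rewrite -s2 -c2 size_char_poly.
have [P [A1 [A2 [uP PA e1 e2]]]] := block_rows fullP H1 H2 r1E r2E.
exists (invmx P), A1, A2; rewrite unitmx_inv uP invmxK PA mulmxK // e1 e2; by split.
Qed.

(** The Sylvester operator Z |-> A Z - Z B as a matrix acting on vectorised Z. *)
Definition sylvester m1 m2 (A : 'M[F]_m1) (B : 'M[F]_m2) : 'M[F]_(m1 * m2) :=
  lin_mulmx A - lin_mulmxr B.

Lemma mul_sylvester m1 m2 (A : 'M[F]_m1) (B : 'M[F]_m2) Z :
  mxvec Z *m sylvester A B = mxvec (A *m Z - Z *m B).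
Proof. by rewrite /sylvester mulmxBr !mul_vec_lin linearB. Qed.

Lemma sylvester_inj m1 m2 (A : 'M[F]_m1) (B : 'M[F]_m2) Z : sylvester A B \in unitmx ->
  A *m Z = Z *m B -> Z = 0.
Proof.
move=> uS E; apply: (can_inj mxvecK); rewrite linear0.
have : mxvec Z *m sylvester A B = 0 by rewrite mul_sylvester E subrr linear0.
by move/(congr1 (mulmx^~ (invmx (sylvester A B)))); rewrite mulmxK // mul0mx.
Qed.

Lemma horner_mx_intertwine n1 n2 (A : 'M[F]_n1.+1) (B : 'M[F]_n2.+1) Z p :
  A *m Z = Z *m B -> horner_mx A p *m Z = Z *m horner_mx B p.
Proof.
move=> E; elim/poly_ind: p => [|p c IH]; first by rewrite !rmorph0 mul0mx mulmx0.
rewrite !rmorphD !rmorphM /= !horner_mx_X !horner_mx_C mulmxDl mulmxDr -scalar_mxC.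
by congr (_ + _); rewrite -!mulmxE -mulmxA E !mulmxA IH.
Qed.

(** If A Z = Z B, then Z chi_A(B) = chi_A(A) Z = 0, and chi_A(B) is invertible by
    a Bezout relation between the two characteristic polynomials. *)
Lemma sylvester_unit m1 m2 (A : 'M[F]_m1) (B : 'M[F]_m2) :
  coprimep (char_poly A) (char_poly B) -> sylvester A B \in unitmx.
Proof.
move=> cop; rewrite -row_free_unit; apply: inj_row_free => v.
rewrite -[v]vec_mxK mul_sylvester; move: (vec_mx v) => Z H.
have /eqP : A *m Z - Z *m B = 0 by apply: (can_inj mxvecK); rewrite H linear0.
rewrite subr_eq0 => /eqP E; suff -> : Z = 0 by rewrite linear0.
move: Z {v H} E; case: m1 A cop => [|n1] A cop Z E; first by rewrite [Z]flatmx0.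
case: m2 B cop Z E => [|n2] B cop Z E; first by rewrite [Z]thinmx0.
have [[u v] /= /(congr1 (horner_mx B))] := Bezout_eq1_coprimepP _ _ cop.
rewrite rmorphD !rmorphM rmorph1 /= Cayley_Hamilton mulr0 addr0 => uB.
have H0 := horner_mx_intertwine (char_poly A) E; rewrite Cayley_Hamilton mul0mx in H0.
have uB' : horner_mx B (char_poly A) *m horner_mx B u = 1%:M.
  by rewrite -[RHS]uB; exact: comm_horner_mx2.
by rewrite -[Z]mulmx1 -uB' mulmxA -H0 mul0mx.
Qed.

End LinearAlgebra.

Lemma regular_sylvester (R : realType) C n m1 m2 (U : set 'cV[R]_n)
    (A : 'cV[R]_n -> 'M[R]_m1) (B : 'cV[R]_n -> 'M[R]_m2) :
  open U -> regular_mx C U A -> regular_mx C U B ->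
  regular_mx C U (fun x => sylvester (A x) (B x)).
Proof.
move=> oU rA rB; apply: regular_mx_sub_op => // i j.
  case/mxvec_indexP: j => j1 j2.
  have -> : (fun x => lin_mulmx (A x) i (mxvec_index j1 j2)) =
      (fun x => (A x *m vec_mx (delta_mx 0 i)) j1 j2).
    by apply/funext => x; rewrite [LHS]mxE /= mxvecE.
  by apply: regular_mx_mul => //; exact: regular_mx_cst.
case/mxvec_indexP: j => j1 j2.
have -> : (fun x => lin_mulmxr (B x) i (mxvec_index j1 j2)) =
    (fun x => (vec_mx (delta_mx 0 i) *m B x) j1 j2).
  by apply/funext => x; rewrite [LHS]mxE /= mxvecE.
by apply: regular_mx_mul => //; exact: regular_mx_cst.
Qed.

(** * Integrability of invariant graphs *)

Lemma unitmx_injective (F : fieldType) n (M : 'M[F]_n) :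
  (forall h : 'cV[F]_n, M *m h = 0 -> h = 0) -> M \in unitmx.
Proof.
move=> inj; rewrite -unitmx_tr -row_free_unit; apply: inj_row_free => v H.
by apply: trmx_inj; rewrite trmx0; apply: inj; rewrite -[M]trmxK -trmx_mul H trmx0.
Qed.

Lemma derive0v (R : realType) (V W : normedModType R) (f : V -> W) x :
  differentiable f x -> 'D_0 f x = 0.
Proof. by move=> df; rewrite deriveE // linear0. Qed.

Lemma linear_matrix (R : realType) p q (f : 'cV[R]_q -> 'cV[R]_p) :
  (forall a u v, f (a *: u + v) = a *: f u + f v) -> exists M : 'M[R]_(p, q), forall c, f c = M *m c.
Proof.
move=> lf; pose fl : {linear 'cV[R]_q -> 'cV[R]_p} :=
  HB.pack f (GRing.isLinear.Build R 'cV[R]_q 'cV[R]_p *:%R f lf).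
exists (\matrix_(i, j) f (ecol j) i ord0) => c.
rewrite -[f c]/(fl c) {1}[c]col_sumE linear_sum; apply/colP => i; rewrite summxE mxE.
by apply: eq_bigr => j _; rewrite linearZ !mxE mulrC.
Qed.

Lemma sylvester_linear (R : realType) p q (A : 'M[R]_p) (B : 'M[R]_q) (f : 'cV[R]_q -> 'cV[R]_p) :
  sylvester A B \in unitmx -> (forall a u v, f (a *: u + v) = a *: f u + f v) ->
  (forall c, A *m f c = f (B *m c)) -> forall c, f c = 0.
Proof.
move=> uS lf fE; have [M HM] := linear_matrix lf.
suff M0 : M = 0 by move=> c; rewrite HM M0 mul0mx.
apply: (sylvester_inj uS); apply/matrixP => i j.
have := fE (ecol j); rewrite !HM !mulmxA /ecol -!colE => /colP /(_ i).
by rewrite [in LHS]mxE [in RHS]mxE => ->.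
Qed.

Section VectorisedMatrix.
Context {R : realType} {n p q : nat}.

Definition tail_mx (u : 'cV[R]_(n + p * q)) : 'M[R]_(p, q) := vec_mx (dsubmx u)^T.

Definition vec_col (M : 'M[R]_(p, q)) : 'cV[R]_(p * q) := (mxvec M)^T.

Lemma tail_mxE u i j : tail_mx u i j = u (rshift n (mxvec_index i j)) ord0.
Proof. by rewrite /tail_mx !mxE. Qed.

Lemma vec_colE M i j : vec_col M (mxvec_index i j) ord0 = M i j.
Proof. by rewrite /vec_col mxE mxvecE. Qed.

Lemma vec_col_inj : injective vec_col.
Proof. by move=> A B /matrixP H; apply/matrixP => i j; rewrite -!vec_colE H. Qed.

Lemma vec_tail u : vec_col (tail_mx u) = dsubmx u.
Proof. by rewrite /vec_col /tail_mx vec_mxK trmxK. Qed.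

Lemma mx_derive_tail u h : mx_derive tail_mx u h (tail_mx h).
Proof.
apply: (mx_derive_entries (r := fun i j => rshift n (mxvec_index i j)) (c := fun _ _ => ord0)
  _ _ (mx_derive_id u h)) => [y|] i j; exact: tail_mxE.
Qed.

Lemma vec_col_index : exists ab : 'I_(p * q) -> 'I_p * 'I_q,
  forall M i, vec_col M i ord0 = M (ab i).1 (ab i).2.
Proof.
have /choice [ab Hab] : forall i : 'I_(p * q), exists ab : 'I_p * 'I_q, i = mxvec_index ab.1 ab.2.
  by move=> i; case/mxvec_indexP: i => a b; exists (a, b).
by exists ab => M i; rewrite {1}(Hab i) vec_colE.
Qed.

Lemma mx_derive_vec (V : normedModType R) (F : V -> 'M[R]_(p, q)) x v A :
  mx_derive F x v A -> mx_derive (fun y => vec_col (F y)) x v (vec_col A).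
Proof.
have [ab Hab] := vec_col_index.
apply: (mx_derive_entries (r := fun i _ => (ab i).1) (c := fun i _ => (ab i).2)) => [y|] i j;
  by rewrite (ord1 j) Hab.
Qed.

Lemma regular_tail C (U : set 'cV[R]_(n + p * q)) : open U -> regular_mx C U tail_mx.
Proof.
move=> oU; apply: (regular_mx_entries (r := fun i j => rshift n (mxvec_index i j)) (c := fun _ _ => ord0)
  _ _ (@regular_mx_id R C _ U)) => // y i j; exact: tail_mxE.
Qed.

Lemma regular_vec C m (U : set 'cV[R]_m) F : open U -> regular_mx C U F ->
  regular_mx C U (fun y => vec_col (F y)).
Proof.
move=> oU; have [ab Hab] := vec_col_index.
apply: (regular_mx_entries (r := fun i _ => (ab i).1) (c := fun i _ => (ab i).2)) => // y i j.
by rewrite (ord1 j) Hab.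
Qed.

End VectorisedMatrix.

(** The obstruction w to the integrability of the graph satisfies
    w(M b, M c) - M' w(M b, c) - M' w(b, M c) + M'^2 w(b, c) = 0 by the vanishing
    of the torsion, M and M' having disjoint spectra; cancelling the Sylvester
    operator in each of the two arguments leaves w = 0. *)
Lemma integrability_algebra (R : realType) n p q (K : 'M[R]_n) (X : 'M[R]_(n, q)) (P : 'M[R]_(p, n))
    (M1 : 'M[R]_p) (M2 : 'M[R]_q) (DK : 'cV[R]_n -> 'M[R]_n) (D : 'cV[R]_n -> 'M[R]_(p, q)) :
  sylvester M1 M2 \in unitmx -> K *m X = X *m M2 -> P *m K = M1 *m P ->
  (forall v, P *m DK v *m X = D v *m M2 - M1 *m D v) ->
  (forall u v, D (u + v) = D u + D v) -> (forall a v, D (a *: v) = a *: D v) ->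
  (forall a b, DK (K *m a) *m b - DK (K *m b) *m a + K *m (DK b *m a) - K *m (DK a *m b) = 0) ->
  forall b c, D (X *m b) *m c = D (X *m c) *m b.
Proof.
move=> uS KX PK PDK DD DZ tor b c; pose w b c := D (X *m b) *m c - D (X *m c) *m b.
have KX' (b' : 'cV[R]_q) : K *m (X *m b') = X *m (M2 *m b') by rewrite !mulmxA KX.
have PDK' v (c' : 'cV[R]_q) : P *m (DK v *m (X *m c')) = D v *m (M2 *m c') - M1 *m (D v *m c').
  by rewrite !mulmxA PDK mulmxBl.
have PKDK v (c' : 'cV[R]_q) : P *m (K *m (DK v *m (X *m c'))) =
    M1 *m (D v *m (M2 *m c')) - M1 *m (M1 *m (D v *m c')).
  by rewrite mulmxA PK -mulmxA PDK' mulmxBr.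
have step b' c' : M1 *m (M1 *m w b' c' - w (M2 *m b') c') =
    M1 *m w b' (M2 *m c') - w (M2 *m b') (M2 *m c').
  have := congr1 (mulmx P) (tor (X *m b') (X *m c')); rewrite mulmx0.
  rewrite (mulmxBr P) (mulmxDr P) (mulmxBr P) !KX' => H; rewrite !PDK' !PKDK in H.
  move/eqP: H => E; rewrite /w !mulmxBr.
  apply/eqP; rewrite -subr_eq0 -(eqP E); apply/eqP/colP => i.
  by rewrite !mxE; ring.
have lw2 b' a u v : w b' (a *: u + v) = a *: w b' u + w b' v.
  rewrite /w !mulmxDr -!scalemxAr DD DZ mulmxDl -scalemxAl scalerBr opprD.
  by rewrite addrACA.
have wN b' c' : w b' c' = - w c' b' by rewrite /w opprB.
have lw1 a u v c' : w (a *: u + v) c' = a *: w u c' + w v c'.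
  by rewrite wN lw2 opprD -scalerN -!wN.
have tau0 b' c' : M1 *m w b' c' = w (M2 *m b') c'.
  apply/eqP; rewrite -subr_eq0; apply/eqP.
  apply: (sylvester_linear (f := fun c => M1 *m w b' c - w (M2 *m b') c) uS) => [a u v|c''].
    rewrite !lw2 mulmxDr -scalemxAr.
    move: (M1 *m w b' u) (M1 *m w b' v) (w (M2 *m b') u) (w (M2 *m b') v) => x1 x2 x3 x4.
    by apply/colP => i; rewrite !mxE; ring.
  exact: step.
have w0 : w b c = 0.
  by apply: (sylvester_linear (f := fun b => w b c) uS) => [a u v|b']; [exact: lw1 | exact: tau0].
by apply/eqP; rewrite -subr_eq0 -/(w b c) w0.
Qed.

Section InvariantGraph.
Context {R : realType} {C : category} {p q : nat}.
Implicit Types (U : set 'cV[R]_(p + q)).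

(** The graph {(A b, b)} is invariant under K when this quadratic expression
    vanishes; its linearisation at a block diagonal K is the Sylvester operator. *)
Definition riccati (K : 'M[R]_(p + q)) (A : 'M[R]_(p, q)) : 'M[R]_(p, q) :=
  ulsubmx K *m A + ursubmx K - A *m (dlsubmx K *m A + drsubmx K).

Definition graph (A : 'M[R]_(p, q)) : 'M[R]_(p + q, q) := col_mx A 1%:M.

Definition cograph (A : 'M[R]_(p, q)) : 'M[R]_(p, p + q) := row_mx 1%:M (- A).

Definition graph_op (K : 'M[R]_(p + q)) (A : 'M[R]_(p, q)) := dlsubmx K *m A + drsubmx K.

Definition cograph_op (K : 'M[R]_(p + q)) (A : 'M[R]_(p, q)) := ulsubmx K - A *m dlsubmx K.

Lemma cograph_graph (A : 'M[R]_(p, q)) : cograph A *m graph A = 0.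
Proof. by rewrite mul_row_col mul1mx mulmx1 subrr. Qed.

Lemma riccati_graph (K : 'M[R]_(p + q)) (A : 'M[R]_(p, q)) : riccati K A = 0 -> K *m graph A = graph A *m graph_op K A.
Proof.
move=> H; rewrite -{1}(submxK K) mul_block_col !mulmx1 mul_col_mx mul1mx; congr col_mx.
by apply/eqP; rewrite -subr_eq0 -[X in X == 0]/(riccati K A) H.
Qed.

Lemma riccati_cograph (K : 'M[R]_(p + q)) (A : 'M[R]_(p, q)) : riccati K A = 0 -> cograph A *m K = cograph_op K A *m cograph A.
Proof.
move=> H; rewrite -{1}(submxK K) mul_row_block !mul1mx mul_mx_row mulmx1 !mulNmx; congr row_mx.
apply/eqP; rewrite -subr_eq0 mulmxN opprK /cograph_op mulmxBl addrC.
have -> : ulsubmx K *m A - A *m dlsubmx K *m A + (ursubmx K - A *m drsubmx K) = riccati K A.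
  by rewrite /riccati mulmxDr opprD mulmxA addrACA.
by rewrite H.
Qed.

Lemma regular_block n p1 p2 q1 q2 (U : set 'cV[R]_n) (F : 'cV[R]_n -> 'M[R]_(p1 + p2, q1 + q2)) :
  open U -> regular_mx C U F ->
  [/\ regular_mx C U (fun x => ulsubmx (F x)), regular_mx C U (fun x => ursubmx (F x)),
      regular_mx C U (fun x => dlsubmx (F x)) & regular_mx C U (fun x => drsubmx (F x))].
Proof.
move=> oU rF; have ru := regular_usubmx oU rF; have rd := regular_dsubmx oU rF.
by split; [exact: regular_lsubmx ru | exact: regular_rsubmx ru | exact: regular_lsubmx rd
  | exact: regular_rsubmx rd].
Qed.

(** The Riccati equation is solved for A by the inverse function theorem: at the
    origin, where K is block diagonal and A = 0, its derivative in A is the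
    Sylvester operator of the two blocks. *)
Lemma invariant_graph U (K : 'cV[R]_(p + q) -> 'M[R]_(p + q)) (A1 : 'M[R]_p) (A2 : 'M[R]_q) :
  open U -> U 0 -> regular_mx C U K -> K 0 = block_mx A1 0 0 A2 -> sylvester A1 A2 \in unitmx ->
  exists (r : R) (A : 'cV[R]_(p + q) -> 'M[R]_(p, q)), [/\ 0 < r,
    (forall z : 'cV[R]_(p + q), `|z| < r -> U z),
    regular_mx C [set z | `|z| < r] A, A 0 = 0 &
    forall z : 'cV[R]_(p + q), `|z| < r -> riccati (K z) (A z) = 0 /\
      sylvester (cograph_op (K z) (A z)) (graph_op (K z) (A z)) \in unitmx].
Proof.
move=> oU U0 rK K0 uS.
pose N := ((p + q) + p * q)%N.
pose U2 : set 'cV[R]_N := [set u | setT u /\ U (usubmx u)].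
have ru (S : set 'cV[R]_N) : open S -> regular_mx C S (fun u : 'cV[R]_N => usubmx u).
  by move=> oS; apply: regular_usubmx => //; exact: regular_mx_id.
have oU2 : open U2 by apply: (@open_preimage _ C) => //; [exact: openT | exact: ru openT].
pose G (u : 'cV[R]_N) : 'cV[R]_N := col_mx (usubmx u) (vec_col (riccati (K (usubmx u)) (tail_mx u))).
have rK2 : regular_mx C U2 (fun u => K (usubmx u)).
  by apply: (regular_mx_comp (V := U)) (ru _ oU2) => // u [].
have [r11 r12 r21 r22] := regular_block oU2 rK2.
have rt : regular_mx C U2 (@tail_mx R (p + q) p q) by exact: regular_tail.
have rG : regular_mx C U2 G.
  apply: regular_col_mx => //; first exact: ru.
  apply: regular_vec => //; apply: regular_mx_sub_op => //.
    by apply: regular_mx_add => //; exact: regular_mx_mul.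
  by apply: regular_mx_mul => //; apply: regular_mx_add => //; exact: regular_mx_mul.
have t0 : tail_mx (0 : 'cV[R]_N) = 0 :> 'M[R]_(p, q) by apply/matrixP => i j; rewrite tail_mxE !mxE.
have U20 : U2 0 by split => //; rewrite linear0.
have G0 : G 0 = 0.
  rewrite /G t0 linear0 K0 /riccati !mulmx0 mul0mx block_mxKur !addr0 subrr.
  by rewrite (_ : vec_col 0 = 0) ?col_mx0 // /vec_col !linear0.
have uG : jac G 0 \in unitmx.
  apply: unitmx_injective => h.
  have dG : differentiable G 0 by exact: regular_mx_diff U20 rG.
  rewrite -jacE // => DG.
  have dK : mx_derive (fun u => K (usubmx u)) (0 : 'cV[R]_N) h ('D_h (fun u => K (usubmx u)) 0).
    exact: mx_derive_regular rK2 U20.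
  have d11 := mx_derive_lsub (mx_derive_usub dK); have d12 := mx_derive_rsub (mx_derive_usub dK).
  have d21 := mx_derive_lsub (mx_derive_dsub dK); have d22 := mx_derive_rsub (mx_derive_dsub dK).
  have dt := @mx_derive_tail R (p + q) p q 0 h.
  have dR := mx_derive_sub (mx_derive_add (mx_derive_mul d11 dt) d12)
    (mx_derive_mul dt (mx_derive_add (mx_derive_mul d21 dt) d22)).
  have dG' := mx_derive_col (mx_derive_usub (mx_derive_id 0 h)) (mx_derive_vec dR).
  have := mx_derive_val dG'; rewrite -/G [LHS]DG => /esym E.
  have h1 : usubmx h = 0.
    by have := congr1 usubmx E; rewrite col_mxKu linear0.
  have DK0 : 'D_h (fun u : 'cV[R]_N => K (usubmx u)) 0 = 0.
    have dKz : differentiable K (usubmx (0 : 'cV[R]_N)).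
      by rewrite linear0; exact: regular_mx_diff U0 rK.
    have := mx_derive_chain (mx_derive_usub (mx_derive_id (0 : 'cV[R]_N) h)) dKz.
    by move=> /mx_derive_val ->; rewrite h1 derive0v.
  have := congr1 dsubmx E; rewrite col_mxKd !(linear0, t0, DK0, mulmx0, mul0mx, add0r, addr0).
  rewrite K0 -/(ulsubmx _) -/(drsubmx _) block_mxKul block_mxKdr => E2.
  have T0 : tail_mx h = 0.
    apply: (sylvester_inj uS); apply/eqP; rewrite -subr_eq0; apply/eqP; apply: vec_col_inj.
    by rewrite E2 /vec_col !linear0.
  have h2 : dsubmx h = 0 by rewrite -vec_tail T0 /vec_col !linear0.
  by rewrite -[h]vsubmxK h1 h2 col_mx0.
have [r [g [r0 rg g0 Hg]]] := right_inverse oU2 U20 rG uG.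
rewrite G0 in rg g0 Hg.
pose A (z : 'cV[R]_(p + q)) : 'M[R]_(p, q) := tail_mx (g (col_mx z 0)).
have lift0 (z : 'cV[R]_(p + q)) : `|z| < r -> `|(col_mx z 0 : 'cV[R]_N) - 0| < r.
  by move=> zr; rewrite subr0; apply/col_mx_lt => //; rewrite normr0.
have oB := @open_norm0 R 'cV[R]_(p + q) r.
have oB2 := @open_norm R 'cV[R]_N 0 r.
have rA : regular_mx C [set z | `|z| < r] A.
  apply: (regular_mx_comp oB (@openT _) _ (@regular_tail R (p + q) p q C setT _)) => //; first exact: openT.
  apply: (regular_mx_comp oB oB2 lift0 rg).
  by apply: regular_col_mx => //; [exact: regular_mx_id | exact: regular_mx_cst].
have A0 : A 0 = 0 by rewrite /A col_mx0 g0.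
have HA (z : 'cV[R]_(p + q)) : `|z| < r -> U z /\ riccati (K z) (A z) = 0.
  move=> /lift0 /Hg[[_ Uz] Gg]; have gu := congr1 usubmx Gg; rewrite /G !col_mxKu in gu.
  rewrite gu in Uz; split => //; apply: vec_col_inj.
  have := congr1 dsubmx Gg; rewrite /G !col_mxKd gu => ->.
  by rewrite /vec_col !linear0.
have rK3 : regular_mx C [set z | `|z| < r] K by apply: regular_mx_sub rK => z /HA[].
have [s11 s12 s21 s22] := regular_block oB rK3.
have rS : regular_mx C [set z | `|z| < r] (fun z => sylvester (cograph_op (K z) (A z)) (graph_op (K z) (A z))).
  apply: regular_sylvester => //.
    by apply: regular_mx_sub_op => //; exact: regular_mx_mul.
  by apply: regular_mx_add => //; exact: regular_mx_mul.
have oS := open_unitmx oB rS.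
have S0 : [set z | [set z | `|z| < r] z /\ sylvester (cograph_op (K z) (A z)) (graph_op (K z) (A z)) \in unitmx] 0.
  split; first by rewrite /= normr0.
  by rewrite /cograph_op /graph_op A0 mul0mx mulmx0 subr0 add0r K0 block_mxKul block_mxKdr.
have [d d0 Hd] := open_dist oS S0.
have {}Hd (z : 'cV[R]_(p + q)) : `|z| < d -> `|z| < r /\
    sylvester (cograph_op (K z) (A z)) (graph_op (K z) (A z)) \in unitmx.
  by move=> zd; apply: Hd; rewrite subr0.
exists d, A; split => //.
- by move=> z /Hd[/HA[]].
- by apply: regular_mx_sub rA => z /Hd[].
by move=> z /Hd[/HA[_ HR] uz].
Qed.

(** The value at x of the torsion of L on the constant fields a and b. *)
Definition torsion_form n (L : 'cV[R]_n -> 'M[R]_n) (x a b : 'cV[R]_n) : 'cV[R]_n :=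
  'D_(L x *m a) L x *m b - 'D_(L x *m b) L x *m a
  + L x *m ('D_b L x *m a) - L x *m ('D_a L x *m b).

(** Differentiating K X = X M along X, where X spans the graph, expresses the
    torsion on the graph through the derivative of A. *)
Lemma graph_integrable U (K : 'cV[R]_(p + q) -> 'M[R]_(p + q)) (A : 'cV[R]_(p + q) -> 'M[R]_(p, q))
    (z : 'cV[R]_(p + q)) (b c : 'cV[R]_q) : open U -> U z ->
  regular_mx C U K -> regular_mx C U A ->
  (forall y, U y -> riccati (K y) (A y) = 0) ->
  sylvester (cograph_op (K z) (A z)) (graph_op (K z) (A z)) \in unitmx ->
  (forall a b, torsion_form K z a b = 0) ->
  'D_(graph (A z) *m b) A z *m c = 'D_(graph (A z) *m c) A z *m b.
Proof.
move=> oU Uz rK rA ric uS tor.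
set M1 := cograph_op (K z) (A z) in uS *; set M2 := graph_op (K z) (A z) in uS *.
set X := graph (A z); set P := cograph (A z).
have KX : K z *m X = X *m M2 by exact: riccati_graph (ric z Uz).
have PK : P *m K z = M1 *m P by exact: riccati_cograph (ric z Uz).
have dA : differentiable A z by exact: regular_mx_diff Uz rA.
pose D v := 'D_v A z.
have DD u v : D (u + v) = D u + D v by exact: deriveDv.
have DZ a v : D (a *: v) = a *: D v by exact: deriveZv.
have PDK v : P *m 'D_v K z *m X = D v *m M2 - M1 *m D v.
  have dAv : mx_derive A z v (D v) by exact: mx_derive_regular rA Uz.
  have dKv : mx_derive K z v ('D_v K z) by exact: mx_derive_regular rK Uz.
  have dX := mx_derive_col dAv (mx_derive_cst (1%:M : 'M[R]_q) z v).
  have dM2 := mx_derive_add (mx_derive_mul (mx_derive_lsub (mx_derive_dsub dKv)) dAv)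
    (mx_derive_rsub (mx_derive_dsub dKv)).
  have e1 := mx_derive_val (mx_derive_mul dKv dX).
  have e2 := mx_derive_val (mx_derive_ext oU Uz (fun y Uy => riccati_graph (ric y Uy)) (mx_derive_mul dKv dX)).
  have e3 := mx_derive_val (mx_derive_mul dX dM2).
  have := congr1 (mulmx P) (etrans (esym e2) e3).
  have PX : P *m col_mx (A z) 1%:M = 0 by exact: cograph_graph.
  have PD : P *m col_mx (D v) 0 = D v by rewrite /P /cograph mul_row_col mul1mx mulmx0 addr0.
  rewrite !mulmxDr !mulmxA PX !mul0mx addr0 PD PK -(mulmxA M1) PD => E.
  rewrite -[LHS](addrK (M1 *m D v)); congr (_ - _).
  by apply: etrans E _; rewrite !addr0.
exact: (integrability_algebra uS KX PK PDK DD DZ tor).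
Qed.

End InvariantGraph.

(** Gronwall along each line of constant xi; the coefficient is bounded on a
    closed ball between the point and the boundary of the domain. *)
Lemma linear_ode_unique (R : realType) C N m (eps : R) (f : 'cV[R]_(1 + N) -> 'cV[R]_m)
    (M : 'cV[R]_(1 + N) -> 'M[R]_m) :
  regular_mx C [set w | `|w| < eps] M ->
  (forall w, `|w| < eps -> mx_derive f w dt (M w *m f w)) ->
  (forall xi, `|xi| < eps -> f (col_mx 0 xi) = 0) ->
  forall w, `|w| < eps -> f w = 0.
Proof.
move=> rM fM f0 w we.
have [rho wr re] : exists2 rho, `|w| < rho & rho < eps by exists ((`|w| + eps) / 2); lra.
have rho0 : 0 < rho by exact: le_lt_trans wr.
have [K K0 HK] := @family_bounded R (1 + N) _ (fun (ij : 'I_m * 'I_m) w => M w ij.1 ij.2) rho (ltW rho0)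
  (fun ij z zr => regular_continuous (le_lt_trans zr re) (rM ij.1 ij.2)).
have MK z (v : 'cV[R]_m) : `|z| <= rho -> `|M z *m v| <= m%:R * K * `|v|.
  move=> zr; apply/col_normP => [|i]; first by rewrite !mulr_ge0.
  rewrite mxE; apply: le_trans (ler_norm_sum _ _ _) _.
  have -> : m%:R * K * `|v| = \sum_(j < m) K * `|v| by rewrite sum_const_ord mulrA.
  apply: ler_sum => j _; rewrite normrM ler_pM ?coord_le_norm //.
  exact: (HK (i, j) z zr).
have L0 : 0 <= m%:R * K by rewrite mulr_ge0.
have [c c0 gron] := @gronwall R m (m%:R * K) rho L0 (ltW rho0).
pose cur (s : R) : 'cV[R]_(1 + N) := col_mx 0 (dsubmx w) + s *: dt.
have curE s : cur s = col_mx (s%:M) (dsubmx w).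
  rewrite /cur dt_col scale_col_mx scaler0 add_col_mx addr0 add0r; congr col_mx.
  by rewrite scalemx1.
have curr s : `|s| < rho -> `|cur s| < rho.
  move=> sr; rewrite curE; apply/col_mx_lt => //; split; last exact: le_lt_trans (dsubmx_le w) wr.
  by apply/col_norm_ltP => // i; rewrite mxE (ord1 i) eqxx.
have wE : w = cur (time w).
  rewrite curE -{1}[w]vsubmxK; congr col_mx; apply/colP => i.
  by rewrite !mxE (ord1 i) eqxx.
have := gron (fun s => f (cur s)) (fun s => M (cur s) *m f (cur s)) 0 (lexx _).
have -> : f (cur 0) = 0.
  rewrite /cur scale0r addr0 f0 //; exact: le_lt_trans (dsubmx_le w) we.
rewrite normr0 addr0 mulr0 => H; apply/eqP; rewrite -normr_le0 {1}wE; apply: H => [s sr|s sr|].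
- have [dF E] := fM (cur s) (lt_trans (curr s sr) re) => i.
  have dFi : differentiable (fun y => f y i ord0) (cur s) by exact: (differentiable_mxP f _).1.
  have := derive_line (diff_derivable dFi : derivable (fun y => f y i ord0) (col_mx 0 (dsubmx w) + s *: dt) dt).
  by rewrite -derive_mxE // -/(cur s) E.
- by rewrite addr0; apply: MK; exact/ltW/curr.
exact: le_lt_trans (coord_le_norm _ _) wr.
Qed.

(** * First integrals of invariant distributions *)

Lemma mulmx_ext (R : realType) m n (A B : 'M[R]_(m, n)) : (forall v : 'cV[R]_n, A *m v = B *m v) -> A = B.
Proof.
move=> H; apply/matrixP => i j; have := H (ecol j); rewrite /ecol -!colE => /colP /(_ i).
by rewrite !mxE.
Qed.

Lemma jac_of (R : realType) n m (F : 'cV[R]_n -> 'cV[R]_m) x (A : 'M[R]_(m, n)) :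
  (forall v, mx_derive F x v (A *m v)) -> jac F x = A.
Proof. by move=> H; apply: jac_unique => [v|]; [exact: (H v).2 | exact: (H 0).1]. Qed.

Lemma mx_schwarz (R : realType) C n p q (U : set 'cV[R]_n) (F : 'cV[R]_n -> 'M[R]_(p, q)) x u v :
  open U -> U x -> regular_mx C U F -> 'D_u ('D_v F) x = 'D_v ('D_u F) x.
Proof.
move=> oU Ux rF.
have H a b i j : ('D_a ('D_b F) x) i j = 'D_a ('D_b (fun y => F y i j)) x.
  have rD := regular_mx_derive b oU rF.
  rewrite derive_mxE; last exact: regular_mx_diff Ux rD.
  apply: (derive_ext _ oU Ux) => y Uy; rewrite derive_mxE //; exact: regular_mx_diff Uy rF.
apply/matrixP => i j; apply: etrans (H u v i j) _; apply: etrans _ (esym (H v u i j)).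
exact: (@schwarz R n U (fun y => F y i j) x u v oU Ux (regular_Ck 2 oU (rF i j))).
Qed.

Lemma add_cancel (V : zmodType) (x y z : V) : x + y - y + (z - z) = x.
Proof. by rewrite addrK subrr addr0. Qed.

Section Frobenius.
Context {R : realType} {C : category} {p q : nat} {r0 : R}.
Context {A : 'cV[R]_(p + q) -> 'M[R]_(p, q)}.
Hypothesis rA : regular_mx C [set z | `|z| < r0] A.
Hypothesis symA : forall (z : 'cV[R]_(p + q)) (b c : 'cV[R]_q), `|z| < r0 ->
  'D_(graph (A z) *m b) A z *m c = 'D_(graph (A z) *m c) A z *m b.

Notation N := ((p + q) + q)%N.

Let V : set 'cV[R]_N := [set u | setT u /\ `|usubmx u| < r0].

Let rise (u : 'cV[R]_N) : 'cV[R]_p := A (usubmx u) *m dsubmx u.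

(* On triples (x, y, y0) this is x' = A(x, y) y0, y' = y0, y0' = 0: rays in the
   y variables are lifted to the distribution spanned by the graph of A, and the
   direction y0 of the ray is carried along as a constant. *)
Let field (u : 'cV[R]_N) : 'cV[R]_N := col_mx (graph (A (usubmx u)) *m dsubmx u) 0.

Lemma open_leaf_domain : open V.
Proof.
apply: (@open_preimage R C N (p + q) 1 setT (fun u : 'cV[R]_N => usubmx u) [set z : 'cV[R]_(p + q) | `|z| < r0]).
- exact: openT.
- by apply: regular_usubmx; [exact: openT | exact: regular_mx_id].
exact: open_norm0.
Qed.

Lemma regular_slope : regular_mx C V (fun u => A (usubmx u)).
Proof.
have oV := open_leaf_domain; have oB := @open_norm0 R 'cV[R]_(p + q) r0.
apply: (regular_mx_comp oV oB _ rA) => [u [] //|].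
by apply: regular_usubmx => //; exact: regular_mx_id.
Qed.

Lemma regular_rise : regular_mx C V rise.
Proof.
have oV := open_leaf_domain; apply: regular_mx_mul => //; first exact: regular_slope.
by apply: regular_dsubmx => //; exact: regular_mx_id.
Qed.

Lemma regular_field : regular_mx C V field.
Proof.
have oV := open_leaf_domain; apply: regular_col_mx => //; last exact: regular_mx_cst.
apply: regular_mx_mul => //; last by apply: regular_dsubmx => //; exact: regular_mx_id.
by apply: regular_col_mx => //; [exact: regular_slope | exact: regular_mx_cst].
Qed.

Lemma mx_derive_rise (T : normedModType R) (F : T -> 'cV[R]_N) x v E : V (F x) -> mx_derive F x v E ->
  mx_derive (fun y => rise (F y)) x v
    ('D_(usubmx E) A (usubmx (F x)) *m dsubmx (F x) + A (usubmx (F x)) *m dsubmx E).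
Proof.
move=> [_ Vx] dF; apply: mx_derive_mul (mx_derive_dsub dF).
exact: mx_derive_chain (mx_derive_usub dF) (regular_mx_diff Vx rA).
Qed.

Section Leaves.
Context {eps : R} {Th : 'cV[R]_(1 + N) -> 'cV[R]_N}.
Hypothesis e0 : 0 < eps.
Hypothesis ThV : forall w, `|w| < eps -> V (Th w).
Hypothesis rTh : regular_mx C [set w | `|w| < eps] Th.
Hypothesis Th0 : forall w, `|w| < eps -> usubmx w = 0 -> Th w = dsubmx w.
Hypothesis Thd : forall w, `|w| < eps -> 'D_dt Th w = field (Th w).

Let oE := @open_norm0 R 'cV[R]_(1 + N) eps.

Lemma leaf_derive w : `|w| < eps -> mx_derive Th w dt (field (Th w)).
Proof. by move=> we; rewrite -Thd //; exact: mx_derive_regular rTh we. Qed.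

Lemma leaf_init (z : 'cV[R]_N) : `|z| < eps -> Th (col_mx 0 z) = z.
Proof.
move=> ze; rewrite Th0 ?col_mxKu ?col_mxKd //; apply/col_mx_lt => //.
by rewrite normr0; have h := e0.
Qed.

Lemma leaf_param w : `|w| < eps -> dsubmx (Th w) = dsubmx (dsubmx w).
Proof.
move=> we; rewrite (@const_along_time R N eps _ _ (fun w => dsubmx (Th w))) //.
  by rewrite leaf_init //; exact: le_lt_trans (dsubmx_le w) we.
by move=> w' we'; have := mx_derive_dsub (leaf_derive we'); rewrite /field col_mxKd.
Qed.

Lemma leaf_base w : `|w| < eps ->
  dsubmx (usubmx (Th w)) = dsubmx (usubmx (dsubmx w)) + dsubmx (dsubmx w) *m usubmx w.
Proof.
move=> we; have := @const_along_time R N eps _ _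
  (fun w => dsubmx (usubmx (Th w)) - dsubmx (dsubmx w) *m usubmx w).
have H w' : `|w'| < eps -> mx_derive (fun w => dsubmx (usubmx (Th w)) - dsubmx (dsubmx w) *m usubmx w) w' dt 0.
  move=> we'.
  have d3 := mx_derive_mul (mx_derive_dsub (mx_derive_dsub (mx_derive_id w' dt)))
      (mx_derive_usub (mx_derive_id w' dt)).
  apply: mx_derive_eq (mx_derive_sub (mx_derive_dsub (mx_derive_usub (leaf_derive we'))) d3) _.
  rewrite dt_col col_mxKd col_mxKu linear0 mul0mx add0r mulmx1 /field col_mxKu /graph mul_col_mx mul1mx col_mxKd.
  by rewrite leaf_param // subrr.
move=> /(_ H w we) /=; rewrite col_mxKu mulmx0 subr0 leaf_init; last exact: le_lt_trans (dsubmx_le w) we.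
by move=> /eqP; rewrite subr_eq => /eqP.
Qed.

(** Varying the parameter y0 moves the end point of the leaf along the
    distribution: the transversal part of that variation satisfies a homogeneous
    linear equation in time, by the symmetry of the derivative of A. *)
Lemma leaf_variation (b : 'cV[R]_q) w : `|w| < eps ->
  usubmx ('D_(col_mx 0 (col_mx 0 b)) Th w) = graph (A (usubmx (Th w))) *m (b *m usubmx w).
Proof.
pose dl : 'cV[R]_(1 + N) := col_mx 0 (col_mx 0 b); pose E := 'D_dl Th.
have rE : regular_mx C [set w | `|w| < eps] E by exact: regular_mx_derive.
have dE w' : `|w'| < eps -> mx_derive Th w' dl (E w') by move=> we'; exact: mx_derive_regular rTh we'.
have Ed w' : `|w'| < eps -> dsubmx (E w') = b.
  move=> we'; have := mx_derive_dsub (mx_derive_dsub (mx_derive_id w' dl)).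
  move=> /(mx_derive_ext oE we' (fun y ye => esym (leaf_param ye))) /mx_derive_val.
  by rewrite (mx_derive_val (mx_derive_dsub (dE w' we'))) => ->; rewrite /dl !col_mxKd.
have Eb w' : `|w'| < eps -> dsubmx (usubmx (E w')) = b *m usubmx w'.
  move=> we'; have d3 := mx_derive_mul (mx_derive_dsub (mx_derive_dsub (mx_derive_id w' dl)))
      (mx_derive_usub (mx_derive_id w' dl)).
  have := mx_derive_add (mx_derive_dsub (mx_derive_usub (mx_derive_dsub (mx_derive_id w' dl)))) d3.
  move=> /(mx_derive_ext oE we' (fun y ye => esym (leaf_base ye))) /mx_derive_val.
  rewrite (mx_derive_val (mx_derive_dsub (mx_derive_usub (dE w' we')))) => ->.
  by rewrite /dl !col_mxKd !col_mxKu mulmx0 addr0 linear0 add0r.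
pose W w := usubmx (usubmx (E w)) - A (usubmx (Th w)) *m b *m usubmx w.
have EW w' : `|w'| < eps -> usubmx (E w') = col_mx (W w') 0 + graph (A (usubmx (Th w'))) *m (b *m usubmx w').
  move=> we'; rewrite -[LHS]vsubmxK Eb // /graph mul_col_mx mul1mx add_col_mx add0r /W.
  by rewrite mulmxA subrK.
suff W0 : forall w, `|w| < eps -> W w = 0 by move=> we; rewrite -/dl -/(E w) EW // W0 // col_mx0 add0r.
apply: (@linear_ode_unique R C N p eps W (fun w => jac rise (Th w) *m col_mx (col_mx 1%:M 0) 0)).
- apply: regular_mx_mul => //; last exact: regular_mx_cst.
  apply: (regular_mx_comp oE open_leaf_domain ThV _ rTh).
  by apply: regular_jac; [exact: open_leaf_domain | exact: regular_rise].
- move=> w' we'; have Vw := ThV we'; have [_ zr] := Vw.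
  have dT := leaf_derive we'.
  have dEt : mx_derive E w' dt ('D_dl ('D_dt Th) w').
    by rewrite (mx_schwarz _ _ oE we' rTh); exact: mx_derive_regular rE we'.
  have dr := mx_derive_rise Vw (dE w' we').
  have field_rise y : `|y| < eps -> 'D_dt Th y = col_mx (col_mx (rise (Th y)) (dsubmx (Th y))) 0.
    by move=> ye; rewrite Thd // /field /graph mul_col_mx mul1mx.
  have E2 := mx_derive_val (mx_derive_ext oE we' (fun y ye => esym (field_rise y ye))
    (mx_derive_col (mx_derive_col dr (mx_derive_dsub (dE w' we'))) (mx_derive_cst 0 w' dl))).
  have dZ := mx_derive_chain (mx_derive_usub dT) (regular_mx_diff zr rA).
  have dAb := mx_derive_mul (mx_derive_mul dZ (mx_derive_cst b w' dt)) (mx_derive_usub (mx_derive_id w' dt)).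
  apply: mx_derive_eq (mx_derive_sub (mx_derive_usub (mx_derive_usub dEt)) dAb) _.
  rewrite E2 !col_mxKu mulmx0 addr0 dt_col !col_mxKu mulmx1.
  have dA : differentiable A (usubmx (Th w')) by exact: regular_mx_diff zr rA.
  rewrite EW // deriveDv // Ed // mulmxDl.
  rewrite (@symA (usubmx (Th w')) (b *m usubmx w') (dsubmx (Th w')) zr).
  have -> : jac rise (Th w') *m col_mx (col_mx 1%:M 0) 0 *m W w' =
      'D_(col_mx (W w') 0) A (usubmx (Th w')) *m dsubmx (Th w').
    rewrite -mulmxA -jacE; last by apply: regular_mx_diff Vw regular_rise.
    rewrite !mul_col_mx !mul0mx mul1mx.
    have := mx_derive_rise (F := id) Vw (mx_derive_id (Th w') (col_mx (col_mx (W w') 0) 0)).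
    by move=> /mx_derive_val ->; rewrite col_mxKu col_mxKd mulmx0 addr0.
  rewrite mulmxA opprD addrACA; exact: add_cancel.
move=> xi xie.
pose w0 : 'cV[R]_(1 + N) := col_mx 0 xi.
have we' : `|w0| < eps.
  by apply/col_mx_lt; [exact: e0 | rewrite normr0; split => //; exact: e0].
have dP := mx_derive_col (mx_derive_cst (0 : 'cV[R]_1) w0 dl) (mx_derive_dsub (mx_derive_id w0 dl)).
have w0E : col_mx 0 (dsubmx w0) = w0 by rewrite /w0 col_mxKd.
have dTh : differentiable Th (col_mx 0 (dsubmx w0)).
  by rewrite w0E; exact: regular_mx_diff we' rTh.
have Pinit (y : 'cV[R]_(1 + N)) : `|y| < eps -> dsubmx y = Th (col_mx 0 (dsubmx y)).
  by move=> ye; rewrite leaf_init //; exact: le_lt_trans (dsubmx_le y) ye.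
have e1 := mx_derive_val (mx_derive_chain dP dTh).
have e2 := mx_derive_val (mx_derive_ext oE we' Pinit (mx_derive_dsub (mx_derive_id w0 dl))).
have E0 : E w0 = dsubmx dl.
  rewrite -e2 e1 w0E; congr ('D_ _ Th w0).
  by rewrite /dl col_mxKd.
by rewrite -/w0 /W E0 /dl col_mxKd !col_mxKu mulmx0 subr0 linear0.
Qed.

(** With y0 = 0 the field vanishes, and the leaf parametrisation is the identity. *)
Lemma leaf_centre w : `|w| < eps -> dsubmx (dsubmx w) = 0 -> usubmx (Th w) = usubmx (dsubmx w).
Proof.
move=> we w0; have h0 := e0.
pose P (w : 'cV[R]_(1 + N)) : 'cV[R]_(1 + N) := col_mx (usubmx w) (col_mx (usubmx (dsubmx w)) 0).
have Pe w' : `|w'| < eps -> `|P w'| < eps.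
  move=> we'; apply/col_mx_lt => //; split; first exact: le_lt_trans (usubmx_le w') we'.
  apply/col_mx_lt => //; rewrite normr0; split => //.
  exact: le_lt_trans (usubmx_le _) (le_lt_trans (dsubmx_le w') we').
have PE : P w = w by rewrite -[RHS]vsubmxK -[dsubmx w]vsubmxK w0 /P.
have := @const_along_time R N eps _ _ (fun w => Th (P w)) _ w we; rewrite PE => ->.
  rewrite /P col_mxKu col_mxKd leaf_init ?col_mxKu //.
  apply/col_mx_lt => //; rewrite normr0; split => //.
  exact: le_lt_trans (usubmx_le _) (le_lt_trans (dsubmx_le w) we).
move=> w' we'.
have dP := mx_derive_col (mx_derive_usub (mx_derive_id w' dt))
  (mx_derive_col (mx_derive_usub (mx_derive_dsub (mx_derive_id w' dt))) (mx_derive_cst (0 : 'cV[R]_q) w' dt)).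
have Edt (t := dt : 'cV[R]_(1 + N)) : col_mx (usubmx t) (col_mx (usubmx (dsubmx t)) 0) = t.
  by rewrite /t dt_col col_mxKu col_mxKd linear0 col_mx0.
rewrite Edt in dP.
apply: mx_derive_eq (mx_derive_chain dP (regular_mx_diff (Pe w' we') rTh)) _.
by rewrite Thd ?Pe // /field leaf_param ?Pe // !col_mxKd mulmx0 col_mx0.
Qed.

End Leaves.

(** Composed with the inverse of the leaf parametrisation, the projection to the
    initial point is constant on the leaves. *)
Lemma straighten (r00 : 0 < r0) (A0 : A 0 = 0) :
  exists r (f : 'cV[R]_(p + q) -> 'cV[R]_p), [/\ 0 < r,
    regular_mx C [set z | `|z| < r] f, jac f 0 = row_mx 1%:M 0 &
    forall z : 'cV[R]_(p + q), `|z| < r -> `|z| < r0 /\ jac f z *m graph (A z) = 0].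
Proof.
have oV := open_leaf_domain; have V0 : V 0 by split => //; rewrite linear0 normr0.
have [eps [Th [e0 ThV rTh Th0 Thd]]] := flow oV V0 regular_field.
have oE := @open_norm0 R 'cV[R]_(1 + N) eps.
have [tau tau0 taue] : exists2 tau : R, 0 < tau & tau < eps by exists (eps / 2); lra.
pose Gm (z : 'cV[R]_(p + q)) : 'cV[R]_(1 + N) :=
  col_mx (tau%:M) (col_mx (col_mx (usubmx z) 0) (tau^-1%:M *m dsubmx z)).
pose rho := Num.min eps (tau * eps).
have rho0 : 0 < rho by rewrite lt_min e0 mulr_gt0.
pose B := [set z : 'cV[R]_(p + q) | `|z| < rho].
have oB : open B by exact: open_norm0.
have B0 : B 0 by rewrite /B /= normr0.
have Gme z : B z -> `|Gm z| < eps.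
  rewrite /B /= lt_min => /andP[z1 z2]; apply/col_mx_lt => //; split.
    by apply/col_norm_ltP => // i; rewrite mxE (ord1 i) eqxx gtr0_norm.
  apply/col_mx_lt => //; split.
    apply/col_mx_lt => //; rewrite normr0; split => //; exact: le_lt_trans (usubmx_le z) z1.
  rewrite mul_scalar_mx normrZ gtr0_norm ?invr_gt0 // ltr_pdivrMl //.
  exact: le_lt_trans (dsubmx_le z) z2.
have dGm z v : mx_derive Gm z v (col_mx 0 (col_mx (col_mx (usubmx v) 0) (tau^-1%:M *m dsubmx v))).
  apply: mx_derive_col; first exact: mx_derive_cst.
  apply: mx_derive_col.
    by apply: mx_derive_col; [exact: mx_derive_usub (mx_derive_id z v) | exact: mx_derive_cst].
  have := mx_derive_mul (mx_derive_cst (tau^-1%:M : 'M[R]_q) z v) (mx_derive_dsub (mx_derive_id z v)).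
  by rewrite mul0mx add0r.
have rGm : regular_mx C B Gm.
  have rid := @regular_mx_id R C (p + q) B.
  apply: regular_col_mx => //; first exact: regular_mx_cst.
  apply: regular_col_mx => //.
    by apply: regular_col_mx => //; [exact: regular_usubmx | exact: regular_mx_cst].
  by apply: regular_mx_mul => //; [exact: regular_mx_cst | exact: regular_dsubmx].
pose Phi z := usubmx (Th (Gm z)).
have rPhi : regular_mx C B Phi.
  by apply: regular_usubmx => //; exact: (regular_mx_comp oB oE Gme rTh rGm).
have dPhi z v : B z -> mx_derive Phi z v
    (usubmx ('D_(col_mx 0 (col_mx (col_mx (usubmx v) 0) (tau^-1%:M *m dsubmx v))) Th (Gm z))).
  move=> Bz; apply: mx_derive_usub; exact: mx_derive_chain (dGm z v) (regular_mx_diff (Gme z Bz) rTh).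
have Phi_axis (z : 'cV[R]_(p + q)) : B z -> dsubmx z = 0 -> Phi z = z.
  move=> Bz z0; rewrite /Phi (leaf_centre e0 rTh Th0 Thd (Gme z Bz)); last first.
    by rewrite /Gm !col_mxKd z0 mulmx0.
  by rewrite /Gm col_mxKd col_mxKu -z0 vsubmxK.
have vert z : B z -> jac Phi z *m col_mx 0 1%:M = graph (A (Phi z)).
  move=> Bz; apply: mulmx_ext => c; rewrite -mulmxA mul_col_mx mul0mx mul1mx.
  rewrite -jacE; last exact: (dPhi z 0 Bz).1.
  rewrite (mx_derive_val (dPhi z _ Bz)) col_mxKu col_mxKd col_mx0.
  rewrite (leaf_variation e0 ThV rTh Th0 Thd _ (Gme z Bz)) {2}/Gm col_mxKu; congr (_ *m _).
  by rewrite mul_mx_scalar mul_scalar_mx scalerA mulfV ?gt_eqF // scale1r.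
have Phi0 : Phi 0 = 0 by apply: Phi_axis; rewrite ?linear0.
(* Phi fixes the points (x, 0), and moves the origin along the graph of A 0 = 0
   in the remaining directions. *)
have jPhi0 : jac Phi 0 = 1%:M.
  have H1 : jac Phi 0 *m col_mx 1%:M 0 = col_mx 1%:M 0.
    apply: mulmx_ext => h; rewrite -mulmxA mul_col_mx mul1mx mul0mx.
    have dP0 : differentiable Phi (0 : 'cV[R]_(p + q)) by exact: (dPhi 0 0 B0).1.
    have Pe (z : 'cV[R]_(p + q)) : B z -> B (col_mx (usubmx z) 0).
      move=> Bz; apply/col_mx_lt => //; rewrite normr0; split => //; exact: le_lt_trans (usubmx_le z) Bz.
    have Pax (z : 'cV[R]_(p + q)) : B z -> col_mx (usubmx z) 0 = Phi (col_mx (usubmx z) 0).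
      by move=> Bz; rewrite Phi_axis ?col_mxKd //; exact: Pe.
    pose v : 'cV[R]_(p + q) := col_mx h 0.
    have P00 : col_mx (usubmx (0 : 'cV[R]_(p + q))) 0 = 0 :> 'cV[R]_(p + q) by rewrite linear0 col_mx0.
    have Pv : col_mx (usubmx v) 0 = v by rewrite /v col_mxKu.
    have dP := mx_derive_eq (mx_derive_col (mx_derive_usub (mx_derive_id (0 : 'cV[R]_(p + q)) v))
      (mx_derive_cst (0 : 'cV[R]_q) 0 v)) Pv.
    have e1 := mx_derive_val (mx_derive_chain_at (G := fun z : 'cV[R]_(p + q) => col_mx (usubmx z) 0) P00 dP dP0).
    have e2 := mx_derive_val (mx_derive_ext oB B0 Pax dP).
    exact: etrans (esym (jacE v dP0)) (etrans (esym e1) e2).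
  have H2 := vert 0 B0; rewrite Phi0 A0 /graph in H2.
  rewrite -[LHS]mulmx1 (_ : 1%:M = row_mx (col_mx 1%:M 0) (col_mx 0 1%:M)); last first.
    by rewrite -block_mxEh -scalar_mx_block.
  by rewrite mul_mx_row H1 H2.
have uPhi : jac Phi 0 \in unitmx by rewrite jPhi0 unitmx1.
have [r [g [rr rg g0 Hg]]] := right_inverse oB B0 rPhi uPhi.
rewrite Phi0 in rg g0 Hg.
have {}Hg (y : 'cV[R]_(p + q)) : `|y| < r -> B (g y) /\ Phi (g y) = y.
  by move=> yr; apply: Hg; rewrite subr0.
have {}rg : regular_mx C [set y | `|y| < r] g.
  by apply: regular_mx_sub rg => y /= yr; rewrite subr0.
have or := @open_norm0 R 'cV[R]_(p + q) r.
have jg (y : 'cV[R]_(p + q)) : `|y| < r -> jac g y *m jac Phi (g y) = 1%:M.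
  move=> yr; have [By gy] := Hg y yr; apply: mulmx1C.
  have dP := regular_mx_diff By rPhi; have dg := regular_mx_diff (U := [set y | `|y| < r]) yr rg.
  apply: etrans (esym (jac_comp dg dP)) _; apply: jac_of => v; rewrite mul1mx.
  apply: (mx_derive_ext or yr _ (mx_derive_id y v)) => z zr; exact/esym/(Hg z zr).2.
have jf (y : 'cV[R]_(p + q)) : `|y| < r -> jac (fun y => usubmx (g y)) y = usubmx (jac g y).
  move=> yr; apply: jac_of => v; rewrite mul_usub_mx.
  exact: mx_derive_usub (mx_derive_jac v rg yr).
exists r, (fun y => usubmx (g y)); split => //.
- exact: regular_usubmx.
- have h0 : `|0 : 'cV[R]_(p + q)| < r by rewrite normr0.
  rewrite jf //; have := jg 0 h0; rewrite g0 jPhi0 mulmx1 => ->.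
  by rewrite (@scalar_mx_block R p q) block_mxEv col_mxKu.
move=> y yr; have [By gy] := Hg y yr; split.
  by have [_] := ThV _ (Gme _ By); rewrite -/(Phi (g y)) gy.
rewrite jf // -{2}gy -vert // mul_usub_mx mulmxA jg // mul1mx col_mxKu //.
Qed.

End Frobenius.

Lemma torsion_conj (R : realType) n m (Q : 'M[R]_(n, m)) (Qi : 'M[R]_(m, n)) (L D1 D2 D3 D4 : 'M[R]_n)
    (a b : 'cV[R]_m) : Q *m Qi = 1%:M ->
  Qi *m D1 *m Q *m b - Qi *m D2 *m Q *m a + Qi *m L *m Q *m (Qi *m D3 *m Q *m a)
    - Qi *m L *m Q *m (Qi *m D4 *m Q *m b) =
  Qi *m (D1 *m (Q *m b) - D2 *m (Q *m a) + L *m (D3 *m (Q *m a)) - L *m (D4 *m (Q *m b))).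
Proof.
move=> QQi; have K2 (D : 'M[R]_n) (v : 'cV[R]_m) :
    Qi *m L *m Q *m (Qi *m D *m Q *m v) = Qi *m (L *m (D *m (Q *m v))).
  by rewrite -!mulmxA (mulmxA Q) QQi mul1mx.
by rewrite !K2 (mulmxBr Qi) (mulmxDr Qi) (mulmxBr Qi) !mulmxA.
Qed.

Lemma torsion_form_affine (R : realType) C n m (U : set 'cV[R]_n) (L : 'cV[R]_n -> 'M[R]_n) x0
    (Q : 'M[R]_(n, m)) (Qi : 'M[R]_(m, n)) z :
  Q *m Qi = 1%:M -> open U -> regular_mx C U L -> U (x0 + Q *m z) ->
  (forall a b, torsion_form L (x0 + Q *m z) a b = 0) ->
  forall a b, torsion_form (fun z => Qi *m L (x0 + Q *m z) *m Q) z a b = 0.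
Proof.
move=> QQi oU rL Uz tor a b.
have dK v : mx_derive (fun z => Qi *m L (x0 + Q *m z) *m Q) z v (Qi *m 'D_(Q *m v) L (x0 + Q *m z) *m Q).
  have d1 := mx_derive_add (mx_derive_cst x0 z v) (mx_derive_mul (mx_derive_cst Q z v) (mx_derive_id z v)).
  rewrite mul0mx !add0r in d1.
  have d2 := mx_derive_chain d1 (regular_mx_diff Uz rL).
  have clean (X Y : 'M[R]_n) (Z : 'M[R]_(m, n)) : (0 *m X + Qi *m Y) *m Q + Z *m 0 = Qi *m Y *m Q.
    by rewrite mul0mx add0r mulmx0 addr0.
  exact: mx_derive_eq (mx_derive_mul (mx_derive_mul (mx_derive_cst Qi z v) d2) (mx_derive_cst Q z v)) (clean _ _ _).
have K (v : 'cV[R]_m) : Q *m (Qi *m L (x0 + Q *m z) *m Q *m v) = L (x0 + Q *m z) *m (Q *m v).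
  by rewrite !mulmxA QQi mul1mx.
rewrite /torsion_form !(mx_derive_val (dK _)) !K.
apply: etrans (torsion_conj _ _ _ _ _ _ _ QQi) _.
by have := tor (Q *m a) (Q *m b); rewrite /torsion_form => ->; rewrite mulmx0.
Qed.

(** A generalised eigenspace decomposition of L x0 yields functions whose
    differentials span an L-invariant codistribution, on which L acts by the
    first block at x0. *)
Lemma first_integrals (R : realType) (C : category) n p q (U : set 'cV[R]_n) (L : 'cV[R]_n -> 'M[R]_n) x0
    (Q : 'M[R]_(n, p + q)) (Qi : 'M[R]_(p + q, n)) (A1 : 'M[R]_p) (A2 : 'M[R]_q) :
  open U -> U x0 -> regular_mx C U L -> (forall x, U x -> forall a b, torsion_form L x a b = 0) ->
  Q *m Qi = 1%:M -> Qi *m Q = 1%:M -> Qi *m L x0 *m Q = block_mx A1 0 0 A2 ->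
  sylvester A1 A2 \in unitmx ->
  exists r (f : 'cV[R]_n -> 'cV[R]_p), [/\ 0 < r,
    regular_mx C [set x | `|x - x0| < r] f, jac f x0 *m Q = row_mx 1%:M 0 &
    forall x, `|x - x0| < r -> exists M, jac f x *m L x = M *m jac f x].
Proof.
move=> oU Ux0 rL tor QQi QiQ L0 uS.
pose K z := Qi *m L (x0 + Q *m z) *m Q.
pose U1 : set 'cV[R]_(p + q) := [set z | setT z /\ U (x0 + Q *m z)].
have raff (S : set 'cV[R]_(p + q)) : open S -> regular_mx C S (fun z => x0 + Q *m z).
  move=> oS; apply: regular_mx_add => //; first exact: regular_mx_cst.
  by apply: regular_mx_mul => //; [exact: regular_mx_cst | exact: regular_mx_id].
have oU1 : open U1.
  apply: (@open_preimage R C (p + q) n 1 setT (fun z => x0 + Q *m z) U) => //; first exact: openT.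
  exact: raff openT.
have U10 : U1 0 by split => //; rewrite mulmx0 addr0.
have rK : regular_mx C U1 K.
  apply: regular_mx_mul => //; last exact: regular_mx_cst.
  apply: regular_mx_mul => //; first exact: regular_mx_cst.
  by apply: (regular_mx_comp oU1 oU _ rL (raff _ oU1)) => z [].
have K0 : K 0 = block_mx A1 0 0 A2 by rewrite /K mulmx0 addr0.
have [r0 [A [r00 rU rA A0 HA]]] := invariant_graph oU1 U10 rK K0 uS.
have oB := @open_norm0 R 'cV[R]_(p + q) r0.
have symA (z : 'cV[R]_(p + q)) (b c : 'cV[R]_q) : `|z| < r0 ->
    'D_(graph (A z) *m b) A z *m c = 'D_(graph (A z) *m c) A z *m b.
  move=> zr; have [_ Uz] := rU z zr.
  apply: (@graph_integrable R C p q [set z | `|z| < r0] K A z b c oB zr _ rA _ (HA z zr).2).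
  - by apply: regular_mx_sub rK => y yr; exact: rU.
  - by move=> y yr; exact: (HA y yr).1.
  exact: (torsion_form_affine QQi oU rL Uz (tor _ Uz)).
have [r [f [rr rf f0 Hf]]] := straighten rA symA r00 A0.
have or := @open_norm0 R 'cV[R]_(p + q) r.
have S (d : 'M[R]_(p, p + q)) z : riccati (K z) (A z) = 0 -> d *m graph (A z) = 0 ->
    lsubmx d \in unitmx -> exists M, d *m K z = M *m d.
  move=> ric; rewrite -[d]hsubmxK row_mxKl; set d1 := lsubmx d; set d2 := rsubmx d => E u1.
  have dE : row_mx d1 d2 = d1 *m cograph (A z).
    rewrite /cograph mul_mx_row mulmx1 mulmxN; congr row_mx.
    by move: E; rewrite /graph mul_row_col mulmx1 => /eqP; rewrite addrC addr_eq0 => /eqP.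
  exists (d1 *m cograph_op (K z) (A z) *m invmx d1).
  by rewrite dE -mulmxA (riccati_cograph ric) !mulmxA mulmxKV.
have rl : regular_mx C [set z | `|z| < r] (fun z => lsubmx (jac f z)).
  by apply: regular_lsubmx => //; exact: regular_jac.
have oS := open_unitmx or rl.
have S0 : [set z : 'cV[R]_(p + q) | [set z | `|z| < r] z /\ lsubmx (jac f z) \in unitmx] 0.
  by split; rewrite /= ?normr0 // f0 row_mxKl unitmx1.
have [d d0 Hd] := open_dist oS S0.
pose h (x : 'cV[R]_n) := Qi *m (x - x0).
have rh (S' : set 'cV[R]_n) : open S' -> regular_mx C S' h.
  move=> oS'; apply: regular_mx_mul => //; first exact: regular_mx_cst.
  by apply: regular_mx_sub_op => //; [exact: regular_mx_id | exact: regular_mx_cst].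
have h0 : h x0 = 0 by rewrite /h subrr mulmx0.
pose W := [set x : 'cV[R]_n | setT x /\ [set z : 'cV[R]_(p + q) | `|z - 0| < d] (h x)].
have oW : open W.
  apply: (@open_preimage R C n (p + q) 1 setT h [set z | `|z - 0| < d]); first exact: openT.
    exact: rh openT.
  exact: open_norm.
have W0 : W x0 by split => //; rewrite /= h0 subrr normr0.
have [r1 r10 Hr1] := open_dist oW W0.
have oR := @open_norm R 'cV[R]_n x0 r1.
have hd x : `|x - x0| < r1 -> `|h x| < r /\ lsubmx (jac f (h x)) \in unitmx.
  by move=> /Hr1[_ /Hd].
have rfh : regular_mx C [set x | `|x - x0| < r1] (fun x => f (h x)).
  apply: (regular_mx_comp oR or _ rf (rh _ oR)) => x /hd[] //.
have jfh x : `|x - x0| < r1 -> jac (fun x => f (h x)) x = jac f (h x) *m Qi.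
  move=> /hd[hr _]; apply: jac_of => v.
  have d1 := mx_derive_mul (mx_derive_cst Qi x v) (mx_derive_sub (mx_derive_id x v) (mx_derive_cst x0 x v)).
  rewrite mul0mx add0r subr0 in d1.
  apply: mx_derive_eq (mx_derive_chain d1 (regular_mx_diff hr rf)) _.
  by rewrite jacE ?mulmxA //; exact: regular_mx_diff hr rf.
exists r1, (fun x => f (h x)); split => //.
  by rewrite jfh ?subrr ?normr0 // h0 f0 -mulmxA QiQ mulmx1.
move=> x xr; have [hr ul] := hd x xr; have [hr0 jg] := Hf _ hr.
have [M HM] := S _ _ (HA _ hr0).1 jg ul.
have hx : x0 + Q *m h x = x by rewrite /h mulmxA QQi mul1mx addrC subrK.
exists M; rewrite jfh // mulmxA -HM /K hx -!mulmxA QQi mulmx1 //.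
Qed.

(** * Pointwise equations for the torsion and the unity *)

Section PointwiseForms.
Context {R : realType} {n : nat}.
Implicit Types (L : 'cV[R]_n -> 'M[R]_n) (xi eta e : 'cV[R]_n -> 'cV[R]_n).

Definition unity_form L e (x : 'cV[R]_n) : 'M[R]_n :=
  'D_(e x) L x - jac e x *m L x + L x *m jac e x.

Lemma bracketE xi eta x : differentiable xi x -> differentiable eta x ->
  bracket xi eta x = 'D_(xi x) eta x - 'D_(eta x) xi x.
Proof. by move=> d1 d2; rewrite /bracket !deriveE. Qed.

Lemma torsion_cancel (l : 'M[R]_n) (p1 p2 p3 p4 y1 y2 x1 x2 : 'cV[R]_n) :
  (p1 + l *m y1 - (p2 + l *m x1)) + l *m (l *m (y2 - x2)) - l *m (y1 - (p3 + l *m x2))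
    - l *m (p4 + l *m y2 - x1) = p1 - p2 + l *m p3 - l *m p4.
Proof.
rewrite !(mulmxBr, mulmxDr); move: (l *m (l *m _)) (l *m (l *m _)) => z1 z2.
by move: (l *m y1) (l *m x1) (l *m p3) (l *m p4) => z3 z4 z5 z6; apply/colP => i; rewrite !mxE; ring.
Qed.

(** The derivatives of xi and eta cancel, because the torsion is a tensor. *)
Lemma torsionE C U L xi eta x : U x -> regular_mx C U L ->
  regular_mx C U xi -> regular_mx C U eta ->
  torsion L xi eta x = torsion_form L x (xi x) (eta x).
Proof.
move=> Ux rL rxi reta.
have dL v := mx_derive_regular v rL Ux.
have dxi v := mx_derive_regular v rxi Ux; have deta v := mx_derive_regular v reta Ux.
have dLxi v := mx_derive_mul (dL v) (dxi v); have dLeta v := mx_derive_mul (dL v) (deta v).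
rewrite /torsion /app /= !bracketE; try exact: (dL 0).1; try exact: (dxi 0).1; try exact: (deta 0).1;
  try exact: (dLxi 0).1; try exact: (dLeta 0).1.
rewrite !(mx_derive_val (dLxi _)) !(mx_derive_val (dLeta _)).
exact: torsion_cancel.
Qed.

Lemma lie_opE C U L e xi x : U x -> regular_mx C U L ->
  regular_mx C U e -> regular_mx C U xi ->
  lie_op e L xi x = unity_form L e x *m xi x.
Proof.
move=> Ux rL re rxi.
have dL v := mx_derive_regular v rL Ux.
have dxi v := mx_derive_regular v rxi Ux; have de v := mx_derive_regular v re Ux.
have dLxi v := mx_derive_mul (dL v) (dxi v).
rewrite /lie_op /app /= !bracketE; try exact: (dL 0).1; try exact: (dxi 0).1; try exact: (de 0).1;
  try exact: (dLxi 0).1.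
rewrite (mx_derive_val (dLxi _)) !(jacE _ (de 0).1) /unity_form mulmxDl mulmxBl mulmxBr -!mulmxA.
move: ('D_(e x) L x *m _) (L x *m 'D_(e x) xi x) (jac e x *m _) (L x *m (jac e x *m _)) => z1 z2 z3 z4.
by apply/colP => i; rewrite !mxE; ring.
Qed.

Lemma nijenhuis_pointwise C U L : open U -> regular_mx C U L ->
  nijenhuis_on C U L <-> (forall x, U x -> forall a b, torsion_form L x a b = 0).
Proof.
move=> oU rL; split=> [[_ H] x Ux a b|H].
  have ra := @regular_mx_cst R C n U _ _ a; have rb := @regular_mx_cst R C n U _ _ b.
  by have := H _ _ ra rb x Ux; rewrite (torsionE Ux rL ra rb).
by split=> // xi eta rxi reta x Ux; rewrite (torsionE Ux rL rxi reta) H.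
Qed.

Lemma unity_pointwise C U L e : open U -> regular_mx C U L -> regular_mx C U e ->
  unity_on C U L e <-> (forall x, U x -> unity_form L e x = 1%:M).
Proof.
move=> oU rL re; split=> [[_ H] x Ux|H].
  apply: mulmx_ext => a; have ra := @regular_mx_cst R C n U _ _ a.
  by have := H _ ra x Ux; rewrite (lie_opE Ux rL re ra) mul1mx.
by split=> // xi rxi x Ux; rewrite (lie_opE Ux rL re rxi) H // mul1mx.
Qed.

End PointwiseForms.

(** The two families of first integrals, one for each factor of the
    characteristic polynomial, are coordinates in which L is block diagonal. *)
Lemma splitting_map (R : realType) (C : category) m1 m2 (U : set 'cV[R]_(m1 + m2))
    (L : 'cV[R]_(m1 + m2) -> 'M[R]_(m1 + m2)) x0 (Q : 'M[R]_(m1 + m2)) (A1 : 'M[R]_m1) (A2 : 'M[R]_m2) :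
  open U -> U x0 -> regular_mx C U L -> (forall x, U x -> forall a b, torsion_form L x a b = 0) ->
  Q \in unitmx -> invmx Q *m L x0 *m Q = block_mx A1 0 0 A2 ->
  sylvester A1 A2 \in unitmx -> sylvester A2 A1 \in unitmx ->
  exists (V : set 'cV[R]_(m1 + m2)) (psi : 'cV[R]_(m1 + m2) -> 'cV[R]_(m1 + m2)), [/\ open V /\ V x0, V `<=` U,
    regular_mx C V psi, jac psi x0 = invmx Q &
    forall x, V x -> exists M1 M2, jac psi x *m L x = block_mx M1 0 0 M2 *m jac psi x].
Proof.
move=> oU Ux0 rL tor uQ L0 uS1 uS2.
have QQi : Q *m invmx Q = 1%:M by rewrite mulmxV.
have QiQ : invmx Q *m Q = 1%:M by rewrite mulVmx.
have [r1 [f1 [r10 rf1 j1 H1]]] := first_integrals oU Ux0 rL tor QQi QiQ L0 uS1.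
pose Q' : 'M[R]_(m1 + m2, m2 + m1) := row_mx (rsubmx Q) (lsubmx Q).
pose Qi' : 'M[R]_(m2 + m1, m1 + m2) := col_mx (dsubmx (invmx Q)) (usubmx (invmx Q)).
have QQi' : Q' *m Qi' = 1%:M.
  by rewrite /Q' /Qi' mul_row_col addrC -mul_row_col hsubmxK vsubmxK.
have blocks (X : 'M[R]_(m1 + m2)) : Qi' *m X *m Q' =
    block_mx (drsubmx (invmx Q *m X *m Q)) (dlsubmx (invmx Q *m X *m Q))
      (ursubmx (invmx Q *m X *m Q)) (ulsubmx (invmx Q *m X *m Q)).
  rewrite /Qi' /Q' mul_col_mx mul_col_mx !mul_mx_row -block_mxEv.
  by rewrite /drsubmx /dlsubmx /ursubmx /ulsubmx !(mulmx_rsub, mulmx_lsub) !(mul_usub_mx, mul_dsub_mx).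
have QiQ' : Qi' *m Q' = 1%:M.
  have := blocks 1%:M; rewrite !mulmx1 QiQ => ->.
  by rewrite (@scalar_mx_block R m1 m2) block_mxKul block_mxKur block_mxKdl block_mxKdr -scalar_mx_block.
have L0' : Qi' *m L x0 *m Q' = block_mx A2 0 0 A1.
  by rewrite blocks L0 block_mxKul block_mxKur block_mxKdl block_mxKdr.
have [r2 [f2 [r20 rf2 j2 H2]]] := first_integrals oU Ux0 rL tor QQi' QiQ' L0' uS2.
pose B r := [set x : 'cV[R]_(m1 + m2) | `|x - x0| < r].
pose V := U `&` (B r1 `&` B r2).
have oV : open V by apply: openI => //; apply: openI; exact: open_norm.
have Vx0 : V x0 by split=> //; split; rewrite /B /= subrr normr0.
pose psi x := col_mx (f1 x) (f2 x).
have rf1' : regular_mx C V f1 by apply: regular_mx_sub rf1 => x [_ []].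
have rf2' : regular_mx C V f2 by apply: regular_mx_sub rf2 => x [_ []].
have jpsi x : V x -> jac psi x = col_mx (jac f1 x) (jac f2 x).
  move=> Vx; apply: jac_of => v; rewrite mul_col_mx.
  by apply: mx_derive_col; [exact: mx_derive_jac rf1' Vx | exact: mx_derive_jac rf2' Vx].
exists V, psi; split => //.
- by move=> x [].
- exact: regular_col_mx.
- have j2' : jac f2 x0 *m Q = row_mx 0 1%:M.
    move: j2; rewrite /Q' mul_mx_row => /eq_row_mx[e1 e2].
    by rewrite -[Q]hsubmxK mul_mx_row e1 e2.
  rewrite jpsi // -[LHS]mulmx1 -QQi mulmxA mul_col_mx j1 j2'.
  by rewrite -block_mxEv -scalar_mx_block mul1mx.
move=> x Vx; have [_ [x1 x2]] := Vx.
have [M1 e1] := H1 x x1; have [M2 e2] := H2 x x2; exists M1, M2.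
by rewrite jpsi // mul_col_mx mul_block_col !mul0mx addr0 add0r e1 e2.
Qed.

Lemma norm_segment (R : realType) (V : normedModType R) (c x y : V) (r t : R) :
  `|x - c| < r -> `|y - c| < r -> 0 <= t <= 1 -> `|x + t *: (y - x) - c| < r.
Proof.
move=> xr yr t01; have := @ball_line R V c x (y - x) r t.
rewrite -ball_normE /= (addrC x (y - x)) subrK distrC (distrC c y) (distrC c (x + _)).
by apply.
Qed.

Lemma const_on_ball (R : realType) n p q (c : 'cV[R]_n) (rho : R) (F : 'cV[R]_n -> 'M[R]_(p, q))
    (x y : 'cV[R]_n) : `|x - c| < rho -> `|y - c| < rho ->
  (forall z : 'cV[R]_n, `|z - c| < rho -> mx_derive F z (y - x) 0) -> F x = F y.
Proof.
move=> Bx By H; apply/matrixP => i j.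
have df t : 0 <= t <= 1 -> derivable (fun z => F z i j) (x + t *: (y - x)) (y - x).
  move=> t01; apply: diff_derivable; have [dF _] := H _ (norm_segment Bx By t01).
  exact: (differentiable_mxP F _).1.
have [t /andP[t0 t1]] := mvt_line df; have t01 : 0 <= t <= 1 by rewrite (ltW t0) (ltW t1).
have [dF E] := H _ (norm_segment Bx By t01); rewrite -derive_mxE // E mxE.
by rewrite (addrC x) subrK => /eqP; rewrite subr_eq0 => /eqP.
Qed.

(** The torsion evaluated on one vector of each factor: the variation of a block
    in the variables of the other factor lies in the kernel of a Sylvester operator. *)
Lemma block_torsion (R : realType) m1 m2 (b1 : 'M[R]_m1) (b2 : 'M[R]_m2)
    (D1 : 'cV[R]_(m1 + m2) -> 'M[R]_m1) (D2 : 'cV[R]_(m1 + m2) -> 'M[R]_m2)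
    (l : 'M[R]_(m1 + m2)) (D : 'cV[R]_(m1 + m2) -> 'M[R]_(m1 + m2)) :
  sylvester b1 b2 \in unitmx -> sylvester b2 b1 \in unitmx ->
  l = block_mx b1 0 0 b2 -> (forall v, D v = block_mx (D1 v) 0 0 (D2 v)) ->
  (forall a u v, D1 (a *: u + v) = a *: D1 u + D1 v) ->
  (forall a u v, D2 (a *: u + v) = a *: D2 u + D2 v) ->
  (forall a b : 'cV[R]_(m1 + m2),
     D (l *m a) *m b - D (l *m b) *m a + l *m (D b *m a) - l *m (D a *m b) = 0) ->
  (forall v2, D1 (col_mx 0 v2) = 0) /\ (forall v1, D2 (col_mx v1 0) = 0).
Proof.
move=> uS1 uS2 lE DE lD1 lD2 tor.
have l1 v1 : l *m col_mx v1 0 = col_mx (b1 *m v1) 0.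
  by rewrite lE mul_block_col !mul0mx !mulmx0 !addr0.
have l2 v2 : l *m col_mx 0 v2 = col_mx 0 (b2 *m v2).
  by rewrite lE mul_block_col !mul0mx !mulmx0 !add0r.
have d1 w v1 : D w *m col_mx v1 0 = col_mx (D1 w *m v1) 0.
  by rewrite DE mul_block_col !mul0mx !mulmx0 !addr0.
have d2 w v2 : D w *m col_mx 0 v2 = col_mx 0 (D2 w *m v2).
  by rewrite DE mul_block_col !mul0mx !mulmx0 !add0r.
have key v1 v2 : b1 *m (D1 (col_mx 0 v2) *m v1) = D1 (col_mx 0 (b2 *m v2)) *m v1 /\
    b2 *m (D2 (col_mx v1 0) *m v2) = D2 (col_mx (b1 *m v1) 0) *m v2.
  have := tor (col_mx 0 v2) (col_mx v1 0); rewrite l1 l2 !d1 !d2 l1 l2.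
  rewrite !opp_col_mx !add_col_mx !oppr0 !addr0 !add0r -[0 in RHS](col_mx0 R m1 m2 1) => /eq_col_mx[e1 e2].
  split; apply/eqP; first by rewrite eq_sym -subr_eq0 e1.
  by rewrite -subr_eq0 addrC e2.
have z0 m : (0 : 'cV[R]_m) = 0 *: 0 + 0 by rewrite scaler0 addr0.
split=> v; apply: mulmx_ext => u; rewrite mul0mx.
  apply: (sylvester_linear (f := fun v2 => D1 (col_mx 0 v2) *m u) uS1) => [a w w'|w].
    have -> : col_mx 0 (a *: w + w') = a *: col_mx 0 w + col_mx 0 w' :> 'cV[R]_(m1 + m2).
      by rewrite scale_col_mx scaler0 add_col_mx addr0.
    by rewrite lD1 mulmxDl -scalemxAl.
  exact: (key u w).1.
apply: (sylvester_linear (f := fun v1 => D2 (col_mx v1 0) *m u) uS2) => [a w w'|w].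
  have -> : col_mx (a *: w + w') 0 = a *: col_mx w 0 + col_mx w' 0 :> 'cV[R]_(m1 + m2).
    by rewrite scale_col_mx scaler0 add_col_mx addr0.
  by rewrite lD2 mulmxDl -scalemxAl.
exact: (key w u).2.
Qed.

Lemma block_unity (R : realType) m1 m2 (b1 d1 : 'M[R]_m1) (b2 d2 : 'M[R]_m2) (J : 'M[R]_(m1 + m2))
    (l := block_mx b1 0 0 b2) :
  sylvester b1 b2 \in unitmx -> sylvester b2 b1 \in unitmx ->
  block_mx d1 0 0 d2 - J *m l + l *m J = 1%:M -> ursubmx J = 0 /\ dlsubmx J = 0.
Proof.
move=> uS1 uS2; rewrite -{1 2}[J]submxK /l !mulmx_block !mul0mx !mulmx0 !addr0 !add0r.
rewrite opp_block_mx !add_block_mx !add0r (@scalar_mx_block R m1 m2) => /eq_block_mx[_ e1 e2 _].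
split; first by apply: (sylvester_inj uS1); apply/eqP; rewrite -subr_eq0 addrC e1.
by apply: (sylvester_inj uS2); apply/eqP; rewrite -subr_eq0 addrC e2.
Qed.

(** Derivatives along the slice s0 + im S commute with the compression
    X |-> P X S, and im S and ker P are invariant under L; hence the torsion and
    the unity equation are compressed as well, provided that the component of e
    transversal to the slice does not change P L S. *)
Lemma slice_fields (R : realType) (C : category) n k (S : 'M[R]_(n, k)) (P : 'M[R]_(k, n)) (s0 : 'cV[R]_n)
    (U : set 'cV[R]_n) (V : set 'cV[R]_k) (L : 'cV[R]_n -> 'M[R]_n) (e : 'cV[R]_n -> 'cV[R]_n) :
  open U -> open V -> (forall u, V u -> U (s0 + S *m u)) -> P *m S = 1%:M ->
  nijenhuis_on C U L -> unity_on C U L e ->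
  (forall x, U x -> L x *m S = S *m (P *m L x *m S)) ->
  (forall x, U x -> P *m L x = P *m L x *m S *m P) ->
  (forall x, U x -> P *m 'D_(e x) L x *m S = P *m 'D_(S *m (P *m e x)) L x *m S) ->
  nijenhuis_on C V (fun u => P *m L (s0 + S *m u) *m S) /\
  unity_on C V (fun u => P *m L (s0 + S *m u) *m S) (fun u => P *m e (s0 + S *m u)).
Proof.
move=> oU oV VU PS nij uni LS PL De.
have rL := nij.1; have re := uni.1.
have tor := (nijenhuis_pointwise oU rL).1 nij; have un := (unity_pointwise oU rL re).1 uni.
have rs : regular_mx C V (fun u => s0 + S *m u).
  apply: regular_mx_add => //; first exact: regular_mx_cst.
  by apply: regular_mx_mul => //; [exact: regular_mx_cst | exact: regular_mx_id].
have rLs := regular_mx_comp oV oU VU rL rs; have res := regular_mx_comp oV oU VU re rs.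
have rL' : regular_mx C V (fun u => P *m L (s0 + S *m u) *m S).
  apply: regular_mx_mul => //; last exact: regular_mx_cst.
  by apply: regular_mx_mul => //; exact: regular_mx_cst.
have re' : regular_mx C V (fun u => P *m e (s0 + S *m u)).
  by apply: regular_mx_mul => //; exact: regular_mx_cst.
have ds u v : mx_derive (fun u => s0 + S *m u) u v (S *m v).
  have := mx_derive_add (mx_derive_cst s0 u v) (mx_derive_mul (mx_derive_cst S u v) (mx_derive_id u v)).
  by rewrite mul0mx !add0r.
have dL' u v : V u -> mx_derive (fun u => P *m L (s0 + S *m u) *m S) u v (P *m 'D_(S *m v) L (s0 + S *m u) *m S).
  move=> Vu; have d2 := mx_derive_chain (ds u v) (regular_mx_diff (VU u Vu) rL).
  have clean (X Y : 'M[R]_n) (Z : 'M[R]_(k, n)) : (0 *m X + P *m Y) *m S + Z *m 0 = P *m Y *m S.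
    by rewrite mul0mx add0r mulmx0 addr0.
  exact: mx_derive_eq (mx_derive_mul (mx_derive_mul (mx_derive_cst P u v) d2) (mx_derive_cst S u v)) (clean _ _ _).
have je' u : V u -> jac (fun u => P *m e (s0 + S *m u)) u = P *m jac e (s0 + S *m u) *m S.
  move=> Vu; apply: jac_of => v; have de := regular_mx_diff (VU u Vu) re.
  have d2 := mx_derive_chain (ds u v) de; rewrite (jacE _ de) in d2.
  have clean (X Y : 'cV[R]_n) : 0 *m X + P *m Y = P *m Y by rewrite mul0mx add0r.
  apply: mx_derive_eq (mx_derive_mul (mx_derive_cst P u v) d2) _.
  by rewrite clean !mulmxA.
split.
  apply/(nijenhuis_pointwise oV rL') => u Vu a b; have Ux := VU u Vu.
  rewrite /torsion_form !(mx_derive_val (dL' _ _ Vu)).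
  have Sl (v : 'cV[R]_k) : S *m (P *m L (s0 + S *m u) *m S *m v) = L (s0 + S *m u) *m (S *m v).
    by rewrite [RHS]mulmxA LS // mulmxA.
  rewrite (Sl a) (Sl b).
  have T := tor _ Ux (S *m a) (S *m b); rewrite /torsion_form in T.
  apply: etrans _ (etrans (congr1 (mulmx P) T) (mulmx0 _ _)).
  move: (LS _ Ux) (PL _ Ux) => {T Sl} ls pl; move: (L (s0 + S *m u)) ls pl ('D_(_ *m (S *m a)) L _)
    ('D_(_ *m (S *m b)) L _) ('D_(S *m a) L _) ('D_(S *m b) L _) => l ls pl D1 D2 D3 D4.
  have K (D : 'M[R]_n) (v : 'cV[R]_k) : P *m l *m S *m (P *m D *m S *m v) = P *m (l *m (D *m (S *m v))).
    by rewrite !mulmxA -pl.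
  by rewrite !K (mulmxBr P) (mulmxDr P) (mulmxBr P) !mulmxA.
apply/(unity_pointwise oV rL' re') => u Vu; have Ux := VU u Vu.
rewrite /unity_form (mx_derive_val (dL' _ _ Vu)) je' //.
have T := un _ Ux; rewrite /unity_form in T; rewrite -De //.
apply: etrans _ (etrans (congr1 (fun X => P *m X *m S) T) _); last by rewrite mulmx1.
move: (LS _ Ux) (PL _ Ux) => {T} ls pl; move: (L (s0 + S *m u)) ls pl ('D_(_) L _) (jac e _) => l ls pl D J.
have -> : P *m J *m S *m (P *m l *m S) = P *m (J *m l) *m S.
  by rewrite -!mulmxA; congr (_ *m (_ *m _)); rewrite [RHS]ls !mulmxA.
have -> : P *m l *m S *m (P *m J *m S) = P *m (l *m J) *m S by rewrite !mulmxA -pl.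
by rewrite (mulmxDr P) (mulmxBr P) mulmxDl mulmxBl.
Qed.

(** * The splitting theorem *)

Lemma ulsubmx_linear (R : realType) m1 m2 n1 n2 (a : R) (A B : 'M[R]_(m1 + m2, n1 + n2)) :
  ulsubmx (a *: A + B) = a *: ulsubmx A + ulsubmx B.
Proof. by apply/matrixP => i j; rewrite !mxE. Qed.

Lemma drsubmx_linear (R : realType) m1 m2 n1 n2 (a : R) (A B : 'M[R]_(m1 + m2, n1 + n2)) :
  drsubmx (a *: A + B) = a *: drsubmx A + drsubmx B.
Proof. by apply/matrixP => i j; rewrite !mxE. Qed.

Lemma mx_derive_zero (R : realType) (V : normedModType R) (U : set V) p q (F : V -> 'M[R]_(p, q)) x v A :
  open U -> U x -> (forall y, U y -> F y = 0) -> mx_derive F x v A -> A = 0.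
Proof.
move=> oU Ux F0 dF.
have [_ <-] := mx_derive_ext (G := fun _ => 0) oU Ux F0 dF; exact: derive_cst.
Qed.

(** The domain is shrunk to a ball in the new coordinates on which the two blocks
    keep disjoint spectra, in the form of invertible Sylvester operators. *)
Lemma local_splitting (R : realType) (C : category) m1 m2 (U : set 'cV[R]_(m1 + m2))
    (L : 'cV[R]_(m1 + m2) -> 'M[R]_(m1 + m2)) x0 (Q : 'M[R]_(m1 + m2)) (A1 : 'M[R]_m1) (A2 : 'M[R]_m2) :
  open U -> U x0 -> nijenhuis_on C U L ->
  Q \in unitmx -> invmx Q *m L x0 *m Q = block_mx A1 0 0 A2 ->
  sylvester A1 A2 \in unitmx -> sylvester A2 A1 \in unitmx ->
  exists (W : set 'cV[R]_(m1 + m2)) (psi g : 'cV[R]_(m1 + m2) -> 'cV[R]_(m1 + m2)) (rho : R),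
    let B := [set y | `|y - psi x0| < rho] in [/\ [/\ 0 < rho, open W, W x0 & W `<=` U],
      regular_mx C W psi /\ regular_mx C B g,
      (forall x, W x -> B (psi x) /\ g (psi x) = x) /\ (forall y, B y -> W (g y) /\ psi (g y) = y),
      jac psi x0 = invmx Q &
      forall y, B y -> jac psi (g y) \in unitmx /\ exists M1 M2,
        [/\ jac psi (g y) *m L (g y) = block_mx M1 0 0 M2 *m jac psi (g y),
            sylvester M1 M2 \in unitmx & sylvester M2 M1 \in unitmx]].
Proof.
move=> oU Ux0 nij uQ L0 uS1 uS2; have rL := nij.1.
have tor := (nijenhuis_pointwise oU rL).1 nij.
have [V [psi [[oV Vx0] VU rpsi j0 HM]]] := splitting_map oU Ux0 rL tor uQ L0 uS1 uS2.
have uj : jac psi x0 \in unitmx by rewrite j0 unitmx_inv.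
have [r [g [r0 rg g0 Hg [W0 oW0 [W0x HW0]]]]] := inverse_function oV Vx0 rpsi uj.
pose B r := [set y : 'cV[R]_(m1 + m2) | `|y - psi x0| < r].
have oB : open (B r) by exact: open_norm.
have B0 : B r (psi x0) by rewrite /B /= subrr normr0.
have Vg y : B r y -> V (g y) by move=> /Hg[].
have rJ : regular_mx C (B r) (fun y => jac psi (g y)).
  by apply: (regular_mx_comp oB oV Vg _ rg); exact: regular_jac.
pose K y := jac psi (g y) *m L (g y) *m invmx (jac psi (g y)).
have rK : regular_mx C (B r) K.
  apply: regular_mx_mul => //; last by apply: regular_invmx => // y /Hg[].
  apply: regular_mx_mul => //; apply: (regular_mx_comp oB oU _ rL rg) => y /Vg; exact: VU.
have [k11 _ _ k22] := regular_block oB rK.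
have oS := open_unitmx oB (regular_sylvester oB k11 k22).
have oS' := open_unitmx oB (regular_sylvester oB k22 k11).
have oG := open_preimage oB rg oW0.
have K0 : K (psi x0) = block_mx A1 0 0 A2 by rewrite /K g0 j0 invmxK.
have [S1 S2] : sylvester (ulsubmx (K (psi x0))) (drsubmx (K (psi x0))) \in unitmx /\
    sylvester (drsubmx (K (psi x0))) (ulsubmx (K (psi x0))) \in unitmx.
  by rewrite K0 block_mxKul block_mxKdr.
have S3 : W0 (g (psi x0)) by rewrite g0.
have [rho rho0 Hrho] := open_dist (openI (openI oS oS') oG)
  (conj (conj (conj B0 S1) (conj B0 S2)) (conj B0 S3)).
have rpsiW : regular_mx C W0 psi by apply: regular_mx_sub rpsi => x /HW0[].
have oW := open_preimage oW0 rpsiW (@open_norm R 'cV[R]_(m1 + m2) (psi x0) rho).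
exists [set x | W0 x /\ `|psi x - psi x0| < rho], psi, g, rho; split => //.
- split=> //; first by split=> //; rewrite subrr normr0.
  by move=> x [/HW0[Vx _ _] _]; exact: VU.
- split; first by apply: regular_mx_sub rpsiW => x [].
  by apply: regular_mx_sub rg => y /Hrho[_ []].
- split=> [x [/HW0[_ _ gx] xr]|y yr] //.
  have [_ [Br Wg]] := Hrho y yr; have [_ pg _] := Hg y Br.
  by split=> //; split=> //; rewrite pg.
move=> y yr; have [[[Br s1] [_ s2]] _] := Hrho y yr; have [Vgy _ ujy] := Hg y Br; split=> //.
have [M1 [M2 HE]] := HM _ Vgy; exists M1, M2.
have KE : K y = block_mx M1 0 0 M2 by rewrite /K HE mulmxK.
by rewrite KE block_mxKul block_mxKdr in s1 s2.
Qed.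

Section ChartComposition.
Context {R : realType} {C : category} {n : nat} {M : manifold R C n}.

Lemma open_within (T U : topologicalType) (A : set T) (f : T -> U) (S : set U) :
  open A -> {within A, continuous f} -> open S -> open [set x | A x /\ S (f x)].
Proof.
move=> oA cf oS; rewrite openE => x [Ax Sx].
have fx : {for x, continuous f}.
  by move: cf; rewrite continuous_open_subspace // => /(_ x (mem_set Ax)).
have H1 : nbhs x A by apply: open_nbhs_nbhs.
have H2 := fx S (open_nbhs_nbhs (conj oS Sx)).
exact: filterI H1 H2.
Qed.

Lemma continuous_at_within (T U : topologicalType) (A : set T) (f : T -> U) x :
  open A -> {within A, continuous f} -> A x -> {for x, continuous f}.
Proof. by move=> oA; rewrite continuous_open_subspace // => H Ax; exact: (H x (mem_set Ax)). Qed.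

Lemma within_open (T U : topologicalType) (A : set T) (f : T -> U) :
  open A -> (forall x, A x -> {for x, continuous f}) -> {within A, continuous f}.
Proof. by move=> oA H; rewrite continuous_open_subspace // => x /set_mem; exact: H. Qed.

Lemma transition_dom_open (phi psi : chart R M n) : open (transition_dom phi psi).
Proof.
exact: open_within (@chart_open_cod R _ _ phi) (@chart_inv_cont R _ _ phi) (@chart_open_dom R _ _ psi).
Qed.

(** The transition maps of the new chart are those of phi composed with psi or
    with g. *)
Lemma chart_comp (phi : chart R M n) (W B : set 'cV[R]_n) (psi g : 'cV[R]_n -> 'cV[R]_n) :
  coordinate_system phi -> open W -> W `<=` chart_cod phi -> open B ->
  regular_mx C W psi -> regular_mx C B g ->
  (forall x, W x -> B (psi x) /\ g (psi x) = x) -> (forall y, B y -> W (g y) /\ psi (g y) = y) ->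
  exists u : chart R M n, [/\ coordinate_system u, chart_cod u = B,
    (forall q, chart_dom u q <-> chart_dom phi q /\ W (phi q)) &
    (forall q, u q = psi (phi q))].
Proof.
move=> cphi oW Wphi oB rpsi rg HW HB.
pose D := [set q | chart_dom phi q /\ W (phi q)].
have oD : open D by exact: open_within (@chart_open_dom R _ _ phi) (@chart_map_cont R _ _ phi) oW.
have p1 q : D q -> B (psi (phi q)) by move=> [_ /HW[]].
have p2 y : B y -> D (chart_inv phi (g y)).
  move=> /HB[Wy _]; split; first exact: chart_inv_dom (Wphi _ Wy).
  by rewrite chart_invK //; exact: Wphi.
have p3 q : D q -> chart_inv phi (g (psi (phi q))) = q.
  by move=> [Dq /HW[_ ->]]; exact: chart_mapK.
have p4 y : B y -> psi (phi (chart_inv phi (g y))) = y.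
  by move=> /HB[Wy gy]; rewrite chart_invK //; exact: Wphi.
have p5 : {within D, continuous (fun q => psi (phi q))}.
  apply: within_open => // q [Dq Wq].
  apply: (@continuous_comp _ _ _ (fun q => phi q) psi).
    exact: continuous_at_within (@chart_open_dom R _ _ phi) (@chart_map_cont R _ _ phi) Dq.
  exact: regular_mx_continuous Wq rpsi.
have p6 : {within B, continuous (fun y => chart_inv phi (g y))}.
  apply: within_open => // y By.
  apply: (@continuous_comp _ _ _ g (chart_inv phi)); first exact: regular_mx_continuous By rg.
  apply: continuous_at_within (@chart_open_cod R _ _ phi) (@chart_inv_cont R _ _ phi) _.
  by apply: Wphi; have [] := HB y By.
pose u := @Chart R M n D B (fun q => psi (phi q)) (fun y => chart_inv phi (g y)) oD oB p1 p2 p3 p4 p5 p6.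
exists u; split=> // chi Achi; have [c1 c2] := cphi chi Achi; split.
  have m1 y : transition_dom u chi y -> transition_dom phi chi (g y).
    by move=> [By Dy]; split=> //; apply: Wphi; have [] := HB y By.
  have rg' : regular_mx C (transition_dom u chi) g by apply: regular_mx_sub rg => y [].
  exact: (regular_mx_comp (@transition_dom_open u chi) (@transition_dom_open phi chi) m1 c1 rg').
have m2 x : transition_dom chi u x -> W (transition chi phi x) by move=> [_ []].
have rt : regular_mx C (transition_dom chi u) (transition chi phi).
  by apply: regular_mx_sub c2 => x [cx [Dx _]].
exact: (regular_mx_comp (@transition_dom_open chi u) oW m2 rpsi rt).
Qed.

End ChartComposition.

Section Factors.
Context {R : realType} {m1 m2 : nat}.

Definition incl1 : 'M[R]_(m1 + m2, m1) := col_mx 1%:M 0.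
Definition incl2 : 'M[R]_(m1 + m2, m2) := col_mx 0 1%:M.
Definition proj1 : 'M[R]_(m1, m1 + m2) := row_mx 1%:M 0.
Definition proj2 : 'M[R]_(m2, m1 + m2) := row_mx 0 1%:M.

Lemma mul_proj1 k (X : 'M[R]_(m1 + m2, k)) : proj1 *m X = usubmx X.
Proof. by rewrite -{1}[X]vsubmxK mul_row_col mul1mx mul0mx addr0. Qed.

Lemma mul_proj2 k (X : 'M[R]_(m1 + m2, k)) : proj2 *m X = dsubmx X.
Proof. by rewrite -{1}[X]vsubmxK mul_row_col mul1mx mul0mx add0r. Qed.

Lemma mul_incl1 k (X : 'M[R]_(k, m1 + m2)) : X *m incl1 = lsubmx X.
Proof. by rewrite -{1}[X]hsubmxK mul_row_col mulmx1 mulmx0 addr0. Qed.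

Lemma mul_incl2 k (X : 'M[R]_(k, m1 + m2)) : X *m incl2 = rsubmx X.
Proof. by rewrite -{1}[X]hsubmxK mul_row_col mulmx1 mulmx0 add0r. Qed.

Lemma incl1_mul k (v : 'M[R]_(m1, k)) : incl1 *m v = col_mx v 0.
Proof. by rewrite /incl1 mul_col_mx mul1mx mul0mx. Qed.

Lemma incl2_mul k (v : 'M[R]_(m2, k)) : incl2 *m v = col_mx 0 v.
Proof. by rewrite /incl2 mul_col_mx mul1mx mul0mx. Qed.

Lemma proj1_incl1 : proj1 *m incl1 = 1%:M.
Proof. by rewrite mul_proj1 col_mxKu. Qed.

Lemma proj2_incl2 : proj2 *m incl2 = 1%:M.
Proof. by rewrite mul_proj2 col_mxKd. Qed.

Lemma invariant_factors (l : 'M[R]_(m1 + m2)) b1 b2 : l = block_mx b1 0 0 b2 ->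
  [/\ l *m incl1 = incl1 *m (proj1 *m l *m incl1), proj1 *m l = proj1 *m l *m incl1 *m proj1,
      l *m incl2 = incl2 *m (proj2 *m l *m incl2) & proj2 *m l = proj2 *m l *m incl2 *m proj2].
Proof.
move=> ->; rewrite !mul_proj1 !mul_proj2 !mul_incl1 !mul_incl2 incl1_mul incl2_mul.
rewrite {2 3 6 7}block_mxEv !col_mxKu !col_mxKd !row_mxKl !row_mxKr !block_mxEh !row_mxKl !row_mxKr.
by split=> //; rewrite mul_mx_row mulmx1 mulmx0.
Qed.

Lemma factor_direction (D : 'cV[R]_(m1 + m2) -> 'M[R]_(m1 + m2)) (w : 'cV[R]_(m1 + m2)) :
  (forall u v, D (u + v) = D u + D v) ->
  (forall v2, ulsubmx (D (col_mx 0 v2)) = 0) -> (forall v1, drsubmx (D (col_mx v1 0)) = 0) ->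
  proj1 *m D w *m incl1 = proj1 *m D (incl1 *m (proj1 *m w)) *m incl1 /\
  proj2 *m D w *m incl2 = proj2 *m D (incl2 *m (proj2 *m w)) *m incl2.
Proof.
move=> lD z1 z2; have wE : w = col_mx (usubmx w) 0 + col_mx 0 (dsubmx w).
  by rewrite add_col_mx addr0 add0r vsubmxK.
rewrite !mul_proj1 !mul_proj2 !mul_incl1 !mul_incl2 incl1_mul incl2_mul {1 3}wE lD.
have addu (X Y : 'M[R]_(m1 + m2)) : ulsubmx (X + Y) = ulsubmx X + ulsubmx Y.
  by apply/matrixP => i j; rewrite !mxE.
have addd (X Y : 'M[R]_(m1 + m2)) : drsubmx (X + Y) = drsubmx X + drsubmx Y.
  by apply/matrixP => i j; rewrite !mxE.
by rewrite -!/(ulsubmx _) -!/(drsubmx _) addu addd z1 z2 addr0 add0r.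
Qed.

End Factors.

(** The derivatives of each block, and of each component of e, in the variables
    of the other factor lie in the kernel of an invertible Sylvester operator.
    The ball is convex, and it is a product of balls for the sup norm, so each
    block and each component depends on its own variables only. *)
Lemma split_fields (R : realType) (C : category) m1 m2 (c : 'cV[R]_(m1 + m2)) (rho : R)
    (L : 'cV[R]_(m1 + m2) -> 'M[R]_(m1 + m2)) (e : 'cV[R]_(m1 + m2) -> 'cV[R]_(m1 + m2))
    (B := [set y | `|y - c| < rho]) : 0 < rho ->
  nijenhuis_on C B L -> unity_on C B L e ->
  (forall y, B y -> exists M1 M2, [/\ L y = block_mx M1 0 0 M2,
    sylvester M1 M2 \in unitmx & sylvester M2 M1 \in unitmx]) ->
  exists (L1 : 'cV[R]_m1 -> 'M[R]_m1) (L2 : 'cV[R]_m2 -> 'M[R]_m2)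
    (e1 : 'cV[R]_m1 -> 'cV[R]_m1) (e2 : 'cV[R]_m2 -> 'cV[R]_m2),
    let U1 := [set usubmx x | x in B] in let U2 := [set dsubmx x | x in B] in
    [/\ (forall u1 u2, B (col_mx u1 u2) -> L (col_mx u1 u2) = block_mx (L1 u1) 0 0 (L2 u2)),
        nijenhuis_on C U1 L1 /\ nijenhuis_on C U2 L2,
        (forall u1 u2, B (col_mx u1 u2) -> e (col_mx u1 u2) = col_mx (e1 u1) (e2 u2)) &
        unity_on C U1 L1 e1 /\ unity_on C U2 L2 e2].
Proof.
move=> rho0 nij uni LuE.
have oB : open B by exact: open_norm.
have rL := nij.1; have re := uni.1.
have tor := (nijenhuis_pointwise oB rL).1 nij; have un := (unity_pointwise oB rL re).1 uni.
pose D y v := 'D_v L y.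
have dL y v : B y -> mx_derive L y v (D y v) by move=> By; exact: mx_derive_regular rL By.
have Dlin y a v w : B y -> D y (a *: v + w) = a *: D y v + D y w.
  by move=> By; rewrite /D deriveDv ?deriveZv //; exact: (dL y 0 By).1.
have Dblock y v : B y -> D y v = block_mx (ulsubmx (D y v)) 0 0 (drsubmx (D y v)).
  move=> By; rewrite -{1}[D y v]submxK; congr block_mx.
    apply: (mx_derive_zero oB By _ (mx_derive_rsub (mx_derive_usub (dL y v By)))) => z Bz.
    by have [M1 [M2 [-> _ _]]] := LuE z Bz; rewrite -/(ursubmx _) block_mxKur.
  apply: (mx_derive_zero oB By _ (mx_derive_lsub (mx_derive_dsub (dL y v By)))) => z Bz.
  by have [M1 [M2 [-> _ _]]] := LuE z Bz; rewrite -/(dlsubmx _) block_mxKdl.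
have DL y : B y -> (forall v2, ulsubmx (D y (col_mx 0 v2)) = 0) /\ (forall v1, drsubmx (D y (col_mx v1 0)) = 0).
  move=> By; have [M1 [M2 [LE s1 s2]]] := LuE y By.
  apply: (@block_torsion R m1 m2 M1 M2 (fun v => ulsubmx (D y v)) (fun v => drsubmx (D y v))
    (L y) (D y) s1 s2 LE).
  - by move=> v; exact: Dblock.
  - by move=> a v w; rewrite Dlin // ulsubmx_linear.
  - by move=> a v w; rewrite Dlin // drsubmx_linear.
  exact: tor.
have De y : B y -> ursubmx (jac e y) = 0 /\ dlsubmx (jac e y) = 0.
  move=> By; have [M1 [M2 [LE s1 s2]]] := LuE y By.
  have := un y By; rewrite /unity_form -/(D y _) Dblock // LE; exact: block_unity s1 s2.
pose c1' := usubmx c; pose c2' := dsubmx c.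
have s1E (u1 : 'cV[R]_m1) : col_mx 0 c2' + incl1 *m u1 = col_mx u1 c2'.
  by rewrite incl1_mul add_col_mx add0r addr0.
have s2E (u2 : 'cV[R]_m2) : col_mx c1' 0 + incl2 *m u2 = col_mx c1' u2.
  by rewrite incl2_mul add_col_mx addr0 add0r.
have ballE (u1 : 'cV[R]_m1) (u2 : 'cV[R]_m2) : B (col_mx u1 u2) <-> `|u1 - c1'| < rho /\ `|u2 - c2'| < rho.
  by rewrite /B /= -{1}[c]vsubmxK opp_col_mx add_col_mx; exact: col_mx_lt.
have V1E : [set usubmx x | x in B] = [set u1 : 'cV[R]_m1 | `|u1 - c1'| < rho].
  apply/seteqP; split=> [u1 [x Bx <-]|u1 ur] /=.
    by move: Bx; rewrite -{1}[x]vsubmxK => /ballE[].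
  by exists (col_mx u1 c2'); rewrite ?col_mxKu //; apply/ballE; rewrite subrr normr0.
have V2E : [set dsubmx x | x in B] = [set u2 : 'cV[R]_m2 | `|u2 - c2'| < rho].
  apply/seteqP; split=> [u2 [x Bx <-]|u2 ur] /=.
    by move: Bx; rewrite -{1}[x]vsubmxK => /ballE[].
  by exists (col_mx c1' u2); rewrite ?col_mxKd //; apply/ballE; rewrite subrr normr0.
have B1 (u1 : 'cV[R]_m1) : `|u1 - c1'| < rho -> B (col_mx 0 c2' + incl1 *m u1).
  by move=> ur; rewrite s1E; apply/ballE; rewrite subrr normr0.
have B2 (u2 : 'cV[R]_m2) : `|u2 - c2'| < rho -> B (col_mx c1' 0 + incl2 *m u2).
  by move=> ur; rewrite s2E; apply/ballE; rewrite subrr normr0.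
have LS y : B y -> [/\ L y *m incl1 = incl1 *m (proj1 *m L y *m incl1),
    proj1 *m L y = proj1 *m L y *m incl1 *m proj1,
    L y *m incl2 = incl2 *m (proj2 *m L y *m incl2) & proj2 *m L y = proj2 *m L y *m incl2 *m proj2].
  by move=> By; have [M1 [M2 [LE _ _]]] := LuE y By; exact: invariant_factors LE.
have DD y : B y -> proj1 *m D y (e y) *m incl1 = proj1 *m D y (incl1 *m (proj1 *m e y)) *m incl1 /\
    proj2 *m D y (e y) *m incl2 = proj2 *m D y (incl2 *m (proj2 *m e y)) *m incl2.
  move=> By; apply: (factor_direction (D := D y)) (DL y By).1 (DL y By).2 => v w.
  by apply: deriveDv; exact: (dL y 0 By).1.
have [nij1 uni1] : nijenhuis_on C [set u1 : 'cV[R]_m1 | `|u1 - c1'| < rho] (fun u1 => proj1 *m L (col_mx 0 c2' + incl1 *m u1) *m incl1) /\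
    unity_on C [set u1 : 'cV[R]_m1 | `|u1 - c1'| < rho] (fun u1 => proj1 *m L (col_mx 0 c2' + incl1 *m u1) *m incl1)
      (fun u1 => proj1 *m e (col_mx 0 c2' + incl1 *m u1)).
  apply: (slice_fields oB (@open_norm R 'cV[R]_m1 c1' rho) B1 (@proj1_incl1 R m1 m2) nij uni) => y By.
  - by have [] := LS y By.
  - by have [] := LS y By.
  exact: (DD y By).1.
have [nij2 uni2] : nijenhuis_on C [set u2 : 'cV[R]_m2 | `|u2 - c2'| < rho] (fun u2 => proj2 *m L (col_mx c1' 0 + incl2 *m u2) *m incl2) /\
    unity_on C [set u2 : 'cV[R]_m2 | `|u2 - c2'| < rho] (fun u2 => proj2 *m L (col_mx c1' 0 + incl2 *m u2) *m incl2)
      (fun u2 => proj2 *m e (col_mx c1' 0 + incl2 *m u2)).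
  apply: (slice_fields oB (@open_norm R 'cV[R]_m2 c2' rho) B2 (@proj2_incl2 R m1 m2) nij uni) => y By.
  - by have [] := LS y By.
  - by have [] := LS y By.
  exact: (DD y By).2.
have shift1 (u1 : 'cV[R]_m1) (u2 : 'cV[R]_m2) : B (col_mx u1 u2) ->
    B (col_mx u1 c2') /\ col_mx u1 c2' - col_mx u1 u2 = col_mx 0 (c2' - u2) :> 'cV[R]_(m1 + m2).
  move=> /ballE[b1 _]; split; first by apply/ballE; rewrite subrr normr0.
  by rewrite opp_col_mx add_col_mx subrr.
have shift2 (u1 : 'cV[R]_m1) (u2 : 'cV[R]_m2) : B (col_mx u1 u2) ->
    B (col_mx c1' u2) /\ col_mx c1' u2 - col_mx u1 u2 = col_mx (c1' - u1) 0 :> 'cV[R]_(m1 + m2).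
  move=> /ballE[_ b2]; split; first by apply/ballE; rewrite subrr normr0.
  by rewrite opp_col_mx add_col_mx subrr.
have de y v : B y -> mx_derive e y v (jac e y *m v) by move=> By; exact: mx_derive_jac re By.
exists (fun u1 => proj1 *m L (col_mx 0 c2' + incl1 *m u1) *m incl1),
  (fun u2 => proj2 *m L (col_mx c1' 0 + incl2 *m u2) *m incl2),
  (fun u1 => proj1 *m e (col_mx 0 c2' + incl1 *m u1)), (fun u2 => proj2 *m e (col_mx c1' 0 + incl2 *m u2)).
rewrite V1E V2E; split => //.
- move=> u1 u2 Bu; have [b1 e1] := shift1 u1 u2 Bu; have [b2 e2] := shift2 u1 u2 Bu.
    rewrite s1E s2E mul_proj1 mul_incl1 mul_proj2 mul_incl2 -/(ulsubmx _) -/(drsubmx _).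
    have <- : ulsubmx (L (col_mx u1 u2)) = ulsubmx (L (col_mx u1 c2')).
      apply: (@const_on_ball R (m1 + m2) m1 m1 c rho (fun y => ulsubmx (L y))) => // z Bz.
      rewrite e1; apply: mx_derive_eq (mx_derive_lsub (mx_derive_usub (dL z _ Bz))) _.
      exact: (DL z Bz).1.
    have <- : drsubmx (L (col_mx u1 u2)) = drsubmx (L (col_mx c1' u2)).
      apply: (@const_on_ball R (m1 + m2) m2 m2 c rho (fun y => drsubmx (L y))) => // z Bz.
      rewrite e2; apply: mx_derive_eq (mx_derive_rsub (mx_derive_dsub (dL z _ Bz))) _.
      exact: (DL z Bz).2.
    by have [M1 [M2 [-> _ _]]] := LuE _ Bu; rewrite block_mxKul block_mxKdr.
move=> u1 u2 Bu; have [b1 e1] := shift1 u1 u2 Bu; have [b2 e2] := shift2 u1 u2 Bu.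
rewrite s1E s2E mul_proj1 mul_proj2.
have <- : usubmx (e (col_mx u1 u2)) = usubmx (e (col_mx u1 c2')).
  apply: (@const_on_ball R (m1 + m2) m1 1 c rho (fun y => usubmx (e y))) => // z Bz.
  rewrite e1; apply: mx_derive_eq (mx_derive_usub (de z _ Bz)) _.
  by rewrite -[jac e z]submxK mul_block_col col_mxKu mulmx0 add0r (De z Bz).1 mul0mx.
have <- : dsubmx (e (col_mx u1 u2)) = dsubmx (e (col_mx c1' u2)).
  apply: (@const_on_ball R (m1 + m2) m2 1 c rho (fun y => dsubmx (e y))) => // z Bz.
  rewrite e2; apply: mx_derive_eq (mx_derive_dsub (de z _ Bz)) _.
  by rewrite -[jac e z]submxK mul_block_col col_mxKd mulmx0 addr0 (De z Bz).2 mul0mx.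
by rewrite vsubmxK.
Qed.

Theorem theorem2p1 (R : realType) (C : category) (m1 m2 : nat)
    (M : manifold R C (m1 + m2)) (L : operator_field M) (e : vector_field M)
    (hLe : nijenhuis_with_unity L e)
    (p : M) (chi1 chi2 : {poly R})
    (hchi : char_poly_at L p (chi1 * chi2))
    (mon1 : chi1 \is monic) (mon2 : chi2 \is monic)
    (hcop : coprimep chi1 chi2)
    (deg1 : size chi1 = m1.+1) (deg2 : size chi2 = m2.+1) :
  exists (u : chart R M (m1 + m2))
    (L1 : 'cV[R]_m1 -> 'M[R]_m1) (L2 : 'cV[R]_m2 -> 'M[R]_m2)
    (e1 : 'cV[R]_m1 -> 'cV[R]_m1) (e2 : 'cV[R]_m2 -> 'cV[R]_m2),
    let U := chart_cod u in
    let U1 := [set usubmx x | x in U] in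
    let U2 := [set dsubmx x | x in U] in
    [/\ coordinates_at p u,
        [/\ forall u1 u2, U (col_mx u1 u2) ->
              L u (col_mx u1 u2) = block_mx (L1 u1) 0 0 (L2 u2),
            nijenhuis_on C U1 L1 /\ nijenhuis_on C U2 L2,
            char_poly (L1 (usubmx (u p))) = chi1
          & char_poly (L2 (dsubmx (u p))) = chi2],
        forall u1 u2, U (col_mx u1 u2) ->
          e u (col_mx u1 u2) = col_mx (e1 u1) (e2 u2)
      & unity_on C U1 L1 e1 /\ unity_on C U2 L2 e2].
Proof.
have [phi [[cphi Dp] cp]] := hchi.
have [Q [A1 [A2 [uQ L0 c1 c2]]]] := block_diagonalization cp mon1 mon2 hcop deg1 deg2.
have uS1 : sylvester A1 A2 \in unitmx by apply: sylvester_unit; rewrite c1 c2.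
have uS2 : sylvester A2 A1 \in unitmx by apply: sylvester_unit; rewrite c1 c2 coprimep_sym.
have [W [psi [g [rho []]]]] := local_splitting (@chart_open_cod R _ _ phi) (@chart_map_cod R _ _ phi p Dp) (hLe.1 phi cphi) uQ L0 uS1 uS2.
set c := psi (phi p); set B := [set y | _] => -[rho0 oW W0 Wphi] [rpsi rg] [HW HB] j0 HM.
have oB : open B by exact: open_norm.
have [u [cu codu domu mapu]] := chart_comp cphi oW Wphi oB rpsi rg HW HB.
have up : u p = c by rewrite mapu.
have Bc : B c by rewrite /B /= subrr normr0.
(* In the new chart the matrix of L is conjugated by the Jacobian of psi, which
   intertwines it with a block diagonal matrix. *)
have conj y : B y -> jac psi (g y) *m L phi (g y) = L u y *m jac psi (g y).
  move=> By; have [Wy gy] := HB y By.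
  have tE z : W z -> psi z = transition phi u z.
    by move=> Wz; rewrite /transition mapu chart_invK //; exact: Wphi.
  have td : transition_dom phi u (g y).
    split; first exact: Wphi.
    by apply/domu; split; [exact: chart_inv_dom (Wphi _ Wy) | rewrite chart_invK //; exact: Wphi].
  have dt v : 'd (transition phi u) (g y) v = jac psi (g y) *m v.
    have [dT <-] := mx_derive_ext oW Wy tE (mx_derive_jac v rpsi Wy).
    by rewrite deriveE.
  apply: mulmx_ext => v; rewrite -!mulmxA.
  by have := @op_transform R C _ M L phi u cphi cu (g y) td v; rewrite !dt -tE // gy.
have LuE y : B y -> exists M1 M2, [/\ L u y = block_mx M1 0 0 M2,
    sylvester M1 M2 \in unitmx & sylvester M2 M1 \in unitmx].
  move=> By; have [uj [M1 [M2 [E s1 s2]]]] := HM y By; exists M1, M2; split => //.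
  by apply: (can_inj (mulmxK uj)); rewrite /= -E conj.
have gc : g c = phi p by have [] := HW _ W0.
(* The Jacobian at the base point is Q^-1, so there the matrix of L is the one
   that Q block diagonalises. *)
have Luc : L u c = block_mx A1 0 0 A2.
  have := conj c Bc; rewrite gc j0 => E.
  by rewrite -L0 E mulmxKV.
have nij : nijenhuis_on C B (L u) by rewrite -codu; exact: hLe.1.
have uni : unity_on C B (L u) (e u) by rewrite -codu; exact: hLe.2.
have [L1 [L2 [e1 [e2 [HL HN He HU]]]]] := split_fields rho0 nij uni LuE.
exists u, L1, L2, e1, e2; rewrite codu up; split => //; first by split=> //; apply/domu.
have := HL (usubmx c) (dsubmx c); rewrite vsubmxK Luc => /(_ Bc) /eq_block_mx[E1 _ _ E2].
by split=> //; rewrite -?E1 -?E2.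
Qed.
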